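(* Let $K,N$ be negative numbers and let $D\ge\pi\sqrt{(N-1)/K}$. Then there exist a sequence $\{f_n\}_{n\in\mathbb{N}}$ of smooth functions on the circle $\mathbb{S}^1$ and an mm-space $(Y,d_Y,\mu_Y)$ consisting of two points with $\operatorname{diam}Y=D$ such that the sequence of mm-spaces $\{(X_n,d_{X_n},\mu_{X_n})\}_{n\in\mathbb{N}}$ defined by $$(X_n,d_{X_n},\mu_{X_n}):=(\mathbb{S}^1,d_g,e^{-f_n}\mathrm{vol}_g),$$ where $g$ is the canonical metric on $\mathbb{S}^1$ scaled so that $\operatorname{diam}\mathbb{S}^1=D$, satisfies the $\mathrm{CD}(K,N)$ condition (that is, each $X_n$ does) and $\Box$-converges to $(Y,d_Y,\mu_Y)$.
   Context: **Notation.** $d_g$ and $\mathrm{vol}_g$ are the Riemannian distance and the volume measure of the Riemannian metric $g$. **mm-spaces.** An mm-space is a triple $(X,d_X,\mu_X)$ where $(X,d_X)$ is a complete separable metric space and $\mu_X$ is a Borel probability measure on $X$ (so in the claim each $e^{-f_n}\mathrm{vol}_g$ is a probability measure). Two mm-spaces are mm-isomorphic if there is an isometry $f:\operatorname{supp}\mu_X\to\operatorname{supp}\mu_Y$ with $f_*\mu_X=\mu_Y$. **Box convergence.** Let $I=[0,1)$ with Lebesgue measure $\mathcal{L}^1$. A parameter of $X$ is a Borel map $\varphi:I\to X$ with $\varphi_*\mathcal{L}^1=\mu_X$ (every mm-space has one). The box distance $\Box(X,Y)$ is the infimum of $\varepsilon>0$ for which there exist a Borel set $\tilde I\subset I$ and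 parameters $\varphi:I\to X$, $\psi:I\to Y$ with $\mathcal{L}^1(\tilde I)\ge1-\varepsilon$ and $|d_X(\varphi(s),\varphi(t))-d_Y(\psi(s),\psi(t))|\le\varepsilon$ for all $s,t\in\tilde I$. $X_n$ $\Box$-converges to $Y$ if $\Box(X_n,Y)\to0$. **Wasserstein space.** $\mathcal{P}(X)$ is the set of Borel probability measures on $X$, $\mathcal{P}_2(X)$ those with finite second moment, $W_2$ the $L^2$-Wasserstein distance on $\mathcal{P}_2(X)$, and $\mathrm{Opt}(\nu_0,\nu_1)$ the set of optimal couplings of $\nu_0,\nu_1$ (couplings on $X\times X$ minimizing $\int d_X^2\,d\pi$). A geodesic $\{\nu_t\}_{t\in[0,1]}$ satisfies $W_2(\nu_s,\nu_t)=|s-t|W_2(\nu_0,\nu_1)$. **Distortion coefficients.** For $\kappa\in\mathbb{R}$ let $\omega_\kappa=\pi/\sqrt\kappa$ if $\kappa>0$ and $\omega_\kappa=\infty$ if $\kappa\le0$. For $\theta\ge0$ let $s_\kappa(\theta)=\frac{\sin\sqrt\kappa\theta}{\sqrt\kappa\theta}$ if $\kappa>0$, $s_0(\theta)=1$, $s_\kappa(\theta)=\frac{\sinh\sqrt{-\kappa}\theta}{\sqrt{-\kappa}\theta}$ if $\kappa<0$ (value $1$ at $\theta=0$). For $K\in\mathbb{R}$, $N<0$, $t\in[0,1]$, $\theta\ge0$, put $$\tau_{K,N}^{(t)}(\theta)=\begin{cases}t\left(\dfrac{s_{K/(N-1)}(t\theta)}{s_{K/(N-1)}(\theta)}\right)^{1-\frac1N}&(\theta<\omega_{K/(N-1)})\\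 \infty&(\theta\ge\omega_{K/(N-1)}),\end{cases}$$ and $\tau_{K,N}^{(t),0}=\tau_{K,N}^{(1-t)}$, $\tau_{K,N}^{(t),1}=\tau_{K,N}^{(t)}$. **Rényi entropy.** For $N<0$ and $\mu\in\mathcal{P}(X)$, $S_{N,\mu}(\nu)=\int_X\rho^{1-\frac1N}d\mu$ if $\nu=\rho\mu$, and $S_{N,\mu}(\nu)=\infty$ if $\nu$ is not absolutely continuous with respect to $\mu$. $\mathcal{D}(S_{N,\mu})=\{\nu\in\mathcal{P}(X) : S_{N,\mu}(\nu)<\infty\}$. **$\mathrm{CD}(K,N)$ condition ($K\in\mathbb{R}$, $N<0$).** $(X,d_X,\mu_X)$ satisfies the $\mathrm{CD}(K,N)$ condition if for any $\nu_0=\rho_0\mu_X,\ \nu_1=\rho_1\mu_X\in\mathcal{P}_2(X)\cap\mathcal{D}(S_{N,\mu_X})$ there exist a geodesic $\{\nu_t\}_{t\in[0,1]}$ in $(\mathcal{P}_2(X),W_2)$ from $\nu_0$ to $\nu_1$ and $\pi\in\mathrm{Opt}(\nu_0,\nu_1)$ such that $$S_{N',\mu_X}(\nu_t)\le\sum_{i=0}^1\int_{X\times X}\tau_{K,N'}^{(t),i}(d_X(x_0,x_1))\,\rho_i(x_i)^{-\frac1{N'}}\,d\pi(x_0,x_1)$$ for any $t\in[0,1]$ and any $N'\in[N,0)$ with $\nu_0,\nu_1\in\mathcal{D}(S_{N',\mu_X})$. *)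

(* Defs.v *)
From HB Require Import structures.
From mathcomp Require Import all_boot all_order all_algebra.
From mathcomp Require Import all_classical all_reals all_analysis.
From mathcomp Require Import measurable_realfun ring lra.

Set Implicit Arguments.
Unset Strict Implicit.
Unset Printing Implicit Defensive.

Import Order.TTheory GRing.Theory Num.Theory.
Import numFieldNormedType.Exports.

Local Open Scope classical_set_scope.
Local Open Scope ring_scope.

#[short(type="completePMetricType")]
HB.structure Definition CompletePMetric (R : numDomainType) :=
  {T of Metric R T & Complete T & Pointed T}.

Notation borel X := (g_sigma_algebraType (@open X)).

Record mmspace (R : realType) := MMSpace {
  mm_space :> completePMetricType R;
  mm_separable : exists2 S : set mm_space, countable S & dense S;
  mm_measure : probability (borel mm_space) R }.

Section mm_spaces.
Local Open Scope ereal_scope.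
Variable R : realType.
Implicit Types X Y : mmspace R.

Definition mm_supp X : set X :=
  [set x | forall U : set X, open U -> U x -> 0 < mm_measure X U].

Definition diam (T : metricType R) : \bar R :=
  ereal_sup [set (mdist xy.1 xy.2)%:E | xy in [set: T * T]].

Definition unit_interval : set R := `[0%R, 1%R[.

(* Only the values of [phi] on [0, 1) matter. *)
Definition parameter X (phi : R -> borel X) :=
  measurable_fun unit_interval phi /\
  forall A : set (borel X), measurable A ->
    lebesgue_measure (unit_interval `&` phi @^-1` A) = mm_measure X A.

Definition box_admissible X Y (e : R) :=
  exists (J : set R) (phi : R -> borel X) (psi : R -> borel Y),
    [/\ measurable J, J `<=` unit_interval, parameter phi, parameter psi &
        (1 - e)%:E <= lebesgue_measure J /\
        forall s t, J s -> J t ->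
          (`| mdist (phi s : X) (phi t) - mdist (psi s : Y) (psi t) | <= e)%R].

Definition box X Y : \bar R :=
  ereal_inf [set e%:E | e in [set e : R | (0 < e)%R /\ box_admissible X Y e]].

Definition box_cvg (X_ : nat -> mmspace R) Y :=
  box (X_ n) Y @[n --> \oo] --> 0.

End mm_spaces.
Arguments mm_supp {R} X.

Section wasserstein.
Local Open Scope ereal_scope.
Variables (R : realType) (X : mmspace R).
Implicit Types nu : probability (borel X) R.

(* A measure in the library is specified only by its values on measurable
   sets, hence this replaces equality of records. *)
Definition same_measure nu nu' :=
  forall A : set (borel X), measurable A -> nu A = nu' A.

Definition finite_second_moment nu :=
  exists x0 : X, \int[nu]_x (mdist x0 (x : X) ^+ 2)%:E < +oo.

(* X is separable, so the product sigma-algebra is the Borel one. *)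
Definition coupling nu0 nu1 (p : probability (borel X * borel X)%type R) :=
  forall A : set (borel X), measurable A ->
    p (A `*` setT) = nu0 A /\ p (setT `*` A) = nu1 A.

Definition transport_cost (p : probability (borel X * borel X)%type R) :=
  \int[p]_z (mdist (z.1 : X) (z.2 : X) ^+ 2)%:E.

Definition W2 nu0 nu1 : \bar R :=
  sqrte (ereal_inf [set transport_cost p | p in coupling nu0 nu1]).

Definition optimal_coupling nu0 nu1 p :=
  coupling nu0 nu1 p /\
  forall p', coupling nu0 nu1 p' -> transport_cost p <= transport_cost p'.

Definition P2_geodesic nu0 nu1 (nu : R -> probability (borel X) R) :=
  [/\ same_measure (nu 0%R) nu0, same_measure (nu 1%R) nu1,
      forall t, (0 <= t <= 1)%R -> finite_second_moment (nu t) &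
      forall s t, (0 <= s <= 1)%R -> (0 <= t <= 1)%R ->
        W2 (nu s) (nu t) = `|s - t|%:E * W2 nu0 nu1].

End wasserstein.

Section distortion.
Variable R : realType.
Implicit Types K N k t theta : R.

Definition omega k : \bar R :=
  if 0 < k then (pi / Num.sqrt k)%:E else +oo%E.

Definition sinh (x : R) : R := (expR x - expR (- x)) / 2.

Definition sfun k theta : R :=
  if theta == 0 then 1
  else if 0 < k then sin (Num.sqrt k * theta) / (Num.sqrt k * theta)
  else if k < 0 then sinh (Num.sqrt (- k) * theta) / (Num.sqrt (- k) * theta)
  else 1.

Definition tau K N t theta : \bar R :=
  let k := K / (N - 1) in
  if (theta%:E < omega k)%E
  then (t * (sfun k (t * theta) / sfun k theta) `^ (1 - N^-1))%:E
  else +oo%E.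

End distortion.

Section curvature_dimension.
Local Open Scope charge_scope.
Local Open Scope ereal_scope.
Variables (R : realType) (X : mmspace R).
Let mu := mm_measure X.
Implicit Types nu : probability (borel X) R.

Definition has_density nu (rho : X -> R) :=
  [/\ measurable_fun [set: borel X] rho, forall x, (0 <= rho x)%R &
      forall A : set (borel X), measurable A ->
        nu A = \int[mu]_(x in A) (rho x)%:E].

(* Densities of [nu] agree [mu]-almost everywhere, so the integral does not
   depend on the choice of the Radon-Nikodym derivative. *)
Definition renyi (N : R) nu : \bar R :=
  if `[< nu `<< mu >]
  then \int[mu]_x ('d (charge_of_finite_measure nu) '/d mu x) `^ (1 - N^-1)
  else +oo.

Definition CD (K N : R) :=
  forall nu0 nu1 (rho0 rho1 : X -> R),
    has_density nu0 rho0 -> has_density nu1 rho1 ->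
    finite_second_moment nu0 -> finite_second_moment nu1 ->
    renyi N nu0 < +oo -> renyi N nu1 < +oo ->
  exists (nu : R -> probability (borel X) R)
         (p : probability (borel X * borel X)%type R),
    [/\ P2_geodesic nu0 nu1 nu, optimal_coupling nu0 nu1 p &
      forall t N', (0 <= t <= 1)%R -> (N <= N' < 0)%R ->
        renyi N' nu0 < +oo -> renyi N' nu1 < +oo ->
        renyi N' (nu t) <=
          \int[p]_z (tau K N' (1 - t) (mdist (z.1 : X) (z.2 : X)) *
                     (rho0 z.1 `^ (- N'^-1))%:E) +
          \int[p]_z (tau K N' t (mdist (z.1 : X) (z.2 : X)) *
                     (rho1 z.2 `^ (- N'^-1))%:E)].

End curvature_dimension.

(* The unit circle of R^2; D only serves to select the metric. *)
Definition circle (R : realType) (D : {posnum R}) : Type :=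
  {p : R * R | p.1 ^+ 2 + p.2 ^+ 2 == 1}.

Section circle.
Variables (R : realType) (D : {posnum R}).
Local Notation S1 := (circle D).

HB.instance Definition _ :=
  Choice.copy S1 {p : R * R | p.1 ^+ 2 + p.2 ^+ 2 == 1}.

Lemma circle_point_subproof :
  (1 : R, 0 : R).1 ^+ 2 + (1 : R, 0 : R).2 ^+ 2 == 1.
Proof. by rewrite /= expr1n expr0n addr0. Qed.

HB.instance Definition _ := isPointed.Build S1
  (exist _ (1, 0) circle_point_subproof).

Lemma circle_param_subproof (s : R) : let a := pi * s / D%:num in
  (cos a, sin a).1 ^+ 2 + (cos a, sin a).2 ^+ 2 == 1.
Proof. by rewrite /= cos2Dsin2. Qed.

(* Parametrization by arc length: the metric is that of a circle of radius
   D / pi, hence of length 2 D and diameter D. *)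
Definition circle_param (s : R) : S1 :=
  exist _ (_, _) (circle_param_subproof s).

Definition abscissa (p : S1) : R := (val p).1.
Definition ordinate (p : S1) : R := (val p).2.

Definition dot (p q : S1) : R :=
  abscissa p * abscissa q + ordinate p * ordinate q.

(* Geodesics are arcs: the distance is the radius times the angle. *)
Definition circle_dist (p q : S1) : R := D%:num / pi * acos (dot p q).

Let radius_gt0 : 0 < D%:num / pi.
Proof. by rewrite divr_gt0// pi_gt0. Qed.

Lemma circleE (p : S1) : abscissa p ^+ 2 + ordinate p ^+ 2 = 1.
Proof. by apply/eqP; case: p. Qed.

Lemma dot_cross (p q : S1) :
  dot p q ^+ 2 + (abscissa p * ordinate q - ordinate p * abscissa q) ^+ 2 = 1.
Proof.
have -> : 1 = (abscissa p ^+ 2 + ordinate p ^+ 2) *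
              (abscissa q ^+ 2 + ordinate q ^+ 2) by rewrite !circleE mulr1.
by rewrite /dot; ring.
Qed.

Lemma dot_itv (p q : S1) : -1 <= dot p q <= 1.
Proof.
move: (dot p q) (dot_cross p q) => d h.
have d1 : d ^+ 2 <= 1 by rewrite -h lerDl sqr_ge0.
by apply/andP; split; nra.
Qed.

Lemma dotC (p q : S1) : dot p q = dot q p.
Proof. by rewrite /dot; ring. Qed.

Lemma circle_dist_xx p : circle_dist p p = 0.
Proof.
by rewrite /circle_dist /dot -!expr2 circleE acos1 mulr0.
Qed.

Lemma circle_dist_positivity p q : circle_dist p q = 0 -> p = q.
Proof.
move=> /eqP; rewrite mulf_eq0 gt_eqF//= => /eqP a0.
have d1 : dot p q = 1.
  by rewrite -(@acosK _ (dot p q)) ?a0 ?cos0// in_itv/= dot_itv.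
have hp := circleE p; have hq := circleE q.
move: d1 hp hq; rewrite /dot => d1 hp hq.
have /eqP : (abscissa p - abscissa q) ^+ 2 + (ordinate p - ordinate q) ^+ 2 = 0.
  transitivity (abscissa p ^+ 2 + ordinate p ^+ 2 +
    (abscissa q ^+ 2 + ordinate q ^+ 2) -
    2 * (abscissa p * abscissa q + ordinate p * ordinate q)); first by ring.
  by rewrite hp hq d1; ring.
rewrite paddr_eq0 ?sqr_ge0// !sqrf_eq0 !subr_eq0 => /andP[/eqP ex /eqP ey].
apply: val_inj; rewrite (surjective_pairing (val p)).
rewrite -[(val p).1]/(abscissa p) -[(val p).2]/(ordinate p) ex ey.
exact/esym/surjective_pairing.
Qed.

Lemma circle_distC p q : circle_dist p q = circle_dist q p.
Proof. by rewrite /circle_dist dotC. Qed.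

Lemma circle_dist_triangle q p r :
  circle_dist p r <= circle_dist p q + circle_dist q r.
Proof.
rewrite /circle_dist -mulrDr ler_pM2l//.
set a := acos (dot p q); set b := acos (dot q r).
have a0 : 0 <= a by rewrite acos_ge0// dot_itv.
have b0 : 0 <= b by rewrite acos_ge0// dot_itv.
have [abpi|piab] := leP (a + b) pi; last first.
  by rewrite (le_trans _ (ltW piab))// acos_lepi// dot_itv.
rewrite leNgt; apply/negP => ltac.
have : cos (acos (dot p r)) < cos (a + b).
  rewrite ltr_cos// in_itv/= ?acos_ge0 ?acos_lepi ?dot_itv//.
  by rewrite addr_ge0.
rewrite acosK ?in_itv/= ?dot_itv// cosD.
rewrite /a /b !acosK ?in_itv/= ?dot_itv// !sin_acos ?dot_itv//.
pose u := abscissa p * ordinate q - ordinate p * abscissa q.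
pose v := abscissa q * ordinate r - ordinate q * abscissa r.
have -> : 1 - dot p q ^+ 2 = u ^+ 2 by rewrite -(dot_cross p q) /u; ring.
have -> : 1 - dot q r ^+ 2 = v ^+ 2 by rewrite -(dot_cross q r) /v; ring.
rewrite !sqrtr_sqr -normrM.
have -> : dot p r = dot p q * dot q r - u * v.
  rewrite -[LHS]mulr1.
  have -> : 1 = abscissa q ^+ 2 + ordinate q ^+ 2 by rewrite circleE.
  by rewrite /dot /u /v; ring.
by rewrite ltrD2l ltrN2 ltNge ler_norm.
Qed.

HB.instance Definition _ := @isMetric.Build R S1 circle_dist
  circle_dist_xx circle_dist_positivity circle_distC circle_dist_triangle.

Lemma circle_mdistE (p q : S1) : mdist p q = circle_dist p q.
Proof. by []. Qed.

Lemma acos_cos_le (x : R) : acos (cos x) <= `|x|.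
Proof.
have [xpi|pix] := leP `|x| pi.
  by rewrite -cos_norm cosK// in_itv/= normr_ge0.
by rewrite (le_trans _ (ltW pix))// acos_lepi// cos_geN1 cos_le1.
Qed.

Lemma circle_param_dist s t :
  mdist (circle_param s) (circle_param t) =
  D%:num / pi * acos (cos (pi * (s - t) / D%:num)).
Proof. by rewrite circle_mdistE /circle_dist /dot/= -cosB; do 3 congr (_ _); lra. Qed.

Lemma radius_norm (x : R) : D%:num / pi * `|pi * x / D%:num| = `|x|.
Proof.
rewrite -[in LHS](gtr0_norm radius_gt0) -normrM; congr `|_|.
have pi0 : pi != 0 :> R by rewrite gt_eqF ?pi_gt0.
by move: pi pi0 => c c0; field; rewrite c0 gt_eqF.
Qed.

Lemma circle_param_lip s t :
  mdist (circle_param s) (circle_param t) <= `|s - t|.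
Proof.
rewrite circle_param_dist -(radius_norm (s - t)).
by rewrite ler_wpM2l ?acos_cos_le// ltW.
Qed.

Lemma circle_param_isometry s t : `|s - t| <= D%:num ->
  mdist (circle_param s) (circle_param t) = `|s - t|.
Proof.
move=> stD; rewrite circle_param_dist -cos_norm cosK ?radius_norm//.
rewrite in_itv/= normr_ge0/= -(ler_pM2l radius_gt0) radius_norm.
by rewrite divfK// gt_eqF// pi_gt0.
Qed.

Lemma circle_param_continuous : continuous circle_param.
Proof.
move=> s; apply/metricType_numDomainType.cvgrPdist_lt => e e0.
near=> t; apply: le_lt_trans (circle_param_lip _ _) _.
by near: t; apply: cvgr_dist_lt.
Unshelve. all: by end_near. Qed.

Lemma circle_param_surj p : exists2 s, s \in `[0, 2 * D%:num] & circle_param s = p.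
Proof.
have hp := circleE p; pose a := acos (abscissa p).
have x1 : -1 <= abscissa p <= 1.
  have : abscissa p ^+ 2 <= 1 by rewrite -hp lerDl sqr_ge0.
  by move: (abscissa p) => x x1; apply/andP; split; nra.
have sa : sin a = `|ordinate p|.
  by rewrite sin_acos// -sqrtr_sqr; congr Num.sqrt; lra.
have ca : cos a = abscissa p by rewrite acosK// in_itv.
have a0 : 0 <= a by exact: acos_ge0.
have api : a <= pi by exact: acos_lepi.
have pi0 := pi_gt0 R; have D0 : 0 < D%:num by [].
pose s (c : R) := D%:num * c / pi.
have sE c : pi * s c / D%:num = c by rewrite /s; move: pi pi0 => x x0; field; rewrite !gt_eqF.
have sI c : 0 <= c <= pi *+ 2 -> s c \in `[0, 2 * D%:num].
  move=> /andP[c0 c2]; rewrite in_itv/= divr_ge0 ?mulr_ge0//=; last exact: ltW.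
  by rewrite /s ler_pdivrMr// [2 * _]mulrC -mulrA ler_pM2l// mulr_natl.
have [y0|y0] := leP 0 (ordinate p).
  exists (s a); first by apply: sI; rewrite a0 (le_trans api)// mulr2n; lra.
  apply: val_inj; rewrite /= sE ca sa ger0_norm//; exact/esym/surjective_pairing.
exists (s (- a + pi *+ 2)); first by apply: sI; rewrite mulr2n; apply/andP; split; lra.
apply: val_inj; rewrite /= sE cosD2pi sinD2pi cosN sinN ca sa ltr0_norm// opprK.
exact/esym/surjective_pairing.
Qed.

Lemma circle_compact : compact [set: S1].
Proof.
have -> : [set: S1] = circle_param @` `[0, 2 * D%:num].
  apply/seteqP; split=> // p _.
  by have [s sI <-] := circle_param_surj p; exists s.
apply: continuous_compact; last exact: segment_compact.
exact/continuous_subspaceT/circle_param_continuous.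
Qed.

HB.instance Definition _ := Uniform_isComplete.Build S1
  (fun F FF cF => compact_cauchy_cvg FF cF filterT circle_compact).

Lemma circle_separable : exists2 S : set S1, countable S & dense S.
Proof.
exists (circle_param @` range (@ratr R)).
  by do 2 apply: (sub_countable (card_image_le _ _)); exact: countableP.
move=> V [p Vp] oV; have [s _ sp] := circle_param_surj p.
have oU : open (circle_param @^-1` V).
  by apply: open_comp oV => ? _; exact: circle_param_continuous.
have [|x [Vx [r _ rx]]] := dense_rat _ oU.
  by exists s; rewrite /= sp.
rewrite -rx in Vx.
by exists (circle_param (ratr r)); split => //; exists (ratr r) => //; exists r.
Qed.

Lemma measurable_circle_param :
  measurable_fun [set: R] (circle_param : R -> borel S1).
Proof.
apply: (@measurability _ _ _ (borel S1) _ _ (@open S1)) => //.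
move=> _ [U oU <-]; rewrite setTI; apply: open_measurable.
by apply: open_comp oU => ? _; exact: circle_param_continuous.
Qed.

Definition circle_vol : set (borel S1) -> \bar R :=
  pushforward (mrestr lebesgue_measure (measurable_itv `[0, 2 * D%:num[))
    (circle_param : R -> borel S1).

Let circle_vol0 : circle_vol set0 = 0%E.
Proof. by rewrite /circle_vol /pushforward preimage_set0 measure0. Qed.

Let circle_vol_ge0 A : (0 <= circle_vol A)%E.
Proof. by rewrite /circle_vol /pushforward measure_ge0. Qed.

Let circle_vol_sigma_additive : semi_sigma_additive circle_vol.
Proof.
apply: measure_semi_sigma_additive; exact: measurable_circle_param.
Qed.

HB.instance Definition _ := isMeasure.Build _ _ _ circle_vol
  circle_vol0 circle_vol_ge0 circle_vol_sigma_additive.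

(* [circle_param] is a local diffeomorphism onto the circle. *)
Definition smooth (f : S1 -> R) :=
  forall (n : nat) (s : R), derivable (derive1n n (f \o circle_param)) s 1.

Definition circle_mm (mu : probability (borel S1) R) : mmspace R :=
  MMSpace circle_separable mu.

Lemma circle_volT : circle_vol [set: borel S1] = (2 * D%:num)%:E.
Proof.
rewrite /circle_vol /pushforward /mrestr preimage_setT setTI.
by rewrite lebesgue_measure_itv/= lte_fin mulr_gt0// sube0.
Qed.

Lemma circle_diam : diam S1 = D%:num%:E.
Proof.
apply/eqP; rewrite eq_le; apply/andP; split.
  apply: ge_ereal_sup => _ [[p q] _ <-]; rewrite lee_fin circle_mdistE/=.
  rewrite /circle_dist -[leRHS](@divfK _ pi) ?gt_eqF ?pi_gt0// ler_pM2l//.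
  by rewrite acos_lepi// dot_itv.
apply: ereal_sup_ubound; exists (circle_param 0, circle_param D%:num) => //=.
by rewrite circle_param_isometry sub0r normrN ger0_norm.
Qed.

End circle.

Arguments circle_vol {R} D.

(* Main.v *)
(* Lift everything to the line by arc length. Two laws with densities on the
   circle have distribution functions F0, F1 with F(x + 2D) = F(x) + 1, and the
   monotone plans between them are the pairs (S z, 2z - S z), z being the
   midpoint, with F1 (2z - S z) = F0 (S z) + a. For one value of a the function
   z - S z has mean 0, hence a periodic primitive, whose conjugates for the
   squared distance are Kantorovich potentials: that plan is optimal and
   (1 - t) S z + t (2z - S z) is a geodesic. A change of variables expresses the
   density of the interpolated law, and the CD(K, N) inequality becomes a
   pointwise one that follows from Jensen's inequality and Sturm comparison for
   h = exp (f / (1 - N')), as soon as f'' + f'^2 / (1 - N) >= K.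

   For f = ln Z + (1 - N) / 2 ln (cos^2 (pi s / D) + b^2) this condition holds
   because (pi / D)^2 <= K / (N - 1). When b tends to 0, the normalization Z
   diverges, and the density e^{-f}, which is D-periodic, concentrates with mass
   1/2 at each of the two antipodal zeros of the cosine. *)

Require Import Defs.
From HB Require Import structures.
From mathcomp Require Import all_boot all_order all_algebra.
From mathcomp Require Import all_classical all_reals all_analysis.
From mathcomp Require Import measurable_realfun ring lra.

Set Implicit Arguments.
Unset Strict Implicit.
Unset Printing Implicit Defensive.

Import Order.TTheory GRing.Theory Num.Theory.
Import numFieldNormedType.Exports.

Local Open Scope classical_set_scope.
Local Open Scope ring_scope.

(** * Measures and primitives on the line *)

(** The squared distance of the circle is a minimum over lifts, so an inequality between potentials
    has to hold against all translates of a point. On the line, monotonicity gives it for the convex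
    primitives of the two ends; it descends to the circle when their deviation from z^2 is periodic,
    hence the condition on the mean.

    Both ends of the plan are Lipschitz in the midpoint, so they have densities, and the
    Monge-Ampere equation becomes a uniqueness statement: F0 (S z) and F1 (2z - S z) differ by a
    constant, so their densities agree almost everywhere.

    The weight comes from the model h = |cos (pi s / D)|, which solves h'' + (pi / D)^2 h = 0
    between its zeros. For h = exp (f / (1 - N)) one has e^{-f} = h^{N-1}, which is not integrable
    at a zero because N - 1 < -1. Replacing h by sqrt (h^2 + b^2) makes f smooth and keeps h'' + (pi
    / D)^2 h >= 0.

    At distances where the distortion coefficients are infinite, the pointwise inequality is
    trivial; at smaller distances the sine comparison applies. *)

Section measures.
Context d (T : measurableType d) (R : realType).
Local Open Scope ereal_scope.

Lemma exists_weighted_measure (mu : {measure set T -> \bar R}) (g : T -> \bar R) :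
  measurable_fun [set: T] g -> (forall x, 0 <= g x) ->
  exists nu : {measure set T -> \bar R}, forall A, nu A = \int[mu]_(x in A) g x.
Proof.
move=> mg g0; pose nu A := \int[mu]_(x in A) g x.
have nu0 : nu set0 = 0 by rewrite /nu integral_set0.
have nu_ge0 A : 0 <= nu A by exact: integral_ge0.
have snu : semi_sigma_additive nu by exact: semi_sigma_additive_nng_induced.
pose mix := @isMeasure.Build _ T R nu nu0 nu_ge0 snu.
by exists (HB.pack_for {measure set T -> \bar R} nu mix).
Qed.

Lemma exists_weighted_finite (mu : {measure set T -> \bar R}) (g : T -> \bar R) :
  measurable_fun [set: T] g -> (forall x, 0 <= g x) ->
  \int[mu]_x g x < +oo ->
  exists nu : {finite_measure set T -> \bar R},
    forall A, nu A = \int[mu]_(x in A) g x.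
Proof.
move=> mg g0 gfin; have [nu nuE] := exists_weighted_measure mu mg g0.
have nuT : nu setT < +oo by rewrite nuE.
(* Restricting to the whole space changes no value and turns the bound on the total mass into the
   structure of a finite measure. *)
exists (mfrestr measurableT nuT) => A.
by rewrite -nuE /= /mfrestr /mrestr setIT.
Qed.

Lemma exists_weighted_probability (mu : {measure set T -> \bar R}) (g : T -> \bar R) :
  measurable_fun [set: T] g -> (forall x, 0 <= g x) ->
  \int[mu]_x g x = 1 ->
  exists nu : probability T R, forall A, nu A = \int[mu]_(x in A) g x.
Proof.
move=> mg g0 g1; pose nu A := \int[mu]_(x in A) g x.
have nu0 : nu set0 = 0 by rewrite /nu integral_set0.
have nu_ge0 A : 0 <= nu A by exact: integral_ge0.
have snu : semi_sigma_additive nu by exact: semi_sigma_additive_nng_induced.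
pose mix := @isMeasure.Build _ T R nu nu0 nu_ge0 snu.
pose nu' := HB.pack_for {measure set T -> \bar R} nu mix.
pose mix1 := @Measure_isProbability.Build _ T R nu' g1.
by exists (HB.pack_for (probability T R) nu mix mix1).
Qed.

Lemma exists_pushforward d' (T' : measurableType d') (m : {measure set T -> \bar R})
    (f : T -> T') : measurable_fun [set: T] f ->
  exists nu : {measure set T' -> \bar R}, forall A, nu A = m (f @^-1` A).
Proof.
move=> mf; pose nu A := m (f @^-1` A).
have nu0 : nu set0 = 0 by rewrite /nu preimage_set0 measure0.
have nu_ge0 A : 0 <= nu A by exact: measure_ge0.
have snu : semi_sigma_additive nu.
  rewrite (_ : nu = pushforward m f)//.
  by apply: measure_semi_sigma_additive; exact: mf.
pose mix := @isMeasure.Build _ T' R nu nu0 nu_ge0 snu.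
by exists (HB.pack_for {measure set T' -> \bar R} nu mix).
Qed.

Lemma exists_pushforward_probability d' (T' : measurableType d')
    (m : probability T R) (f : T -> T') : measurable_fun [set: T] f ->
  exists nu : probability T' R, forall A, nu A = m (f @^-1` A).
Proof.
move=> mf; pose X := HB.pack_for {mfun T >-> T'} f (isMeasurableFun.Build _ _ _ _ f mf).
by exists (distribution m X).
Qed.

Lemma density_dominated (mu nu : {measure set T -> \bar R}) (g : T -> \bar R) :
  measurable_fun [set: T] g ->
  (forall A, measurable A -> nu A = \int[mu]_(x in A) g x) -> nu `<< mu.
Proof.
move=> mg nuE; apply/null_content_dominatesP => A mA A0.
rewrite nuE//; apply: null_set_integral => //.
exact: measurable_funTS.
Qed.

(** The Radon-Nikodym derivative supplies the formula, and it agrees with [g] almost everywhere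
    because both have the same integral on every measurable set. *)
Lemma density_integral (mu : {sigma_finite_measure set T -> \bar R})
    (nu : {finite_measure set T -> \bar R}) (g f : T -> \bar R) :
  measurable_fun [set: T] g -> (forall x, 0 <= g x) ->
  (forall A, measurable A -> nu A = \int[mu]_(x in A) g x) ->
  measurable_fun [set: T] f -> (forall x, 0 <= f x) ->
  \int[nu]_x f x = \int[mu]_x (f x * g x).
Proof.
move=> mg g0 nuE mf f0.
have numu := density_dominated mg nuE.
rewrite -(Radon_Nikodym_SigmaFinite.change_of_variables numu)//.
have mRN := measurable_int _ (Radon_Nikodym_SigmaFinite.f_integrable numu).
apply: ae_eq_integral => //; try exact: emeasurable_funM.
apply: ae_eqe_mul2l; apply: integral_ae_eq => //.
  exact: Radon_Nikodym_SigmaFinite.f_integrable.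
move=> E _ mE; rewrite -nuE//.
by rewrite (Radon_Nikodym_SigmaFinite.f_integral numu).
Qed.

End measures.

Section lebesgue.
Context (R : realType).
Local Notation leb := (@lebesgue_measure R).

Lemma ocitv_measure_unique (m1 m2 : {measure set (measurableTypeR R) -> \bar R}) :
  (forall a b : R, a < b -> m1 `]a, b]%classic = m2 `]a, b]%classic) ->
  (forall a b : R, (m1 `]a, b]%classic < +oo)%E) ->
  forall A, measurable A -> m1 A = m2 A.
Proof.
move=> m12 fin1 A mA.
apply: (@g_sigma_algebra_measure_unique _ R (measurableTypeR R) (@ocitv R) _
  (fun n => `](- n%:R)%R, n%:R%R]%classic)) => //.
- by move=> _ [[a b] _ <-]; exact: measurable_itv.
- by move=> i; exact: is_ocitv.
- rewrite -subTset => x _.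
  have [n xn] : exists n : nat, `|x| < n%:R.
    by exists (Num.truncn `|x|).+1; rewrite truncnS_gt.
  exists n => //=; rewrite in_itv/=.
  by move: xn; rewrite ltr_norml => /andP[-> /ltW ->].
- exact: ocitvI.
- move=> B /ocitvP[->|[[a b]/= ab ->]]; first by rewrite !measure0.
  exact: m12.
Qed.

Lemma lebesgue_shift (c : R) (A : set R) : measurable A ->
  pushforward leb ((fun x : R => x + c) : _ -> measurableTypeR R) A = leb A.
Proof.
move=> mA.
have mc : measurable_fun setT ((fun x : R => x + c) : measurableTypeR R -> measurableTypeR R).
  by apply: measurable_funD.
have [pc pcE] : exists pc : {measure set (measurableTypeR R) -> \bar R},
    forall X, pc X = leb ((fun x : R => x + c) @^-1` X).
  exact: (exists_pushforward leb mc).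
suff h : forall X, ocitv X -> leb X = pc X by rewrite (lebesgue_measure_unique h mA) pcE.
move=> _ [[a b]] _ <-; rewrite pcE/=.
have -> : (fun x => x + c) @^-1` `]a, b]%classic = `](a - c), (b - c)]%classic.
  by apply/seteqP; split => x; rewrite /= !in_itv/= ltrBlDr lerBrDr.
by rewrite !lebesgue_measure_itv/= !lte_fin ltrD2r -!EFinD; case: ifP => // _; congr (_%:E); ring.
Qed.

Lemma integral_shift (f : R -> \bar R) (a b c : R) :
  measurable_fun setT f -> (forall x, 0 <= f x)%E ->
  (\int[leb]_(x in `[(a + c)%R, (b + c)%R]) f x = \int[leb]_(x in `[a, b]) f (x + c)%R)%E.
Proof.
move=> mf f0.
have mc : measurable_fun setT ((fun x : R => x + c) : measurableTypeR R -> measurableTypeR R).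
  by apply: measurable_funD.
have -> : `[a, b]%classic = (fun x => x + c) @^-1` `[(a + c), (b + c)]%classic.
  by apply/seteqP; split => x; rewrite /= !in_itv/= !lerD2r.
rewrite -(ge0_integral_pushforward mc leb)//; last exact: measurable_funTS.
by apply: eq_measure_integral => //= A mA _; rewrite lebesgue_shift.
Qed.

End lebesgue.

Section primitives.
Context (R : realType).
Local Notation leb := (@lebesgue_measure R).

Lemma ray_measure_unique (m1 m2 : {finite_measure set (measurableTypeR R) -> \bar R}) :
  (forall c : R, m1 `]-oo, c]%classic = m2 `]-oo, c]%classic) ->
  forall A, measurable A -> m1 A = m2 A.
Proof.
move=> m12; apply: ocitv_measure_unique => [a b ab|a b]; last first.
  by rewrite ltey_eq fin_num_measure//; exact: measurable_itv.
have -> : `]a, b]%classic = `]-oo, b]%classic `\` `]-oo, a]%classic.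
  apply/seteqP; split => x; rewrite /= !in_itv/=.
    by move=> /andP[ax xb]; split => //; apply/negP; rewrite -ltNge.
  by move=> [-> /negP]; rewrite -ltNge => ->.
have sub : `]-oo, b]%classic `&` `]-oo, a]%classic = `]-oo, a]%classic :> set R.
  apply/seteqP; split => x /=; rewrite !in_itv/=; first by case.
  by move=> xa; split => //; rewrite (le_trans xa)// ltW.
rewrite !measureD; try exact: measurable_itv; last 2 first.
- by rewrite ltey_eq fin_num_measure//; exact: measurable_itv.
- by rewrite ltey_eq fin_num_measure//; exact: measurable_itv.
by rewrite sub; congr (_ - _)%E; exact: m12.
Qed.

(** The integrated form of [F' = g] almost everywhere for an absolutely continuous [F]. It passes
    through changes of variable and determines [g] up to a null set. *)
Definition primitive_on (l u : R) (g F : R -> R) := forall a b : R,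
  l <= a -> a <= b -> b <= u ->
  (\int[leb]_(x in `[a, b]) (g x)%:E = (F b - F a)%:E)%E.

Lemma integral_itv_split (f : R -> \bar R) (a b c : R) :
  measurable_fun setT f -> (forall x, 0 <= f x)%E -> a <= b -> b <= c ->
  (\int[leb]_(x in `[a, c]) f x =
   \int[leb]_(x in `[a, b]) f x + \int[leb]_(x in `[b, c]) f x)%E.
Proof.
move=> mf f0 ab bc.
rewrite -(integral_itv_obnd_cbnd (r := b)); last exact: measurable_funTS.
rewrite -ge0_integral_setU//=; last 2 first.
- exact: measurable_funTS.
- apply/disj_setPS => x; rewrite /= !in_itv/= => -[/andP[_ xb] /andP[bx _]].
  by move: bx; rewrite ltNge xb.
by rewrite -itv_bndbnd_setU// bnd_simp.
Qed.

Lemma exists_primitive (g : R -> R) :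
  measurable_fun setT g -> (forall x, 0 <= g x) ->
  (forall a b, \int[leb]_(x in `[a, b]) (g x)%:E < +oo)%E ->
  exists F : R -> R, [/\ continuous F, {homo F : x y / x <= y} &
    forall l u, primitive_on l u g F].
Proof.
move=> mg g0 gfin.
have mg' : measurable_fun setT (EFin \o g) by exact/measurable_EFinP.
pose I a b := fine (\int[leb]_(x in `[a, b]) (g x)%:E).
have IE a b : (\int[leb]_(x in `[a, b]) (g x)%:E)%E = (I a b)%:E.
  rewrite fineK// ge0_fin_numE//; apply: integral_ge0 => x _; exact: g0.
have I0 a b : 0 <= I a b.
  by rewrite /I fine_ge0// integral_ge0// => x _; exact: g0.
have Isplit a b c : a <= b -> b <= c -> I a c = I a b + I b c.
  move=> ab bc; apply: EFin_inj; rewrite EFinD -!IE.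
  by apply: (integral_itv_split mg') => // x; exact: g0.
have Irev a b : b <= a -> I a b = 0.
  rewrite le_eqVlt => /predU1P[->|ba].
    by rewrite /I set_itv1 integral_set1.
  by rewrite /I set_itv_ge ?integral_set0// bnd_simp -ltNge.
(* The oriented integral from 0: one of the two terms vanishes, according to the sign of [x]. *)
pose F x := I 0 x - I x 0.
have FE a b : a <= b -> F b - F a = I a b.
  move=> ab; rewrite /F.
  have [a0|a0] := leP 0 a; first by
    rewrite (Irev b 0) ?(le_trans a0)// (Irev a 0)// (Isplit 0 a b)//; lra.
  have [b0|b0] := leP b 0.
    by rewrite (Irev 0 b)// (Irev 0 a) ?(ltW a0)// (Isplit a b 0)//; lra.
  by rewrite (Irev b 0) ?(ltW b0)// (Irev 0 a) ?(ltW a0)// (Isplit a 0 b) ?ltW//; lra.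
have Fprim l u : primitive_on l u g F.
  by move=> a b _ ab _; rewrite FE// IE.
exists F; split => //; last by move=> x y xy; rewrite -subr_ge0 FE.
move=> x.
have gint : leb.-integrable `[x - 1, x + 1] (EFin \o g).
  apply/integrableP; split; first exact: measurable_funTS.
  by under eq_integral do rewrite /= ger0_norm//.
have x11 : x - 1 <= x + 1 by lra.
have := parameterized_integral_continuous x11 gint.
move=> /continuous_within_itvP-/(_ ltac:(lra))[+ _ _].
move=> /(_ x ltac:(rewrite in_itv/=; lra)) cx.
pose G y := F (x - 1) + \int[leb]_(t in `[x - 1, y]) g t.
have FG y : x - 1 <= y -> F y = G y.
  by move=> xy; rewrite /G /Rintegral -/(I (x - 1) y) -FE//; lra.
have cG : G @ x --> G x by apply: cvgD => //; exact: cvg_cst.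
rewrite /continuous_at FG; last by lra.
apply: cvg_trans cG; apply: near_eq_cvg; near=> y; apply/esym/FG.
by near: y; apply: filterS (lt_nbhsr (a := x - 1) _) => [z /ltW//|]; lra.
Unshelve. all: by end_near. Qed.

End primitives.

Section change_of_variable.
Context (R : realType).
Local Notation leb := (@lebesgue_measure R).
Local Open Scope ereal_scope.

Lemma exists_weighted_itv (g : R -> R) (l r : R) :
  measurable_fun setT g -> (forall x, 0 <= g x)%R ->
  \int[leb]_(x in `[l, r]) (g x)%:E < +oo ->
  exists nu : {finite_measure set (measurableTypeR R) -> \bar R},
    (forall A, measurable A ->
       nu A = \int[leb]_(x in `[l, r] `&` A) (g x)%:E) /\
    (forall f : R -> \bar R, measurable_fun [set: R] f -> (forall x, 0 <= f x) ->
       \int[nu]_x f x = \int[leb]_(x in `[l, r]) (f x * (g x)%:E)).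
Proof.
move=> mg g0 gfin; pose h := (fun x => (g x)%:E) \_ `[l, r].
have mh : measurable_fun [set: R] h.
  apply/(measurable_restrictT _ _).1; first exact: measurable_itv.
  by apply: measurable_funTS; exact/measurable_EFinP.
have h0 x : 0 <= h x by rewrite /h patchE; case: ifP => // _; rewrite lee_fin.
have [|nu nuE] := exists_weighted_finite (mu := leb) mh h0.
  by rewrite -integral_mkcond.
exists nu; split => [A mA|f mf f0].
  by rewrite nuE integral_mkcondl.
rewrite (density_integral (mu := leb) mh h0 (fun A _ => nuE A))//.
rewrite [RHS]integral_mkcond; apply: eq_integral => x _.
by rewrite /h !patchE; case: ifP => _; rewrite ?mule0.
Qed.

Lemma primitive_id (l r : R) : primitive_on l r (cst 1%R) id.
Proof.
move=> a b _ ab _; transitivity (leb `[a, b]%classic).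
  by rewrite (@integral_cst _ _ _ leb _ (measurable_itv _) 1) mul1e.
rewrite lebesgue_measure_itv/= lte_fin -EFinB.
by case: ltgtP ab => // -> _; rewrite subrr.
Qed.

(** As [U] is continuous and monotone, the sublevel set is [[l, a]] with [a] its supremum, and [U a]
    is [c] capped at [U r]. The outer maximum covers the case of an empty set. *)
Lemma primitive_ray (u U : R -> R) (l r c : R) : (l <= r)%R ->
  continuous U -> {homo U : x y / (x <= y)%R} -> primitive_on l r u U ->
  \int[leb]_(x in `[l, r] `&` U @^-1` `]-oo, c]) (u x)%:E =
  (Num.max (Num.min c (U r) - U l) 0)%:E.
Proof.
move=> lr cU ndU pU; set A := _ `&` _.
have [cl|lc] := ltP c (U l).
  have -> : A = set0.
    rewrite -subset0 => x [] /=; rewrite !in_itv/= => /andP[lx _] Uxc.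
    by have := ndU _ _ lx; rewrite leNgt (le_lt_trans Uxc cl).
  rewrite integral_set0 max_r// subr_le0.
  by rewrite (le_trans _ (ltW cl))// ge_min lexx.
have Al : A l by split => /=; rewrite in_itv/= ?lexx.
have supA : has_sup A.
  by split; [exists l|exists r => x []; rewrite /= in_itv/= => /andP[]].
set a := sup A.
have la : (l <= a)%R by apply: sup_ubound => //; case: supA.
have ar : (a <= r)%R.
  by apply: ge_sup; [exists l|move=> x []; rewrite /= in_itv/= => /andP[]].
have Uac : (U a <= c)%R.
  rewrite leNgt; apply/negP => cUa.
  have : \forall x \near a, (c < U x)%R by exact: (cvgr_gt _ (cU a)).
  move=> [e /= e0 he].
  have [x Ax xe] := sup_adherent e0 supA; rewrite -/a in xe.
  have xa : (x <= a)%R by apply: sup_ubound => //; case: supA.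
  have := he x; rewrite /ball_/= ger0_norm ?subr_ge0//.
  move=> /(_ ltac:(lra)); case: Ax => _ /=; rewrite in_itv/= leNgt.
  by move=> /negbTE ->.
have AE : A = `[l, a]%classic.
  apply/seteqP; split => x /=.
    move=> Ax; rewrite in_itv/=; apply/andP; split.
      by case: Ax => /=; rewrite in_itv/= => /andP[].
    by apply: sup_ubound => //; case: supA.
  rewrite in_itv/= => /andP[lx xa]; split; rewrite /= in_itv/=.
    by rewrite lx (le_trans xa ar).
  by rewrite (le_trans (ndU _ _ xa)).
rewrite AE pU//; congr (_%:E).
have -> : Num.min c (U r) = U a.
  have [|nar] := eqVneq a r; first by move=> <-; rewrite min_r.
  have altr : (a < r)%R by rewrite lt_neqAle nar.
  suff cUa : (c <= U a)%R.
    have -> : c = U a by apply/eqP; rewrite eq_le cUa.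
    by rewrite min_l// ndU.
  rewrite leNgt; apply/negP => Uc.
  have : \forall x \near a, (U x < c)%R by exact: (cvgr_lt _ (cU a)).
  move=> [e /= e0 he].
  pose x := Num.min r (a + e / 2)%R.
  have ax : (a < x)%R by rewrite /x lt_min altr; lra.
  have xe : (x <= a + e / 2)%R by rewrite /x ge_min lexx orbT.
  have : (x <= a)%R.
    apply: sup_ubound; first by case: supA.
    split; rewrite /= in_itv/=.
      by rewrite (le_trans la (ltW ax)) /x ge_min lexx.
    apply/ltW/he; rewrite /ball_/= ltr0_norm ?subr_lt0//; lra.
  by rewrite leNgt ax.
by rewrite max_l// subr_ge0 ndU.
Qed.

(** The image of [u dx] under [U] and Lebesgue measure on [[U l, U r]] give the same mass to every
    ray, by [primitive_ray] for [U] and for the identity. [U] may be flat on intervals; there [u]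
    vanishes almost everywhere. *)
Lemma primitive_change_of_variable (u U : R -> R) (h : R -> \bar R) (l r : R) :
  (l <= r)%R -> measurable_fun setT u -> (forall x, 0 <= u x)%R ->
  continuous U -> {homo U : x y / (x <= y)%R} -> primitive_on l r u U ->
  measurable_fun setT h -> (forall x, 0 <= h x) ->
  \int[leb]_(x in `[l, r]) (h (U x) * (u x)%:E) =
  \int[leb]_(x in `[U l, U r]) h x.
Proof.
move=> lr mu u0 cU ndU pU mh h0.
have mU : measurable_fun setT (U : measurableTypeR R -> measurableTypeR R).
  exact: continuous_measurable_fun.
have [|nu [nuE nuint]] := exists_weighted_itv (l := l) (r := r) mu u0.
  by rewrite pU// ltry.
have [la [laE laint]] : exists nu : {finite_measure set (measurableTypeR R) -> \bar R},
    (forall A, measurable A ->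
       nu A = \int[leb]_(x in `[U l, U r] `&` A) (1%R)%:E) /\
    (forall f : R -> \bar R, measurable_fun [set: R] f -> (forall x, 0 <= f x) ->
       \int[nu]_x f x = \int[leb]_(x in `[U l, U r]) (f x * (1%R)%:E)).
  apply: (@exists_weighted_itv (cst 1%R)) => //.
  by rewrite (primitive_id (lexx _) (ndU _ _ lr) (lexx _)) ltry.
have [nuU nuUE] := exists_pushforward nu mU.
have nuUfin : nuU setT < +oo.
  by rewrite nuUE preimage_setT ltey_eq fin_num_measure.
have mla : forall A, measurable A -> mfrestr measurableT nuUfin A = la A.
  apply: ray_measure_unique => c.
  rewrite /= /mfrestr /mrestr setIT nuUE; etransitivity; first apply: nuE.
    by rewrite -[X in measurable X]setTI; apply: mU => //; exact: measurable_itv.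
  rewrite primitive_ray//; apply/esym; etransitivity; first by apply: laE; exact: measurable_itv.
  apply: (@primitive_ray (cst 1%R) id) => //; [exact: ndU|by move=> ?; exact: cvg_id|exact: primitive_id].
transitivity (\int[la]_x h x); last first.
  by rewrite laint//; apply: eq_integral => x _; rewrite mule1.
transitivity (\int[nuU]_x h x).
  transitivity (\int[nu]_x (h \o U) x).
    by rewrite nuint//=; exact: (measurableT_comp mh (continuous_measurable_fun cU)).
  have := ge0_integral_pushforward mU nu measurableT mh (fun y _ => h0 y).
  rewrite preimage_setT => <-.
  by apply: eq_measure_integral => A mA _; rewrite nuUE.
apply: eq_measure_integral => A mA _.
by rewrite -[RHS](mla _ mA) /= /mfrestr /mrestr setIT.
Qed.

(** Rays determine finite measures, and a measure determines its density up to a null set. This is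
    what yields the Monge-Ampere equation [td_ae]. *)
Lemma primitive_unique (g1 g2 F : R -> R) (l r : R) : (l <= r)%R ->
  measurable_fun setT g1 -> measurable_fun setT g2 ->
  (forall x, 0 <= g1 x)%R -> (forall x, 0 <= g2 x)%R ->
  primitive_on l r g1 F -> primitive_on l r g2 F ->
  ae_eq leb `[l, r]%classic (EFin \o g1) (EFin \o g2).
Proof.
move=> lr mg1 mg2 g10 g20 p1 p2.
have fin1 : \int[leb]_(x in `[l, r]) (g1 x)%:E < +oo by rewrite p1// ltry.
have fin2 : \int[leb]_(x in `[l, r]) (g2 x)%:E < +oo by rewrite p2// ltry.
have [nu1 [nu1E _]] := exists_weighted_itv mg1 g10 fin1.
have [nu2 [nu2E _]] := exists_weighted_itv mg2 g20 fin2.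
have nu12 : forall A, measurable A -> nu1 A = nu2 A.
  apply: ray_measure_unique => c.
  etransitivity; first by apply: nu1E; exact: measurable_itv.
  apply/esym; etransitivity; first by apply: nu2E; exact: measurable_itv.
  have [cl|lc] := ltP c l.
    rewrite (_ : _ `&` _ = set0) ?integral_set0//.
    rewrite -subset0 => x [] /=; rewrite !in_itv/= => /andP[lx _] xc.
    by move: cl; rewrite ltNge (le_trans lx xc).
  rewrite (_ : _ `&` _ = `[l, Num.min c r]%classic).
    by rewrite p1 ?p2// ?le_min ?lc ?lr// ge_min lexx orbT.
  apply/seteqP; split => x /=; rewrite !in_itv/= le_min.
    by move=> [/andP[-> ->] ->].
  by move=> /and3P[-> -> ->].
apply: integral_ae_eq => //.
- apply/integrableP; split; first exact/measurable_EFinP/measurable_funTS.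
  by under eq_integral do rewrite /= ger0_norm//.
- exact/measurable_EFinP/measurable_funTS.
- move=> E El mE; have := nu12 _ mE; rewrite [LHS]nu1E// [RHS]nu2E//.
  by rewrite (setIidr El).
Qed.

End change_of_variable.

Section density.
Context (R : realType).
Local Notation leb := (@lebesgue_measure R).

Lemma lebesgue_stieltjes_itv (F : cumulative R R) (a b : R) : a <= b ->
  lebesgue_stieltjes_measure F `]a, b]%classic = (F b - F a)%:E.
Proof.
move=> ab; rewrite /lebesgue_stieltjes_measure /measure_extension/=.
by rewrite measurable_mu_extE/= ?wlength_itv_bnd//; exact: is_ocitv.
Qed.

Lemma exists_stieltjes_measure (F : R -> R) :
  continuous F -> {homo F : x y / x <= y} ->
  exists nu : {measure set (measurableTypeR R) -> \bar R},
    forall a b, a <= b -> nu `]a, b]%classic = (F b - F a)%:E.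
Proof.
move=> cF ndF; pose mix := isCumulative.Build R _ R F ndF (right_continuousW cF).
pose F' := HB.pack_for (cumulative R R) F mix.
exists (lebesgue_stieltjes_measure F') => a b ab.
exact: (lebesgue_stieltjes_itv F' ab).
Qed.

(** Monotonicity of [C * z - F z] encodes the Lipschitz bound. The Stieltjes measures of the two
    monotone functions add up to [C] times Lebesgue measure, so that of [F] is absolutely
    continuous. *)
Lemma exists_density (F : R -> R) (C l r : R) : 0 <= C ->
  continuous F -> {homo F : x y / x <= y} ->
  {homo (fun z => C * z - F z) : x y / x <= y} ->
  exists f : R -> R, [/\ measurable_fun setT f, forall x, 0 <= f x &
    primitive_on l r f F].
Proof.
move=> C0 cF ndF ndG.
have cG : continuous (fun z => C * z - F z).
  by move=> x; apply: cvgB; [apply: cvgMr; exact: cvg_id|exact: cF].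
have [m mE] := exists_stieltjes_measure cF ndF.
have [m' m'E] := exists_stieltjes_measure cG ndG.
pose sm : {measure set (measurableTypeR R) -> \bar R} := measure_add m m'.
have smE A : sm A = (m A + m' A)%E by exact: measure_addE.
pose dl : {measure set (measurableTypeR R) -> \bar R} := mscale (NngNum C0) leb.
have mm' : forall A, measurable A -> sm A = dl A.
  apply: ocitv_measure_unique => a b; rewrite smE.
    move=> ab; rewrite mE ?m'E ?(ltW ab)// /dl/= /mscale/=.
    by rewrite lebesgue_measure_itv/= lte_fin ab -!EFinD -EFinM; congr (_%:E); ring.
  have [ab|ba] := leP a b; first by rewrite mE// m'E// ltry.
  by rewrite set_itv_ge ?measure0 ?adde0 ?ltry// bnd_simp -leNgt ltW.
have mfin : (m `]l, r]%classic < +oo)%E.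
  have [ab|ba] := leP l r; first by rewrite mE// ltry.
  by rewrite set_itv_ge ?measure0 ?ltry// bnd_simp -leNgt ltW.
have mI : measurable (`]l, r]%classic : set (measurableTypeR R)) by exact: measurable_itv.
pose nu : {finite_measure set (measurableTypeR R) -> \bar R} := mfrestr mI mfin.
have numu : nu `<< leb.
  apply/null_content_dominatesP => A mA A0; apply/eqP; rewrite eq_le measure_ge0 andbT.
  have <- : sm A = 0%E by rewrite mm'// /dl/= /mscale/= A0 mule0.
  rewrite smE /nu/= /mfrestr /mrestr.
  apply: (@le_trans _ _ (m A)); last by rewrite leeDl.
  by apply: le_measure; rewrite ?inE//; apply: measurableI => //; exact: measurable_itv.
have [f [f0 ffin /integrableP[mf _] fE]] := @radon_nikodym_sigma_finite _ _ _ leb nu numu.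
exists (fine \o f); split.
- exact: measurableT_comp.
- by move=> x /=; rewrite fine_ge0.
- move=> a b la ab br.
  under eq_integral do rewrite /= fineK//.
  rewrite -integral_itv_obnd_cbnd; last exact: measurable_funTS.
  rewrite -fE; last exact: measurable_itv.
  rewrite -mE// /nu/= /mfrestr /mrestr; congr (m _); apply/setIidPl.
  by apply: subset_itv; rewrite bnd_simp.
Qed.

Lemma periodic_int (T : Type) (f : R -> T) (L : R) (k : int) x :
  (forall x, f (x + L) = f x) -> f (x + k%:~R * L) = f x.
Proof.
move=> fL; have fn (n : nat) y : f (y + n%:R * L) = f y.
  elim: n y => [|n IH] y; first by rewrite mul0r addr0.
  by rewrite -[in RHS]IH -[in RHS]fL; congr f; rewrite -natr1; ring.
case: k => n; first exact: fn.
by rewrite NegzE -[in RHS](subrK (n.+1%:R * L) x) fn; congr f; rewrite mulrNz mulNr.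
Qed.

Lemma integral_periodic (f : R -> \bar R) (L a : R) : 0 < L ->
  measurable_fun setT f -> (forall x, 0 <= f x)%E ->
  (forall x, f (x + L) = f x) ->
  (\int[leb]_(x in `[a, (a + L)%R]) f x = \int[leb]_(x in `[0%R, L]) f x)%E.
Proof.
move=> L0 mf f0 fL.
pose k := Num.floor (a / L); pose b := a - k%:~R * L.
have [b0 bL] : 0 <= b /\ b <= L.
  have /andP[] := floor_itv (a / L).
  rewrite -/k intrD ler_pdivlMr// ltr_pdivrMr// => h1 h2; rewrite /b; lra.
have aE : a = b + k%:~R * L by rewrite /b subrK.
rewrite aE [X in `[_, X]](_ : _ = (b + L) + k%:~R * L); last by ring.
rewrite integral_shift//; under eq_integral do rewrite periodic_int//.
(* Cut [[b, b + L]] at [L] and bring the second piece back to [[0, b]]. *)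
rewrite (@integral_itv_split _ _ b L)//; last by rewrite lerDr.
rewrite -[X in `[X, (b + L)%R]]add0r integral_shift//.
under [X in (_ + X)%E]eq_integral do rewrite fL.
by rewrite addeC -integral_itv_split.
Qed.

End density.

(** * Monotone matchings of periodic distribution functions *)

Section level_sets.
Context (R : realType).

(** [ab.1] and [ab.2] are the ends of the level set of [v]. The two equalities of booleans turn
    every later comparison with these ends into a comparison of values of [h]. *)
Lemma monotone_level (h : R -> R) (v : R) :
  continuous h -> {homo h : x y / x <= y} ->
  (exists x, h x < v) -> (exists x, v < h x) ->
  exists ab : R * R, forall x,
    ((ab.1 <= x) = (v <= h x)) /\ ((x <= ab.2) = (h x <= v)).
Proof.
move=> ch ndh [x0 hx0] [x1 hx1].
have below x y : h x < h y -> x < y.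
  by move=> hxy; rewrite ltNge; apply: contraTN hxy => yx; rewrite -leNgt ndh.
pose A := [set x | v <= h x]; pose B := [set x | h x <= v].
have infA : has_inf A.
  split; first by exists x1; rewrite /A/= ltW.
  by exists x0 => x; rewrite /A/= => vx; apply/ltW/below/(lt_le_trans hx0).
have supB : has_sup B.
  split; first by exists x0; rewrite /B/= ltW.
  by exists x1 => x; rewrite /B/= => vx; apply/ltW/below/(le_lt_trans vx).
have Ainf : v <= h (inf A).
  rewrite leNgt; apply/negP => hv.
  have : \forall x \near inf A, h x < v by exact: (cvgr_lt _ (ch (inf A))).
  move=> [e /= e0 he].
  have [x Ax xe] := inf_adherent e0 infA.
  have xa : inf A <= x by apply: ge_inf => //; case: infA.
  have := he x; rewrite /ball_/= ler0_norm ?subr_le0//.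
  by move=> /(_ ltac:(lra)); rewrite ltNge Ax.
have Bsup : h (sup B) <= v.
  rewrite leNgt; apply/negP => hv.
  have : \forall x \near sup B, v < h x by exact: (cvgr_gt _ (ch (sup B))).
  move=> [e /= e0 he].
  have [x Bx xe] := sup_adherent e0 supB.
  have xa : x <= sup B by apply: ub_le_sup => //; case: supB.
  have := he x; rewrite /ball_/= ger0_norm ?subr_ge0//.
  by move=> /(_ ltac:(lra)); rewrite ltNge Bx.
exists (inf A, sup B) => x /=; split; apply/idP/idP.
- by move=> /ndh; apply: le_trans.
- by move=> vx; apply: ge_inf => //; case: infA.
- by move=> /ndh xB; apply: le_trans Bsup.
- by move=> vx; apply: ub_le_sup => //; case: supB.
Qed.

End level_sets.

Section matching.
Context (R : realType) (L : R) (L0 : 0 < L).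
Local Notation leb := (@lebesgue_measure R).
Variables (F0 F1 : R -> R).
Hypotheses (cF0 : continuous F0) (cF1 : continuous F1).
Hypotheses (ndF0 : {homo F0 : x y / x <= y}) (ndF1 : {homo F1 : x y / x <= y}).
Hypotheses (F0L : forall x, F0 (x + L) = F0 x + 1).
Hypotheses (F1L : forall x, F1 (x + L) = F1 x + 1).

(** A root [x] of [H z x = - al] is a possible value of [S z], matched with its reflection
    [2 * z - x] in the midpoint. [H] increases in [x] and decreases in [z]. *)
Let H (z x : R) : R := F0 x - F1 (2 * z - x).

Let cH z : continuous (H z).
Proof.
move=> x; apply: cvgB; first exact: cF0.
apply: (@continuous_comp _ _ _ (fun x => 2 * z - x) F1); last exact: cF1.
by apply: cvgB; [exact: cvg_cst|exact: cvg_id].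
Qed.

Let ndH z : {homo H z : x y / x <= y}.
Proof. by move=> x y xy; rewrite /H lerB ?ndF0 ?ndF1// lerD2l lerN2. Qed.

Let niH z z' x : z <= z' -> H z' x <= H z x.
Proof. by move=> zz'; rewrite /H lerD2l lerN2 ndF1//; lra. Qed.

Let HL z x : H (z + L) (x + L) = H z x.
Proof.
rewrite /H F0L (_ : 2 * (z + L) - (x + L) = (2 * z - x) + L); last by ring.
by rewrite F1L; ring.
Qed.

(** The midpoint is fixed, so at each period [F0] gains 1 and [F1] at the reflected point loses
    1. *)
Let HLn z x (n : nat) : H z (x + n%:R * L) = H z x + 2 * n%:R.
Proof.
elim: n => [|n IH]; first by rewrite mul0r mulr0 !addr0.
rewrite -natr1 mulrDl mul1r addrA /H F0L.
have := F1L (2 * z - (x + n%:R * L + L)); rewrite opprD addrA subrK => E.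
by move: IH; rewrite /H E; lra.
Qed.

Let H_unbounded z v : (exists x, H z x < v) /\ (exists x, v < H z x).
Proof.
split.
- have [n hn] : exists n : nat, H z 0 - v < n%:R.
    by exists (Num.truncn (H z 0 - v)).+1; rewrite truncnS_gt.
  exists (- (n%:R * L)); have := HLn z (- (n%:R * L)) n; rewrite addNr => E.
  have := ler0n R n; lra.
- have [n hn] : exists n : nat, v - H z 0 < n%:R.
    by exists (Num.truncn (v - H z 0)).+1; rewrite truncnS_gt.
  exists (0 + n%:R * L); rewrite HLn; have := ler0n R n; lra.
Qed.

Let ab (al z : R) : R * R := projT1 (cid (monotone_level (v := - al) (@cH z) (@ndH z)
  (H_unbounded z (- al)).1 (H_unbounded z (- al)).2)).
(** The least root and, below, the greatest one. They differ where both distribution functions are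
    flat. *)
Let Sm al z := (ab al z).1.
Let Sp al z := (ab al z).2.

Let SmE al z x : (Sm al z <= x) = (- al <= H z x).
Proof. by rewrite /Sm /ab; case: cid => c /= /(_ x)[]. Qed.

Let SpE al z x : (x <= Sp al z) = (H z x <= - al).
Proof. by rewrite /Sp /ab; case: cid => c /= /(_ x)[]. Qed.

(* The point [S z] is sent to [2 z - S z]. Indexing the monotone plan by the
   midpoint [z] makes both ends 2-Lipschitz even where [F0] or [F1] is constant;
   [al] selects one of the monotone plans of the circle. *)
Definition matching al (S : R -> R) :=
  [/\ {homo S : x y / x <= y}, {homo (fun z => 2 * z - S z) : x y / x <= y},
      forall z, S (z + L) = S z + L &
      forall z, F1 (2 * z - S z) = F0 (S z) + al].

Let HSm al z : H z (Sm al z) = - al.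
Proof.
apply/eqP; rewrite eq_le -SmE lexx andbT leNgt; apply/negP => hlt.
have : \forall x \near Sm al z, - al < H z x by exact: (cvgr_gt _ (@cH z (Sm al z))).
move=> [e /= e0 he]; have := he (Sm al z - e / 2).
rewrite /ball_/= opprB addrC subrK ger0_norm; last by lra.
move=> /(_ ltac:(lra))/ltW; rewrite -SmE; lra.
Qed.

Let HSp al z : H z (Sp al z) = - al.
Proof.
apply/eqP; rewrite eq_le -SpE lexx/= leNgt; apply/negP => hlt.
have : \forall x \near Sp al z, H z x < - al by exact: (cvgr_lt _ (@cH z (Sp al z))).
move=> [e /= e0 he]; have := he (Sp al z + e / 2).
rewrite /ball_/= opprD addrA subrr sub0r normrN ger0_norm; last by lra.
move=> /(_ ltac:(lra))/ltW; rewrite -SpE; lra.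
Qed.

Let matching_Sm al : matching al (Sm al).
Proof.
split.
- by move=> z z' zz'; rewrite SmE -[leLHS](HSm al z') niH.
- move=> z z' zz'; suff : Sm al z' <= Sm al z + 2 * (z' - z) by lra.
  rewrite SmE -[leLHS](HSm al z) /H.
  rewrite (_ : 2 * z' - _ = 2 * z - Sm al z); last by ring.
  by rewrite lerD2r ndF0//; lra.
- move=> z; apply/eqP; rewrite eq_le SmE HL -SmE lexx/=.
  by rewrite -lerBrDr SmE -HL subrK -SmE.
- by move=> z; have := HSm al z; rewrite /H; lra.
Qed.

Let matching_Sp al : matching al (Sp al).
Proof.
split.
- move=> z z' zz'; rewrite SpE (le_trans (niH _ zz'))//.
  by rewrite HSp.
- move=> z z' zz'; suff : Sp al z' - 2 * (z' - z) <= Sp al z by lra.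
  rewrite SpE -[leRHS](HSp al z') /H.
  rewrite (_ : 2 * z - _ = 2 * z' - Sp al z'); last by ring.
  by rewrite lerD2r ndF0//; lra.
- move=> z; apply/eqP; rewrite eq_le -lerBlDr SpE.
  rewrite -[H z _]HL subrK -SpE lexx/=.
  by rewrite SpE HL -SpE.
- by move=> z; have := HSp al z; rewrite /H; lra.
Qed.

(** [H z] is constant between its extreme roots, so every value in between is a root. *)
Let matching_between al (S : R -> R) : {homo S : x y / x <= y} ->
  {homo (fun z => 2 * z - S z) : x y / x <= y} ->
  (forall z, S (z + L) = S z + L) -> (forall z, Sm al z <= S z <= Sp al z) ->
  matching al S.
Proof.
move=> S1 S2 S3 SS; split => // z; have /andP[] := SS z.
by rewrite SmE SpE /H => h1 h2; lra.
Qed.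

(** Monotonicity of both ends gives [0 <= S y - S x <= 2 * (y - x)] for [x <= y]. *)
Lemma matching_continuous al S : matching al S -> continuous S.
Proof.
move=> [S1 S2 _ _] x; apply/cvgrPdist_le => e e0; near=> y.
have xy : `|x - y| <= e / 2.
  by near: y; apply: cvgr_dist_le; [exact: cvg_id|rewrite divr_gt0].
have [xley|/ltW ylex] := leP x y.
  rewrite ler0_norm ?subr_le0 ?S1//; have := S2 _ _ xley.
  by move: xy; rewrite ler0_norm ?subr_le0//; lra.
rewrite ger0_norm ?subr_ge0 ?S1//; have := S2 _ _ ylex.
by move: xy; rewrite ger0_norm ?subr_ge0//; lra.
Unshelve. all: by end_near. Qed.

Let M (S : R -> R) : R := \int[leb]_(z in `[0, L]) (S z - z).

Let integrable_shift (S : R -> R) : continuous S ->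
  leb.-integrable `[0, L] (EFin \o (fun z => S z - z)).
Proof.
move=> cS; apply: continuous_compact_integrable; first exact: segment_compact.
apply: continuous_subspaceT => x; apply: cvgB; [exact: cS|exact: cvg_id].
Qed.

Let cSm al : continuous (Sm al) := matching_continuous (matching_Sm al).
Let cSp al : continuous (Sp al) := matching_continuous (matching_Sp al).

Let le_M S S' : continuous S -> continuous S' ->
  (forall z, 0 <= z <= L -> S z <= S' z) -> M S <= M S'.
Proof.
move=> cS cS' SS; apply: le_Rintegral => //; try exact: integrable_shift.
by move=> z /=; rewrite in_itv/= => /SS; rewrite lerD2r.
Qed.

Let Sm_anti al be z : al <= be -> Sm be z <= Sm al z.
Proof. by move=> albe; rewrite SmE (le_trans _ (_ : - al <= _)) ?lerN2// -SmE. Qed.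

Let M_lim (a : R^nat) (S : R -> R) : continuous S ->
  (exists l u : R, forall n, l <= a n <= u) ->
  (forall z, Sm (a n) z @[n --> \oo] --> S z) ->
  M (Sm (a n)) @[n --> \oo] --> M S.
Proof.
move=> cS [l [u alu]] lim.
(* On [[0, L]] all the functions lie between [Sm u 0] and [Sm l L], by monotonicity in [z] and
   antitonicity in [al]. *)
pose B := `|Sm u 0| + `|Sm l L| + L.
have bnd n z : 0 <= z <= L -> `|Sm (a n) z - z| <= B.
  move=> /andP[z0 zL]; have /andP[ln un] := alu n.
  have [mono _ _ _] := matching_Sm (a n).
  have h1 : Sm u 0 <= Sm (a n) z by rewrite (le_trans (Sm_anti _ un))// mono.
  have h2 : Sm (a n) z <= Sm l L by rewrite (le_trans _ (Sm_anti _ ln))// mono.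
  have := ler_norm (- Sm u 0); have := ler_norm (Sm l L); rewrite normrN.
  have := normr_ge0 (Sm l L); have := normr_ge0 (Sm u 0).
  by rewrite /B ler_norml; lra.
have mI (T : R -> R) : continuous T ->
    measurable_fun `[0, L] (EFin \o (fun z => T z - z)).
  by move=> cT; exact: (measurable_int _ (integrable_shift cT)).
have [] := @dominated_convergence _ _ _ leb _ (measurable_itv `[0, L])
  (fun n => EFin \o (fun z => Sm (a n) z - z))
  (EFin \o (fun z => S z - z)) (EFin \o cst B) (fun n => mI _ (@cSm (a n))) (mI _ cS).
- apply: nearW => z _; apply: cvg_EFin; first exact: nearW.
  by apply: cvgB; [exact: lim|exact: cvg_cst].
- apply: continuous_compact_integrable; first exact: segment_compact.
  by apply: continuous_subspaceT => x; exact: cvg_cst.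
- by apply: nearW => z n; rewrite /= in_itv/= lee_fin => /bnd.
- move=> iS _ lim'; apply: fine_cvg; rewrite /M /Rintegral fineK//.
  exact: integrable_fin_num iS.
Qed.

Let M_Sm_anti al be : al <= be -> M (Sm be) <= M (Sm al).
Proof. by move=> albe; apply: le_M => // z _; exact: Sm_anti. Qed.

(* Moving [al] moves [S] continuously between its extreme solutions [Sm] and
   [Sp]; the condition selects the optimal plan, for it makes the primitive of
   [2 (z - S z)] periodic. *)
Lemma exists_balanced_matching : exists al S, matching al S /\
  \int[leb]_(z in `[0, L]) (S z - z) = 0.
Proof.
pose N := [set al | M (Sm al) <= 0].
have M_ge0 (S : R -> R) : (forall z, 0 <= z <= L -> z <= S z) -> 0 <= M S.
  move=> zS; apply: Rintegral_ge0 => z /=.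
  by rewrite in_itv/= subr_ge0 => /zS.
have infN : has_inf N.
  split.
    (* For this [al] one has [- al <= H z z] on the period, hence [Sm al z <= z]. *)
    exists (F1 L - F0 0); rewrite /N/=.
    rewrite [leRHS](_ : _ = M id); last first.
      rewrite /M; under eq_Rintegral do rewrite subrr.
      by rewrite Rintegral_cst// mul0r.
    apply: le_M => //; first by move=> ?; exact: cvg_id.
    move=> z /andP[z0 zL]; rewrite SmE /H (_ : 2 * z - z = z); last by ring.
    by have := ndF0 z0; have := ndF1 zL; lra.
  (* Below this value [H z (z + L) = H z z + 2 < - al], hence [z + L < Sm al z], and the mean is
     positive. *)
  exists (F1 0 - F0 L - 2) => al; rewrite /N/= => Nal.
  rewrite leNgt; apply/negP => alt.
  suff : 0 < M (Sm al) by rewrite ltNge Nal.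
  apply: (@lt_le_trans _ _ (M (fun z => z + L))).
    rewrite /M; under eq_Rintegral do rewrite addrAC subrr add0r.
    by rewrite Rintegral_cst//= lebesgue_measure_itv/= lte_fin L0/= subr0 mulr_gt0.
  apply: le_M => //; first by move=> x; apply: cvgD; [exact: cvg_id|exact: cvg_cst].
  move=> z /andP[z0 zL]; apply/ltW; rewrite ltNge SmE -ltNge.
  have := HLn z z 1; rewrite mul1r mulr1 => ->.
  rewrite /H (_ : 2 * z - z = z); last by ring.
  by have := ndF0 zL; have := ndF1 z0; lra.
(* The mean may jump here. When the parameter decreases to [al], [Sm] tends to [Sm al]; when it
   increases to [al], [Sm] tends to [Sp al]. So 0 lies between the two means. *)
pose al := inf N.
have upN be : al < be -> M (Sm be) <= 0.
  move=> albe; have be0 : 0 < be - al by lra.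
  have [x Nx xe] := inf_adherent be0 infN.
  by apply: le_trans Nx; apply: M_Sm_anti; rewrite -/al in xe; lra.
have loN be : be < al -> 0 <= M (Sm be).
  move=> beal; rewrite leNgt; apply/negP => /ltW h.
  by move: beal; rewrite ltNge => /negP; apply; apply: ge_inf => //; case: infN.
pose e (n : nat) : R := n.+1%:R^-1.
have e01 n : 0 < e n <= 1.
  by rewrite /e invr_gt0 ltr0n/= invf_le1 ?ltr0n// ler1n.
have ecvg : e n @[n --> \oo] --> (0 : R) by exact: cvg_harmonic.
have Mm : M (Sm al) <= 0.
  have lim : M (Sm (al + e n)) @[n --> \oo] --> M (Sm al).
    apply: M_lim => //.
      by exists al, (al + 1) => n; have := e01 n; lra.
    move=> z; apply/cvgrPdist_le => d d0.
    have hx : H z (Sm al z - d) < - al.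
      by rewrite ltNge -SmE; lra.
    near=> n.
    have en : e n < - al - H z (Sm al z - d).
      by near: n; apply: (cvgr_lt _ ecvg); lra.
    have h1 : Sm (al + e n) z <= Sm al z by apply: Sm_anti; have := e01 n; lra.
    have h2 : Sm al z - d < Sm (al + e n) z by rewrite ltNge SmE -ltNge; lra.
    by rewrite ger0_norm; lra.
  apply: (cvgr_to_le lim).
  by apply: nearW => n; apply: upN; have := e01 n; lra.
have Mp : 0 <= M (Sp al).
  have lim : M (Sm (al - e n)) @[n --> \oo] --> M (Sp al).
    apply: M_lim => //.
      by exists (al - 1), al => n; have := e01 n; lra.
    move=> z; apply/cvgrPdist_le => d d0.
    have hx : - al < H z (Sp al z + d).
      by rewrite ltNge -SpE; lra.
    near=> n.
    have en : e n < H z (Sp al z + d) + al.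
      by near: n; apply: (cvgr_lt _ ecvg); lra.
    have h1 : Sp al z < Sm (al - e n) z.
      by rewrite ltNge SmE HSp; have := e01 n; lra.
    have h2 : Sm (al - e n) z <= Sp al z + d by rewrite SmE; lra.
    by rewrite ler0_norm; lra.
  apply: (cvgr_to_ge lim).
  by apply: nearW => n; apply: loN; have := e01 n; lra.
have [m0|mn0] := eqVneq (M (Sm al)) 0.
  by exists al, (Sm al); split.
(* The coefficient for which the convex combination of [Sm al] and [Sp al] has mean 0. *)
pose c := M (Sp al) / (M (Sp al) - M (Sm al)).
have dm : 0 < M (Sp al) - M (Sm al) by move: Mm mn0; rewrite le_eqVlt => /predU1P[->/eqP//|]; lra.
have c01 : 0 <= c <= 1.
  by rewrite /c divr_ge0 ?(ltW dm)//= ler_pdivrMr//; lra.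
exists al, (fun z => c * Sm al z + (1 - c) * Sp al z); split.
  have [m1 m2 m3 m4] := matching_Sm al; have [p1 p2 p3 p4] := matching_Sp al.
  apply: matching_between.
  - by move=> x y xy; have := m1 _ _ xy; have := p1 _ _ xy; nra.
  - by move=> x y xy; have := m2 _ _ xy; have := p2 _ _ xy; nra.
  - by move=> z; rewrite m3 p3; ring.
  - move=> z; have : Sm al z <= Sp al z by rewrite SmE HSp.
    by move=> ?; apply/andP; split; nra.
rewrite (_ : \int[leb]_(z in _) _ = c * M (Sm al) + (1 - c) * M (Sp al)).
  rewrite /c; move: (M (Sm al)) (M (Sp al)) dm => x y dm.
  by field; rewrite gt_eqF.
rewrite /M -!RintegralZl//; try exact: integrable_shift.
rewrite -RintegralD//; last 2 first.
- apply: continuous_compact_integrable; first exact: segment_compact.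
  apply: continuous_subspaceT => x; apply: cvgM; first exact: cvg_cst.
  by apply: cvgB; [exact: cSm|exact: cvg_id].
- apply: continuous_compact_integrable; first exact: segment_compact.
  apply: continuous_subspaceT => x; apply: cvgM; first exact: cvg_cst.
  by apply: cvgB; [exact: cSp|exact: cvg_id].
by apply: eq_Rintegral => z _; ring.
Unshelve. all: by end_near. Qed.

End matching.

Section potential.
Context (R : realType).
Local Notation leb := (@lebesgue_measure R).

Lemma integral_is_derive (F f : R -> R) (a b : R) : a <= b -> continuous f ->
  (forall x : R, is_derive x 1 F (f x)) ->
  (\int[leb]_(x in `[a, b]) (f x)%:E = (F b - F a)%:E)%E.
Proof.
rewrite le_eqVlt => /predU1P[<-|ab] cf dF.
  by rewrite set_itv1 integral_set1 subrr.
have cF x : {for x, continuous F}.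
  by apply: differentiable_continuous; apply/derivable1_diffP; exact: ex_derive.
rewrite (@continuous_FTC2 R f F)//.
- exact: continuous_subspaceT.
- split; first by move=> x _; exact: ex_derive.
    by apply: cvg_at_right_filter; exact: cF.
  by apply: cvg_at_left_filter; exact: cF.
- by move=> x _; rewrite derive1E; exact: derive_val.
Qed.

(* [theta] is the primitive of [2 (z - S z)], so that [z ^ 2 - theta] and
   [z ^ 2 + theta] are the convex primitives of [2 S z] and [2 (2 z - S z)]. *)
Lemma exists_potential (L al : R) (F0 F1 S : R -> R) : 0 < L ->
  matching L F0 F1 al S -> \int[leb]_(z in `[0, L]) (S z - z) = 0 ->
  exists theta : R -> R, [/\ forall z, theta (z + L) = theta z,
    forall z z', 2 * S z * (z' - z) <= (z' ^+ 2 - theta z') - (z ^+ 2 - theta z),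
    forall z z', 2 * (2 * z - S z) * (z' - z) <=
      (z' ^+ 2 + theta z') - (z ^+ 2 + theta z) &
    exists B, forall z, `|theta z| <= B].
Proof.
move=> L0 mS MS; have cS := matching_continuous mS; case: mS => ndS ndR SL _.
have period z : exists2 y, 0 <= y <= L & exists k : int, z = y + k%:~R * L.
  exists (z - (Num.floor (z / L))%:~R * L).
    have /andP[] := floor_itv (z / L).
    by rewrite intrD ler_pdivlMr// ltr_pdivrMr// => h1 h2; lra.
  by exists (Num.floor (z / L)); rewrite subrK.
(* The shift by [B] makes the integrand nonnegative, as [exists_primitive] requires; [theta] takes
   it back. *)
pose B := L + `|S 0|; pose W z := S z - z + B.
have WL z : W (z + L) = W z by rewrite /W SL; ring.
have cW : continuous W.
  by move=> x; apply: cvgD; [apply: cvgB; [exact: cS|exact: cvg_id]|exact: cvg_cst].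
have mW : measurable_fun setT W by exact: continuous_measurable_fun.
have W0 z : 0 <= W z.
  have [y /andP[y0 yL] [k ->]] := period z.
  rewrite periodic_int// /W /B; have := ndS _ _ y0; have := ler_norm (- S 0).
  by rewrite normrN; lra.
have iW a b : leb.-integrable `[a, b] (EFin \o W).
  apply: continuous_compact_integrable; first exact: segment_compact.
  exact: continuous_subspaceT.
have Wfin a b : (\int[leb]_(x in `[a, b]) (W x)%:E < +oo)%E.
  have : (\int[leb]_(x in `[a, b]) (W x)%:E \is a fin_num)%E.
    exact: integrable_fin_num (iW a b).
  by rewrite ge0_fin_numE//; apply: integral_ge0 => x _; rewrite lee_fin.
have [G [cG ndG GW]] := exists_primitive mW W0 Wfin.
have GL z : G (z + L) = G z + B * L.
  have zL : z <= z + L by lra.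
  have := GW _ _ _ _ (lexx z) zL (lexx _).
  have mWE : measurable_fun setT (fun x => (W x)%:E) by exact/measurable_EFinP.
  have WLE x : (W (x + L))%:E = (W x)%:E by rewrite WL.
  rewrite (integral_periodic z L0 mWE W0 WLE).
  have Wfin0 : (\int[leb]_(x in `[0%R, L]) (W x)%:E \is a fin_num)%E.
    exact: integrable_fin_num (iW 0 L).
  rewrite -(fineK Wfin0).
  rewrite -[fine _]/(\int[leb]_(x in `[0, L]) (S x - x + cst B x)).
  rewrite RintegralD//; last 2 first.
  - apply: continuous_compact_integrable; first exact: segment_compact.
    by apply: continuous_subspaceT => x; apply: cvgB; [exact: cS|exact: cvg_id].
  - apply: continuous_compact_integrable; first exact: segment_compact.
    by apply: continuous_subspaceT => x; exact: cvg_cst.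
  rewrite MS Rintegral_cst//= lebesgue_measure_itv/= lte_fin L0/= => -[].
  by lra.
pose theta z := 2 * (B * z - G z).
have thL z : theta (z + L) = theta z by rewrite /theta GL; ring.
have aff a b c k : a <= b ->
    (\int[leb]_(x in `[a, b]) (c + k * x)%:E =
     (c * (b - a) + k * (b ^+ 2 - a ^+ 2) / 2)%:E)%E.
  move=> ab.
  have dF (x : R) : is_derive x (1 : R) (fun x : R => c * x + k * (x ^+ 2 / 2)) (c + k * x).
    by apply: is_derive_eq; rewrite /GRing.scale/=; lra.
  have cF : continuous (fun x : R => c + k * x).
    by move=> x; apply: cvgD; [exact: cvg_cst|apply: cvgMr; exact: cvg_id].
  by rewrite (integral_is_derive ab cF dF); congr (_%:E); lra.
have iaff a b c k : leb.-integrable `[a, b] (EFin \o (fun x => c + k * x)).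
  apply: continuous_compact_integrable; first exact: segment_compact.
  apply: continuous_subspaceT => x.
  by apply: cvgD; [exact: cvg_cst|apply: cvgMr; exact: cvg_id].
(* Compare [W] with affine functions: monotonicity of [S] compares [W x] with [S z + B - x], and
   monotonicity of [2 * z - S z] with [S z - 2 * z + B + x]. Integrating gives the subgradient
   inequalities. *)
have lower a b c k : a <= b -> (forall x, a <= x <= b -> c + k * x <= W x) ->
    c * (b - a) + k * (b ^+ 2 - a ^+ 2) / 2 <= G b - G a.
  move=> ab cW'; rewrite -lee_fin -aff// -(GW a b)//.
  by apply: le_integral; [by []|exact: iaff|exact: iW|move=> x; rewrite inE; exact: cW'].
have upper a b c k : a <= b -> (forall x, a <= x <= b -> W x <= c + k * x) ->
    G b - G a <= c * (b - a) + k * (b ^+ 2 - a ^+ 2) / 2.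
  move=> ab cW'; rewrite -lee_fin -aff// -(GW a b)//.
  by apply: le_integral; [by []|exact: iW|exact: iaff|move=> x; rewrite inE; exact: cW'].
have sub z z' : 2 * S z * (z' - z) <= (z' ^+ 2 - theta z') - (z ^+ 2 - theta z).
  rewrite /theta; have [zz'|/ltW z'z] := leP z z'.
    have := @lower z z' (S z + B) (- 1) zz'; suff H x : z <= x <= z' -> S z + B + -1 * x <= W x.
      by move=> /(_ H); lra.
    by move=> /andP[/ndS]; rewrite /W; lra.
  have := @upper z' z (S z + B) (- 1) z'z; suff H x : z' <= x <= z -> W x <= S z + B + -1 * x.
    by move=> /(_ H); lra.
  by move=> /andP[_ /ndS]; rewrite /W; lra.
have sub' z z' : 2 * (2 * z - S z) * (z' - z) <=
    (z' ^+ 2 + theta z') - (z ^+ 2 + theta z).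
  rewrite /theta; have [zz'|/ltW z'z] := leP z z'.
    have := @upper z z' (S z - 2 * z + B) 1 zz'.
    suff H x : z <= x <= z' -> W x <= S z - 2 * z + B + 1 * x by move=> /(_ H); lra.
    by move=> /andP[/ndR]; rewrite /W; lra.
  have := @lower z' z (S z - 2 * z + B) 1 z'z.
  suff H x : z' <= x <= z -> S z - 2 * z + B + 1 * x <= W x by move=> /(_ H); lra.
  by move=> /andP[_ /ndR]; rewrite /W; lra.
exists theta; split => //.
exists (2 * (`|B| * L + `|G 0| + `|G L|)) => z.
have [y /andP[y0 yL] [k ->]] := period z; rewrite (periodic_int _ _ thL).
rewrite /theta normrM ger0_norm// ler_pM2l// (le_trans (ler_normB _ _))//.
rewrite -addrA lerD//.
  by rewrite normrM ler_wpM2l// ger0_norm.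
have := ndG _ _ y0; have := ndG _ _ yL; have := ler_norm (G L); have := ler_norm (- G 0).
by rewrite normrN ler_norml; have := normr_ge0 (G 0); have := normr_ge0 (G L); lra.
Qed.

End potential.

(** * Optimal transport on the circle *)

Section circle_facts.
Context (R : realType) (D : {posnum R}).
Local Notation leb := (@lebesgue_measure R).
Local Notation S1 := (circle D).
Local Notation L := (2 * D%:num).
Local Notation e := (circle_param D).

Lemma circle_period_gt0 : 0 < L. Proof. by rewrite mulr_gt0. Qed.
Let L0 := circle_period_gt0.

Lemma circle_paramD s : e (s + L) = e s.
Proof.
apply: val_inj => /=.
have -> : pi * (s + L) / D%:num = pi * s / D%:num + pi *+ 2.
  by rewrite mulr2n; field.
by rewrite cosD2pi sinD2pi.
Qed.

Lemma circle_paramDint s (k : int) : e (s + k%:~R * L) = e s.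
Proof. exact: (periodic_int k s circle_paramD). Qed.

Lemma circle_param_inj s t : `|s - t| < L -> e s = e t -> s = t.
Proof.
wlog ts : s t / t <= s.
  move=> H; have [/H//|/ltW/H{}H] := leP t s.
  by rewrite distrC => /H{}H /esym /H.
rewrite ger0_norm ?subr_ge0// => stL est.
have [h|h] := leP (s - t) D%:num.
  have := @circle_param_isometry _ D s t; rewrite ger0_norm ?subr_ge0// => /(_ h).
  rewrite est circle_mdistE circle_dist_xx => /eqP.
  by rewrite eq_sym subr_eq0 => /eqP.
(* Beyond half a turn the other arc is the short one: compare [s] with [t + L]. *)
have := @circle_param_isometry _ D s (t + L).
rewrite circle_paramD est circle_mdistE circle_dist_xx.
rewrite ler0_norm; last by lra.
by move=> /(_ ltac:(lra)); lra.
Qed.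

(** Take the lift nearest to [s]: [k] rounds [(s - z) / L] to an integer, which leaves at most half
    a turn. *)
Lemma circle_dist_lift s (p : S1) :
  exists2 t, e t = p & mdist (e s) p = `|s - t|.
Proof.
have [z _ zp] := circle_param_surj p.
pose k := Num.floor ((s - z) / L + 2^-1).
have := floor_itv ((s - z) / L + 2^-1); rewrite -/k => /andP[].
rewrite -lerBlDr -ltrBrDr ler_pdivlMr// ltr_pdivrMr// intrD => h1 h2.
exists (z + k%:~R * L); first by rewrite circle_paramDint.
rewrite -zp -(circle_paramDint z k) circle_param_isometry// ler_norml; lra.
Qed.

Lemma circle_dist_le (p q : S1) : mdist p q <= D%:num.
Proof.
rewrite circle_mdistE/= /circle_dist -[leRHS](@divfK _ pi) ?gt_eqF ?pi_gt0//.
by rewrite ler_pM2l ?divr_gt0 ?pi_gt0// acos_lepi// dot_itv.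
Qed.

Lemma circle_param_compact (A : set R) : compact A -> closed (e @` A).
Proof.
move=> cA; apply: compact_closed; first exact: metric_hausdorff.
apply: continuous_compact cA.
exact/continuous_subspaceT/circle_param_continuous.
Qed.

(** The map [z |-> e (U z)] is injective on [[0, L)]. Its inverse jumps at [e (U 0)], yet for
    [0 < a < L] the set where [j] is at least [a] is a compact image without that one point, hence
    Borel. *)
Lemma exists_circle_inverse (U : R -> R) : continuous U ->
  {homo U : x y / x < y} -> (forall z, U (z + L) = U z + L) ->
  exists j : borel S1 -> R, measurable_fun setT j /\
    forall z, 0 <= z < L -> j (e (U z)) = z.
Proof.
move=> cU iU UL.
have bound z z' : 0 <= z -> z < z' -> z' < L -> `|U z' - U z| < L.
  move=> z0 zz' z'L; have h1 := iU _ _ zz'.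
  have h2 : U z' < U (z + L) by apply: iU; lra.
  by move: h2; rewrite UL ger0_norm; lra.
have inj z z' : 0 <= z < L -> 0 <= z' < L -> e (U z) = e (U z') -> z = z'.
  move=> /andP[z0 zL] /andP[z'0 z'L].
  have [zz'|zz'|->//] := ltgtP z z' => /circle_param_inj H; have := iU _ _ zz'.
    by rewrite H ?ltxx// distrC bound.
  by rewrite H ?ltxx// bound.
pose P p := [set z | 0 <= z < L /\ e (U z) = p].
pose j (p : borel S1) := xget 0 (P p).
have jI p : 0 <= j p < L.
  by rewrite /j; case: xgetP => [z -> []//|_]; rewrite lexx/= L0.
have jE z : 0 <= z < L -> j (e (U z)) = z.
  move=> zL; have [] : P (e (U z)) (j (e (U z))) by apply: (@xgetI _ 0 _ z).
  by move=> jL /inj; apply.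
exists j; split => //.
move=> mT; apply: (measurability _ (RGenInftyO.measurableE R)) => //.
move=> _ [_ [a ->] <-]; rewrite setTI.
have [a0|a0] := leP a 0.
  rewrite (_ : _ @^-1` _ = set0)//; rewrite -subset0 => p /=.
  rewrite in_itv/= => ja; have := jI p; lra.
have [aL|aL] := leP L a.
  rewrite (_ : _ @^-1` _ = setT)//; apply/seteqP; split => // p _ /=.
  by rewrite in_itv/=; have := jI p; lra.
rewrite (_ : _ @^-1` _ = ~` (((e \o U) @` `[a, L]) `&` ~` [set e (U 0)])); last first.
  apply/seteqP; split => p /=; rewrite in_itv/=.
    move=> ja [[z /=]]; rewrite in_itv/= => /andP[az zL] zp; apply.
    move: zL; rewrite le_eqVlt => /predU1P[zL|zL].
      by rewrite -zp zL -[2 * D%:num]add0r UL circle_paramD.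
    by exfalso; move: ja; rewrite -zp jE; lra.
  move=> H; rewrite ltNge; apply/negP => aj; apply: H.
  (* The default value 0 of [xget] is excluded by [0 < a <= j p]. *)
  have : P p (j p).
    rewrite /j; case: xgetP => [z -> //|nP].
    by move: aj; rewrite /j xgetPN; [lra|exact: nP].
  move=> [jL jp]; split.
    by exists (j p) => //=; rewrite in_itv/= aj/=; lra.
  move=> p0; have := jE 0; rewrite -p0 lexx L0 => /(_ isT); lra.
have mclosed (A : set S1) : closed A -> measurable (A : set (borel S1)).
  move=> cA; rewrite -[A]setCK; apply: measurableC; apply: sub_sigma_algebra.
  exact: closed_openC.
apply: measurableC; apply: measurableI.
  apply: mclosed; rewrite -image_comp; apply: circle_param_compact.
  apply: continuous_compact; last exact: segment_compact.
  exact: continuous_subspaceT.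
apply: measurableC; apply: (mclosed [set e (U 0)]).
apply: compact_closed; first exact: metric_hausdorff.
exact: compact_set1.
Qed.

(** A measurable section of [e], cut at [e 0]; it reduces measurability on the circle to
    measurability on the line. *)
Lemma exists_circle_log : exists lg : borel S1 -> R, measurable_fun setT lg /\
  forall p, 0 <= lg p < L /\ e (lg p) = p.
Proof.
have [|x y //|z //|lg [mlg lgE]] := @exists_circle_inverse id.
  by move=> x; exact: cvg_id.
exists lg; split => // p; have [z /= zL <-] := circle_param_surj (p : S1).
move: zL; rewrite in_itv/= => /andP[z0]; rewrite le_eqVlt => /predU1P[->|zL].
  have -> : e L = e 0 by rewrite -[2 * D%:num]add0r circle_paramD.
  by rewrite lgE lexx L0.
by rewrite lgE z0 zL.
Qed.

(** The distance is a continuous function of the difference of the two angles, which is measurable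
    for the product sigma-algebra. *)
Lemma measurable_circle_dist :
  measurable_fun [set: (borel S1 * borel S1)%type]
    (fun z : borel S1 * borel S1 => mdist (z.1 : S1) (z.2 : S1)).
Proof.
have [lg [mlg lgE]] := exists_circle_log.
pose g x := mdist (e x) (e 0).
have cg : continuous g.
  move=> x; apply/cvgrPdist_le => d d0; near=> y.
  apply: (@le_trans _ _ (mdist (e x) (e y))).
    have := circle_dist_triangle (e y) (e x) (e 0).
    have := circle_dist_triangle (e x) (e y) (e 0).
    by rewrite /g !circle_mdistE (circle_distC (e y) (e x)) ler_norml; lra.
  apply: le_trans (circle_param_lip _ _ _) _.
  by near: y; apply: cvgr_dist_le => //; exact: cvg_id.
rewrite (_ : (fun _ => _) = g \o (fun z : borel S1 * borel S1 => lg z.1 - lg z.2)).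
  apply: measurableT_comp; first exact: continuous_measurable_fun.
  by apply: measurable_funB; exact: measurableT_comp.
apply/funext => z /=; rewrite -[in LHS](lgE z.1).2 -[in LHS](lgE z.2).2 /g.
by rewrite !circle_param_dist subr0.
Unshelve. all: by end_near. Qed.

Lemma measurable_circle_fun d' (T : measurableType d') (h : borel S1 -> T) :
  measurable_fun [set: R] (h \o e) -> measurable_fun setT h.
Proof.
move=> mh; have [lg [mlg lgE]] := exists_circle_log.
rewrite (_ : h = (h \o e) \o lg); first exact: measurableT_comp.
by apply/funext => p /=; rewrite (lgE p).2.
Qed.

Lemma ge0_integral_circle (h : borel S1 -> \bar R) :
  measurable_fun setT h -> (forall p, 0 <= h p)%E ->
  (\int[circle_vol D]_p h p = \int[leb]_(z in `[0%R, L]) h (e z))%E.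
Proof.
move=> mh h0.
have me := @measurable_circle_param _ D.
have [la [laE laint]] : exists nu : {finite_measure set (measurableTypeR R) -> \bar R},
    (forall A, measurable A ->
       nu A = \int[leb]_(x in `[0%R, L] `&` A) (1%R)%:E)%E /\
    (forall f : R -> \bar R, measurable_fun [set: R] f -> (forall x, 0 <= f x)%E ->
       \int[nu]_x f x = \int[leb]_(x in `[0%R, L]) (f x * (1%R)%:E))%E.
  apply: (@exists_weighted_itv R (cst 1%R)) => //.
  by rewrite (primitive_id (lexx _) (ltW L0) (lexx _)) ltry.
transitivity (\int[la]_z (h \o e) z)%E; last first.
  rewrite laint//=; last exact: (measurableT_comp mh me).
  by apply: eq_integral => z _; rewrite mule1.
have me' : measurable_fun [set: measurableTypeR R] (e : measurableTypeR R -> borel S1).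
  exact: me.
have := ge0_integral_pushforward me' la measurableT mh (fun p _ => h0 p).
rewrite preimage_setT => <-.
apply: eq_measure_integral => A mA _.
have mA' : measurable (e @^-1` A) by rewrite -[X in measurable X]setTI; exact: me.
rewrite [RHS]laE//.
have mI : measurable (`[0, L] `&` e @^-1` A) by exact: measurableI.
rewrite (@integral_cst _ _ _ leb _ mI 1) mul1e.
change (circle_vol D A = leb (`[0, L] `&` e @^-1` A)).
rewrite /circle_vol /pushforward /mrestr.
transitivity (\int[leb]_(x in `[0%R, L[) (\1_(e @^-1` A) x)%:E)%E.
  by rewrite integral_indic.
rewrite integral_itv_bndo_bndc.
  by rewrite integral_indic// setIC.
exact/measurable_funTS/measurable_EFinP.
Qed.

(** [U] goes once around the circle, and periodicity absorbs its starting point. *)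
Lemma circle_change_of_variable (u U : R -> R) (h : borel S1 -> \bar R) :
  measurable_fun setT u -> (forall x, 0 <= u x) ->
  continuous U -> {homo U : x y / x <= y} -> U L = U 0 + L ->
  primitive_on 0 L u U ->
  measurable_fun setT h -> (forall p, 0 <= h p)%E ->
  (\int[leb]_(z in `[0%R, L]) (h (e (U z)) * (u z)%:E) =
   \int[circle_vol D]_p h p)%E.
Proof.
move=> mu u0 cU ndU UL pU mh h0.
have mhe : measurable_fun setT (h \o e).
  by apply: measurableT_comp => //; exact: measurable_circle_param.
rewrite (primitive_change_of_variable (h := h \o e) (ltW L0) mu u0 cU ndU pU)//=.
rewrite UL integral_periodic//; last by move=> x /=; rewrite circle_paramD.
by rewrite ge0_integral_circle.
Qed.

End circle_facts.

(** * Kantorovich potentials on the circle *)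

Section circle_transport.
Context (R : realType) (D : {posnum R}).
Local Notation S1 := (circle D).
Local Notation L := (2 * D%:num).
Local Notation e := (circle_param D).

Lemma circle_param_eq a b : e a = e b -> exists k : int, b = a + k%:~R * L.
Proof.
move=> ab; have L0 := circle_period_gt0 D.
exists (Num.floor ((b - a) / L)); apply/esym/circle_param_inj.
  have := floor_itv ((b - a) / L) => /andP[].
  rewrite ler_pdivlMr// ltr_pdivrMr// intrD => h1 h2.
  by rewrite ler0_norm; lra.
by rewrite circle_paramDint.
Qed.

Lemma periodic_circle_fun (T : Type) (f : R -> T) : (forall z, f (z + L) = f z) ->
  exists g : S1 -> T, forall z, g (e z) = f z.
Proof.
move=> fL; have [lg [_ lgE]] := exists_circle_log D.
exists (f \o lg) => z /=; have [_ lgz] := lgE (e z).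
by have [k zE] := circle_param_eq lgz; rewrite [in RHS]zE periodic_int.
Qed.

(** An infimal convolution, normalized for the cost [d ^ 2 / 2]: the midpoint [m] of a shortest arc
    from [p] to [q] satisfies [d (p, m) ^ 2 + d (m, q) ^ 2 = d (p, q) ^ 2 / 2]. *)
Definition cost_conj (th : S1 -> R) (p : S1) : R :=
  inf [set th m + mdist p m ^+ 2 | m in [set: S1]].

Lemma circle_dist_continuous (m : S1) : continuous (fun s => mdist (e s) m).
Proof.
move=> s; apply/cvgrPdist_lt => d d0; near=> t.
apply: (@le_lt_trans _ _ (mdist (e s) (e t))).
  have := circle_dist_triangle (e t) (e s) m.
  have := circle_dist_triangle (e s) (e t) m.
  by rewrite !circle_mdistE (circle_distC (e t) (e s)) ler_norml; lra.
apply: (le_lt_trans (circle_param_lip _ _ _)).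
by near: t; apply: cvgr_dist_lt => //; exact: cvg_id.
Unshelve. all: by end_near. Qed.

Section cost_conj.
Variables (th : S1 -> R) (B : R).
Hypothesis thB : forall p, `|th p| <= B.

Let conj_inf p : has_inf [set th m + mdist p m ^+ 2 | m in [set: S1]].
Proof.
split; first by exists (th p + mdist p p ^+ 2); exists p.
exists (- B) => _ [m _ <-]; have := thB m; rewrite ler_norml.
have := sqr_ge0 (mdist p m); lra.
Qed.

Lemma cost_conj_le p m : cost_conj th p <= th m + mdist p m ^+ 2.
Proof. by apply: ge_inf; [case: (conj_inf p)|exists m]. Qed.

Lemma le_cost_conj p x : (forall m, x <= th m + mdist p m ^+ 2) -> x <= cost_conj th p.
Proof. by move=> H; apply: lb_le_inf; [case: (conj_inf p)|move=> _ [m _ <-]]. Qed.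

Lemma cost_conj_ge p : - B <= cost_conj th p.
Proof.
apply: le_cost_conj => m; have := thB m; rewrite ler_norml.
have := sqr_ge0 (mdist p m); lra.
Qed.

(** An infimum of continuous functions, even over uncountably many points, has open strict sublevel
    sets. *)
Lemma measurable_cost_conj : measurable_fun [set: borel S1] (cost_conj th : borel S1 -> R).
Proof.
apply: measurable_circle_fun => mT.
apply: (measurability _ (RGenInftyO.measurableE R)) => //.
move=> _ [_ [a ->] <-]; rewrite setTI; apply: open_measurable.
rewrite (_ : _ @^-1` _ = \bigcup_(m in [set: S1])
    ((fun s => th m + mdist (e s) m ^+ 2) @^-1` [set y | y < a])).
  apply: bigcup_open => m _; apply: open_comp; last exact: open_lt.
  move=> s _; apply: cvgD; first exact: cvg_cst.
  by rewrite expr2; apply: cvgM; exact: circle_dist_continuous.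
apply/seteqP; split => s /=; rewrite in_itv/=.
  move=> /(inf_lt (conj_inf (e s)).1)[_ [m _ <-] h].
  by exists m.
by move=> [m _ /=]; apply: le_lt_trans; exact: cost_conj_le.
Qed.

End cost_conj.

(* Insert the midpoint of a shortest arc from [p] to [q] in both infima. *)
Lemma cost_conj_sum_le (th : S1 -> R) (B : R) (p q : S1) : (forall p, `|th p| <= B) ->
  cost_conj (fun m => - th m) p + cost_conj th q <= mdist p q ^+ 2 / 2.
Proof.
move=> thB; have nthB m : `|- th m| <= B by rewrite normrN.
have [a _ pE] := circle_param_surj p.
have [b bq ab] := circle_dist_lift a q.
rewrite -pE ab -bq.
have h1 := cost_conj_le nthB (e a) (e ((a + b) / 2)).
have h2 := cost_conj_le thB (e b) (e ((a + b) / 2)).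
have sq (x y z : R) : mdist (e x) (e y) <= z -> mdist (e x) (e y) ^+ 2 <= z ^+ 2.
  move=> h; have d0 : 0 <= mdist (e x) (e y) by exact: mdist_ge0.
  by rewrite ler_sqr ?nnegrE// (le_trans d0).
have l1 := sq _ _ _ (circle_param_lip D a ((a + b) / 2)).
have l2 := sq _ _ _ (circle_param_lip D b ((a + b) / 2)).
move: l1 l2 h1 h2; rewrite !real_normK ?num_real//.
lra.
Qed.

Section potential_pair.
Variables (S theta : R -> R) (B : R).
Hypothesis thetaL : forall z, theta (z + L) = theta z.
Hypothesis thetaB : forall z, `|theta z| <= B.
Hypothesis subS : forall z z',
  2 * S z * (z' - z) <= (z' ^+ 2 - theta z') - (z ^+ 2 - theta z).
Hypothesis subR : forall z z',
  2 * (2 * z - S z) * (z' - z) <= (z' ^+ 2 + theta z') - (z ^+ 2 + theta z).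

(** At the two ends of the plan both infima are attained at [e z]: any other point has a lift that
    realizes the distance, and for lifts [subS] and [subR] say precisely that [z] is a minimizer. *)
Lemma exists_circle_potentials : exists phi psi : borel S1 -> R,
  [/\ measurable_fun setT phi /\ measurable_fun setT psi,
      (forall p, - B <= phi p) /\ (forall p, - B <= psi p),
      forall p q : S1, phi p + psi q <= mdist p q ^+ 2 / 2 &
      forall z, phi (e (S z)) + psi (e (2 * z - S z)) = (2 * z - 2 * S z) ^+ 2 / 2].
Proof.
have [th thE] := periodic_circle_fun thetaL.
have thB p : `|th p| <= B by have [z _ <-] := circle_param_surj p; rewrite thE.
have nthB m : `|- th m| <= B by rewrite normrN.
have sq (x y : R) : mdist (e x) (e y) ^+ 2 <= (x - y) ^+ 2.
  rewrite -[leRHS](real_normK (num_real (x - y))).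
  by rewrite ler_sqr ?nnegrE ?mdist_ge0// circle_param_lip.
exists (cost_conj (fun m => - th m)), (cost_conj th); split.
- by split; [exact: measurable_cost_conj nthB|exact: measurable_cost_conj thB].
- by split => p; [exact: cost_conj_ge nthB p|exact: cost_conj_ge thB p].
- by move=> p q; exact: cost_conj_sum_le thB.
move=> z.
have -> : cost_conj (fun m => - th m) (e (S z)) = - theta z + (S z - z) ^+ 2.
  apply/eqP; rewrite eq_le; apply/andP; split.
    by rewrite (le_trans (cost_conj_le nthB _ (e z)))// thE lerD2l sq.
  apply: (le_cost_conj nthB) => m; have [t <- ->] := circle_dist_lift (S z) m.
  by rewrite thE real_normK ?num_real//; have := subS z t; lra.
have -> : cost_conj th (e (2 * z - S z)) = theta z + (z - S z) ^+ 2.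
  apply/eqP; rewrite eq_le; apply/andP; split.
    rewrite (le_trans (cost_conj_le thB _ (e z)))// thE lerD2l (le_trans (sq _ _))//.
    by rewrite (_ : 2 * z - S z - z = z - S z)//; ring.
  apply: (le_cost_conj thB) => m; have [t <- ->] := circle_dist_lift (2 * z - S z) m.
  by rewrite thE real_normK ?num_real//; have := subR z t; lra.
lra.
Qed.

(** Equality of the potentials along the plan bounds the squared gap of the lifts by the squared
    distance: the segment between the lifts projects to a shortest arc. *)
Lemma matching_dist z : mdist (e (S z)) (e (2 * z - S z)) = `|2 * z - 2 * S z|.
Proof.
have [phi [psi [_ _ le_d /(_ z) eq_d]]] := exists_circle_potentials.
apply/eqP; rewrite eq_le; apply/andP; split.
  rewrite (le_trans (circle_param_lip _ _ _))// distrC.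
  by rewrite (_ : 2 * z - S z - S z = 2 * z - 2 * S z)//; ring.
have := le_d (e (S z)) (e (2 * z - S z)); rewrite eq_d.
rewrite ler_pM2r ?invr_gt0// -ler_sqrt ?sqr_ge0// !sqrtr_sqr.
by rewrite [X in _ <= X -> _]ger0_norm ?mdist_ge0.
Qed.

End potential_pair.

End circle_transport.

Section law.
Context d d' (T : measurableType d) (T' : measurableType d') (R : realType).
Local Open Scope ereal_scope.

Lemma integral_law (m : {measure set T -> \bar R}) (nu : {measure set T' -> \bar R})
    (f : T -> T') (h : T' -> \bar R) :
  measurable_fun setT f -> (forall A, measurable A -> nu A = m (f @^-1` A)) ->
  measurable_fun setT h -> (forall x, 0 <= h x) ->
  \int[nu]_x h x = \int[m]_x h (f x).
Proof.
move=> mf nuE mh h0.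
have := ge0_integral_pushforward mf m measurableT mh (fun p _ => h0 p).
rewrite preimage_setT => <-.
by apply: eq_measure_integral => A mA _; rewrite nuE.
Qed.

End law.

Section circle_wasserstein.
Context (R : realType) (D : {posnum R}) (mu : probability (borel (circle D)) R).
Local Notation S1 := (circle D).
Local Notation X := (circle_mm mu).
Local Open Scope ereal_scope.

Lemma circle_finite_second_moment (nu : probability (borel X) R) :
  finite_second_moment nu.
Proof.
exists (circle_param D 0).
apply: (@le_lt_trans _ _ (\int[nu]_x (D%:num ^+ 2)%:E)).
  apply: ge0_le_integral => //.
  - by move=> x _; rewrite lee_fin sqr_ge0.
  - apply/measurable_EFinP; apply: measurable_funX.
    have h := (measurableT_comp (@measurable_circle_dist R D)
      (@measurable_pair1 _ _ (borel S1) (borel S1) (circle_param D 0))).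
    exact: h.
  - by move=> x _; rewrite lee_fin ler_sqr ?nnegrE ?mdist_ge0// circle_dist_le.
by rewrite integral_cst//= probability_setT mule1 ltry.
Qed.

Definition sqdist (z : borel S1 * borel S1) : \bar R :=
  (mdist (z.1 : S1) (z.2 : S1) ^+ 2)%:E.

Lemma sqdist_ge0 z : 0 <= sqdist z.
Proof. by rewrite lee_fin sqr_ge0. Qed.

Lemma measurable_sqdist : measurable_fun setT sqdist.
Proof.
by apply/measurable_EFinP; apply: measurable_funX; exact: measurable_circle_dist.
Qed.

Lemma coupling_fst (nu0 nu1 : probability (borel X) R) p (h : borel S1 -> \bar R) :
  coupling nu0 nu1 p -> measurable_fun setT h -> (forall x, 0 <= h x) ->
  \int[p]_z h z.1 = \int[nu0]_x h x.
Proof.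
move=> cp mh h0; apply/esym/(integral_law (f := fst)) => // A mA.
etransitivity; first exact: (esym (cp A mA).1).
congr (p _); by apply/seteqP; split => -[x y]//= [].
Qed.

Lemma coupling_snd (nu0 nu1 : probability (borel X) R) p (h : borel S1 -> \bar R) :
  coupling nu0 nu1 p -> measurable_fun setT h -> (forall x, 0 <= h x) ->
  \int[p]_z h z.2 = \int[nu1]_x h x.
Proof.
move=> cp mh h0; apply/esym/(integral_law (f := snd)) => // A mA.
etransitivity; first exact: (esym (cp A mA).2).
congr (p _); by apply/seteqP; split => -[x y]//= [].
Qed.

Lemma coupling_map d (T : measurableType d) (m : probability T R)
    (nu0 nu1 : probability (borel X) R) (f g : T -> borel S1) :
  measurable_fun setT f -> measurable_fun setT g ->
  (forall A, measurable A -> nu0 A = m (f @^-1` A)) ->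
  (forall A, measurable A -> nu1 A = m (g @^-1` A)) ->
  exists p : probability (borel X * borel X)%type R, coupling nu0 nu1 p /\
    forall A, p A = m ((fun x => (f x, g x)) @^-1` A).
Proof.
move=> mf mg nu0E nu1E.
have mfg : measurable_fun setT (fun x => (f x, g x)) by exact: measurable_fun_pair.
have [p pE] := exists_pushforward_probability m mfg.
exists p; split => // A mA; rewrite !pE nu0E// nu1E//.
by split; congr (m _); apply/seteqP; split => x //= [].
Qed.

Lemma transport_cost_sqdist (p : probability (borel X * borel X)%type R) :
  transport_cost p = \int[p]_z sqdist z.
Proof. by []. Qed.

Lemma W2_sym (nu0 nu1 : probability (borel X) R) : W2 nu0 nu1 = W2 nu1 nu0.
Proof.
suff H nu nu' : [set transport_cost p | p in coupling (X := X) nu nu'] `<=`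
    [set transport_cost p | p in coupling nu' nu].
  by rewrite /W2; congr (sqrte (ereal_inf _)); apply/seteqP; split; exact: H.
move=> _ [p cp <-].
have [p' [cp' p'E]] : exists p' : probability (borel X * borel X)%type R,
    coupling nu' nu p' /\ forall A, p' A = p ((fun x => (x.2, x.1)) @^-1` A).
  apply: coupling_map => // A mA.
  - etransitivity; first exact: (esym (cp A mA).2).
    congr (p _); by apply/seteqP; split => -[x y]//= [].
  - etransitivity; first exact: (esym (cp A mA).1).
    congr (p _); by apply/seteqP; split => -[x y]//= [].
exists p' => //; rewrite !transport_cost_sqdist.
rewrite (@integral_law _ _ _ _ R p p' (fun x => (x.2, x.1)) sqdist).
- by apply: eq_integral => z _; rewrite /sqdist/= !circle_mdistE circle_distC.
- exact: measurable_fun_pair.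
- by move=> A _; exact: p'E.
- exact: measurable_sqdist.
- exact: sqdist_ge0.
Qed.

End circle_wasserstein.

(* The junk value [0^-1 = 0] makes this true at [s = 0] and [t = 1] under the two
   implications. *)
Lemma weighted_sqrD (R : realFieldType) (s t a b c : R) :
  0 <= s -> s < t -> t <= 1 -> (s = 0 -> a = 0) -> (t = 1 -> c = 0) ->
  (a + b + c) ^+ 2 <= s^-1 * a ^+ 2 + (t - s)^-1 * b ^+ 2 + (1 - t)^-1 * c ^+ 2.
Proof.
move=> s0 st t1 a0 c0.
have [a' aE] : exists a', a = s * a' /\ s^-1 * a ^+ 2 = s * a' ^+ 2.
  have [s00|sn0] := eqVneq s 0; first by exists 0; rewrite a0// s00; split; ring.
  by exists (a / s); split; field.
have [b' bE] : exists b', b = (t - s) * b' /\ (t - s)^-1 * b ^+ 2 = (t - s) * b' ^+ 2.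
  by exists (b / (t - s)); split; field; lra.
have [c' cE] : exists c', c = (1 - t) * c' /\ (1 - t)^-1 * c ^+ 2 = (1 - t) * c' ^+ 2.
  have [t11|tn1] := eqVneq t 1; first by exists 0; rewrite c0// t11; split; ring.
  by exists (c / (1 - t)); split; field; rewrite subr_eq0 eq_sym.
rewrite aE.2 bE.2 cE.2 aE.1 bE.1 cE.1 -subr_ge0.
(* Convexity of the square for the weights [s], [t - s] and [1 - t]; the difference of the two sides
   is a weighted variance. *)
have -> : s * a' ^+ 2 + (t - s) * b' ^+ 2 + (1 - t) * c' ^+ 2 -
    (s * a' + (t - s) * b' + (1 - t) * c') ^+ 2 =
    s * (t - s) * (a' - b') ^+ 2 + s * (1 - t) * (a' - c') ^+ 2 +
    (t - s) * (1 - t) * (b' - c') ^+ 2 by ring.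
by rewrite !addr_ge0// mulr_ge0 ?sqr_ge0// mulr_ge0//; lra.
Qed.

(** * Optimality and geodesics from a family of maps and a pair of potentials *)

Section interpolation.
Context (R : realType) (D : {posnum R}) (mu : probability (borel (circle D)) R).
Local Notation S1 := (circle D).
Local Notation X := (circle_mm mu).
Context d (T : measurableType d) (m : probability T R).
Variables (x : R -> T -> borel S1) (len : T -> R).
Hypothesis mx : forall t, measurable_fun setT (x t).
Hypothesis mlen : measurable_fun setT len.
Hypothesis len_ge0 : forall w, 0 <= len w.
Hypothesis lenE : forall w, len w = mdist (x 0 w : S1) (x 1 w : S1).
Hypothesis x_lip : forall s t w, mdist (x s w : S1) (x t w : S1) <= `|s - t| * len w.
Variables (nu : R -> probability (borel X) R).
Hypothesis nuE : forall t A, measurable A -> nu t A = m (x t @^-1` A).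
Variables (phi psi : borel S1 -> R) (B : R).
Hypotheses (mphi : measurable_fun setT phi) (mpsi : measurable_fun setT psi).
Hypothesis B0 : 0 <= B.
Hypotheses (phiB : forall p, - B <= phi p) (psiB : forall p, - B <= psi p).
Hypothesis phi_psi : forall p q : S1, phi p + psi q <= mdist p q ^+ 2 / 2.
Hypothesis phi_psi_len : forall w, phi (x 0 w) + psi (x 1 w) = len w ^+ 2 / 2.

Let C : \bar R := (\int[m]_w (len w ^+ 2)%:E)%E.

Let len_le w : len w <= D%:num.
Proof. by rewrite lenE circle_dist_le. Qed.

Let msqlen : measurable_fun setT (fun w => (len w ^+ 2)%:E).
Proof. by apply/measurable_EFinP; exact: measurable_funX. Qed.

Let C_fin : C \is a fin_num.
Proof.
rewrite ge0_fin_numE; last by apply: integral_ge0 => w _; rewrite lee_fin sqr_ge0.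
apply: (@le_lt_trans _ _ (\int[m]_w (D%:num ^+ 2)%:E)%E).
  apply: ge0_le_integral => //.
  - by move=> w _; rewrite lee_fin sqr_ge0.
  - by move=> w _; rewrite lee_fin ler_sqr ?nnegrE.
by rewrite integral_cst//= probability_setT mule1 ltry.
Qed.

Lemma optimal_cost_le (p : probability (borel X * borel X)%type R) :
  coupling (nu 0) (nu 1) p -> (C <= transport_cost p)%E.
Proof.
move=> cp; rewrite transport_cost_sqdist.
(* The easy half of Kantorovich duality. Adding [B] to both potentials makes them nonnegative; the
   resulting [4 * B] is put on both sides and cancelled. *)
pose f1 q : \bar R := (2 * (phi q + B))%:E.
pose f2 q : \bar R := (2 * (psi q + B))%:E.
have f10 q : (0 <= f1 q)%E by rewrite lee_fin; have := phiB q; lra.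
have f20 q : (0 <= f2 q)%E by rewrite lee_fin; have := psiB q; lra.
have mf1 : measurable_fun setT f1.
  by apply/measurable_EFinP; apply: measurable_funM => //; exact: measurable_funD.
have mf2 : measurable_fun setT f2.
  by apply/measurable_EFinP; apply: measurable_funM => //; exact: measurable_funD.
have cstp (P : probability (borel X * borel X)%type R) : (\int[P]_z (4 * B)%:E = (4 * B)%:E)%E.
  by rewrite integral_cst//= probability_setT mule1.
have cstm : (\int[m]_z (4 * B)%:E = (4 * B)%:E)%E.
  by rewrite integral_cst//= probability_setT mule1.
have B40 : (0 <= (4 * B)%:E)%E by rewrite lee_fin mulr_ge0.
suff : (C + (4 * B)%:E <= \int[p]_z sqdist z + (4 * B)%:E)%E by rewrite leeD2rE.
have -> : (\int[p]_z sqdist z + (4 * B)%:E = \int[p]_z (sqdist z + (4 * B)%:E))%E.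
  rewrite ge0_integralD//= ?cstp//; first by move=> z _; exact: sqdist_ge0.
  exact: measurable_sqdist.
have -> : (C + (4 * B)%:E = \int[m]_w ((len w ^+ 2)%:E + (4 * B)%:E))%E.
  by rewrite ge0_integralD//= ?cstm// => w _; rewrite lee_fin sqr_ge0.
have E1 : (\int[p]_z f1 z.1 = \int[m]_w f1 (x 0 w))%E.
  etransitivity; first exact: coupling_fst cp mf1 f10.
  exact: integral_law (mx 0) (nuE 0) mf1 f10.
have E2 : (\int[p]_z f2 z.2 = \int[m]_w f2 (x 1 w))%E.
  etransitivity; first exact: coupling_snd cp mf2 f20.
  exact: integral_law (mx 1) (nuE 1) mf2 f20.
apply: (@le_trans _ _ (\int[p]_z (f1 z.1 + f2 z.2))%E); last first.
  apply: ge0_le_integral => //.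
  - by move=> z _; rewrite adde_ge0.
  - by apply: emeasurable_funD; exact: measurableT_comp.
  - by apply: emeasurable_funD => //; exact: measurable_sqdist.
  - move=> z _; rewrite lee_fin; have := phi_psi z.1 z.2; lra.
have -> : (\int[p]_z (f1 z.1 + f2 z.2) = \int[m]_w (f1 (x 0 w) + f2 (x 1 w)))%E.
  rewrite [LHS]ge0_integralD//; try exact: measurableT_comp.
  by rewrite E1 E2 ge0_integralD//; exact: measurableT_comp.
rewrite le_eqVlt; apply/orP; left; apply/eqP; apply: eq_integral => w _.
by rewrite /f1 /f2 -!EFinD; congr (_%:E); have := phi_psi_len w; lra.
Qed.

(** At an interior time the position determines both ends of the trajectory. [interp_inverse]
    provides this from strict monotonicity of the interpolated map. *)
Hypothesis back : forall s, 0 <= s < 1 -> exists2 a : borel S1 -> borel S1,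
  measurable_fun setT a & forall w, a (x s w) = x 0 w.
Hypothesis forth : forall t, 0 < t <= 1 -> exists2 b : borel S1 -> borel S1,
  measurable_fun setT b & forall w, b (x t w) = x 1 w.

Let integral_sq_le (nu' : probability (borel X) R) (f : T -> borel S1)
    (k : borel S1 -> borel S1) (r : R) : 0 <= r ->
  measurable_fun setT k -> measurable_fun setT f ->
  (forall A, measurable A -> nu' A = m (f @^-1` A)) ->
  (forall w, mdist (k (f w) : S1) (f w : S1) <= r * len w) ->
  (\int[nu']_q (mdist (k q : S1) (q : S1) ^+ 2)%:E <= (r ^+ 2)%:E * C)%E.
Proof.
move=> r0 mk mf nu'E kf.
have mh : measurable_fun setT (fun q => (mdist (k q : S1) (q : S1) ^+ 2)%:E).
  have mkq : measurable_fun setT (fun q => (k q, q)) by exact: measurable_fun_pair.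
  exact: (measurableT_comp (@measurable_sqdist R D) mkq).
rewrite (integral_law mf nu'E mh); last by move=> q; rewrite lee_fin sqr_ge0.
rewrite -ge0_integralZl//; last 2 first.
- by move=> w _; rewrite lee_fin sqr_ge0.
- by rewrite lee_fin sqr_ge0.
apply: ge0_le_integral => //.
- by move=> w _; rewrite lee_fin sqr_ge0.
- exact: (measurableT_comp mh mf).
- exact: emeasurable_funM.
- move=> w _; rewrite -EFinM lee_fin -exprMn ler_sqr ?nnegrE ?mdist_ge0//.
  by rewrite mulr_ge0.
Qed.

(* Glueing a coupling of [nu s] and [nu t] with the maps back to time 0 and forth
   to time 1 gives a coupling of the end points, whose cost is at least [C]. *)
Lemma interpolation_cost_le s t (p : probability (borel X * borel X)%type R) :
  0 <= s -> s < t -> t <= 1 -> coupling (nu s) (nu t) p ->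
  (((t - s) ^+ 2)%:E * C <= transport_cost p)%E.
Proof.
move=> s0 st t1 cp.
(* At [s = 0] the map must be the identity everywhere, so that the term with the junk weight [0^-1]
   vanishes in [weighted_sqrD]; likewise for [b] at [t = 1]. *)
have [a [ma aE a0]] : exists a : borel S1 -> borel S1,
    [/\ measurable_fun setT a, forall w, a (x s w) = x 0 w &
        s = 0 -> forall q, a q = q].
  have [->|sn0] := eqVneq s 0; first by exists id.
  have [|a ma aE] := @back s; first by lra.
  by exists a; split => // s00; move: sn0; rewrite s00 eqxx.
have [b [mb bE b1]] : exists b : borel S1 -> borel S1,
    [/\ measurable_fun setT b, forall w, b (x t w) = x 1 w &
        t = 1 -> forall q, b q = q].
  have [->|tn1] := eqVneq t 1; first by exists id.
  have [|b mb bE] := @forth t; first by lra.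
  by exists b; split => // t11; move: tn1; rewrite t11 eqxx.
have mafst : measurable_fun setT (a \o fst : borel S1 * borel S1 -> borel S1).
  exact: measurableT_comp.
have mbsnd : measurable_fun setT (b \o snd : borel S1 * borel S1 -> borel S1).
  exact: measurableT_comp.
have [p' [cp' p'E]] : exists p' : probability (borel X * borel X)%type R,
    coupling (nu 0) (nu 1) p' /\
    forall A, p' A = p ((fun z => ((a \o fst) z, (b \o snd) z)) @^-1` A).
  apply: (coupling_map mafst mbsnd) => A mA.
  - have mA' : measurable (a @^-1` A) by rewrite -[X in measurable X]setTI; exact: ma.
    transitivity (nu s (a @^-1` A)).
      rewrite !nuE//; congr (m _); apply/funext => w /=.
      by rewrite -(aE w).
    etransitivity; first exact: (esym (cp _ mA').1).
    by congr (p _); apply/seteqP; split => -[u v]//= [].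
  - have mA' : measurable (b @^-1` A) by rewrite -[X in measurable X]setTI; exact: mb.
    transitivity (nu t (b @^-1` A)).
      rewrite !nuE//; congr (m _); apply/funext => w /=.
      by rewrite -(bE w).
    etransitivity; first exact: (esym (cp _ mA').2).
    by congr (p _); apply/seteqP; split => -[u v]//= [].
have := optimal_cost_le cp'; rewrite transport_cost_sqdist.
have -> : (\int[p']_z sqdist z = \int[p]_z sqdist (a z.1, b z.2))%E.
  apply: (integral_law (f := fun z => (a z.1, b z.2))).
  - exact: measurable_fun_pair.
  - by move=> A _; exact: p'E.
  - exact: measurable_sqdist.
  - exact: sqdist_ge0.
pose f1 q : \bar R := (mdist (a q : S1) (q : S1) ^+ 2)%:E.
pose f2 q : \bar R := (mdist (b q : S1) (q : S1) ^+ 2)%:E.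
have f10 q : (0 <= f1 q)%E by rewrite lee_fin sqr_ge0.
have f20 q : (0 <= f2 q)%E by rewrite lee_fin sqr_ge0.
have mf1 : measurable_fun setT f1.
  have h : measurable_fun setT (fun q => (a q, q)) by exact: measurable_fun_pair.
  exact: (measurableT_comp (@measurable_sqdist R D) h).
have mf2 : measurable_fun setT f2.
  have h : measurable_fun setT (fun q => (b q, q)) by exact: measurable_fun_pair.
  exact: (measurableT_comp (@measurable_sqdist R D) h).
have E1 : (\int[p]_z f1 z.1 <= (s ^+ 2)%:E * C)%E.
  apply: (@le_trans _ _ (\int[nu s]_q f1 q)%E).
    by rewrite le_eqVlt; apply/orP; left; apply/eqP; exact: coupling_fst cp mf1 f10.
  apply: integral_sq_le => //; first exact: nuE.
  move=> w; rewrite aE; have := x_lip 0 s w.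
  by rewrite sub0r normrN ger0_norm.
have E2 : (\int[p]_z f2 z.2 <= ((1 - t) ^+ 2)%:E * C)%E.
  apply: (@le_trans _ _ (\int[nu t]_q f2 q)%E).
    by rewrite le_eqVlt; apply/orP; left; apply/eqP; exact: coupling_snd cp mf2 f20.
  apply: integral_sq_le => //; [by lra|exact: nuE|].
  move=> w; rewrite bE; have := x_lip 1 t w.
  by rewrite ger0_norm//; lra.
set I := (\int[p]_z sqdist z)%E => CI.
(* Triangle inequality through [u] and [v], then [weighted_sqrD]. The outer terms cost at most
   [s * C] and [(1 - t) * C], so what is left reads [(t - s) * C <= I / (t - s)]. *)
have : (C <= s^-1%:E * \int[p]_z f1 z.1 + (t - s)^-1%:E * I +
    (1 - t)^-1%:E * \int[p]_z f2 z.2)%E.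
  apply: (le_trans CI).
  have mf1' : measurable_fun setT (fun z : borel S1 * borel S1 => f1 z.1).
    exact: measurableT_comp.
  have mf2' : measurable_fun setT (fun z : borel S1 * borel S1 => f2 z.2).
    exact: measurableT_comp.
  have s'0 : (0 <= s^-1%:E :> \bar R)%E by rewrite lee_fin invr_ge0.
  have ts0 : (0 <= (t - s)^-1%:E :> \bar R)%E by rewrite lee_fin invr_ge0; lra.
  have t'0 : (0 <= (1 - t)^-1%:E :> \bar R)%E by rewrite lee_fin invr_ge0; lra.
  have msq := @measurable_sqdist R D.
  have I1 : (s^-1%:E * \int[p]_z f1 z.1 = \int[p]_z (s^-1%:E * f1 z.1))%E.
    by rewrite ge0_integralZl.
  have I2 : ((t - s)^-1%:E * I = \int[p]_z ((t - s)^-1%:E * sqdist z))%E.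
    by rewrite ge0_integralZl// => z _; exact: sqdist_ge0.
  have I3 : ((1 - t)^-1%:E * \int[p]_z f2 z.2 = \int[p]_z ((1 - t)^-1%:E * f2 z.2))%E.
    by rewrite ge0_integralZl.
  rewrite I1 I2 I3.
  have mg1 := emeasurable_funM (measurable_cst (s^-1%:E : \bar R)) mf1'.
  have mg2 := emeasurable_funM (measurable_cst ((1 - t)^-1%:E : \bar R)) mf2'.
  have mg := emeasurable_funM (measurable_cst ((t - s)^-1%:E : \bar R))
    (@measurable_sqdist R D).
  rewrite -!ge0_integralD//; try (by move=> z _; rewrite ?adde_ge0 ?mule_ge0 ?sqdist_ge0//);
    try exact: emeasurable_funD.
  apply: ge0_le_integral => //.
  - by move=> z _; exact: sqdist_ge0.
  - exact: (measurableT_comp (@measurable_sqdist R D) (measurable_fun_pair mafst mbsnd)).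
  - by do 2 (apply: emeasurable_funD => //).
  move=> [u v] _; rewrite /sqdist/= /f1 /f2 -!EFinM -!EFinD lee_fin.
  apply: (@le_trans _ _ ((mdist (a u : S1) u + mdist (u : S1) v + mdist (b v : S1) v) ^+ 2)).
    rewrite ler_sqr ?nnegrE ?addr_ge0 ?mdist_ge0//.
    rewrite [leLHS]circle_mdistE (le_trans (circle_dist_triangle u _ _))//.
    rewrite -addrA lerD// (le_trans (circle_dist_triangle v _ _))//.
    by rewrite lerD// circle_distC.
  apply: weighted_sqrD => //.
    by move=> /a0 ->; rewrite circle_mdistE circle_dist_xx.
  by move=> /b1 ->; rewrite circle_mdistE circle_dist_xx.
move: E1 E2; rewrite -(fineK C_fin); set c := fine C => E1 E2 H.
rewrite transport_cost_sqdist -/I.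
have I0 : (0 <= I)%E by apply: integral_ge0 => z _; exact: sqdist_ge0.
have [Ioo|Ioo] := eqVneq I +oo%E; first by rewrite Ioo leey.
have Ifin : I \is a fin_num by rewrite ge0_fin_numE// ltey.
rewrite -EFinM -(fineK Ifin) lee_fin; move: H; rewrite -(fineK Ifin); set i := fine I => H.
have s2 : s^-1 * (s ^+ 2 * c) = s * c.
  by have [->|sn0] := eqVneq s 0; [ring|field].
have t2 : (1 - t)^-1 * ((1 - t) ^+ 2 * c) = (1 - t) * c.
  have [->|tn1] := eqVneq t 1; first by rewrite subrr; ring.
  by field; rewrite subr_eq0 eq_sym.
have : (c%:E <= (s * c + (t - s)^-1 * i + (1 - t) * c)%:E)%E.
  apply: (le_trans H); rewrite !EFinD leeD ?leeD//.
  - by rewrite -s2 EFinM lee_wpmul2l ?lee_fin ?invr_ge0.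
  - by rewrite -t2 EFinM lee_wpmul2l ?lee_fin ?invr_ge0 ?subr_ge0.
rewrite lee_fin => {}H.
have ts0 : 0 < t - s by lra.
have : (t - s) * c <= (t - s)^-1 * i by lra.
by move=> ?; rewrite expr2 -mulrA -ler_pdivlMl.
Qed.

Lemma interpolation_W2 s t : 0 <= s -> s <= t -> t <= 1 ->
  W2 (nu s) (nu t) = sqrte (((t - s) ^+ 2)%:E * C)%E.
Proof.
move=> s0 st t1; rewrite /W2; congr sqrte; apply/eqP; rewrite eq_le; apply/andP; split.
  have [p [cp pE]] := coupling_map (mx s) (mx t) (nuE s) (nuE t).
  apply: (@le_trans _ _ (transport_cost p)); first by apply: ereal_inf_lbound; exists p.
  rewrite transport_cost_sqdist.
  have mst : measurable_fun setT (fun w => (x s w, x t w)) by exact: measurable_fun_pair.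
  have -> : (\int[p]_z sqdist z = \int[m]_w sqdist (x s w, x t w))%E.
    exact: (integral_law mst (fun A _ => pE A) (@measurable_sqdist R D) (@sqdist_ge0 R D)).
  rewrite -ge0_integralZl//; last 2 first.
  - by move=> w _; rewrite lee_fin sqr_ge0.
  - by rewrite lee_fin sqr_ge0.
  apply: ge0_le_integral => //.
  - by move=> w _; exact: sqdist_ge0.
  - exact: (measurableT_comp (@measurable_sqdist R D) mst).
  - exact: emeasurable_funM.
  move=> w _; rewrite /sqdist -EFinM lee_fin -exprMn ler_sqr ?nnegrE ?mdist_ge0//.
    by have := x_lip s t w; rewrite distrC ger0_norm ?subr_ge0.
  by rewrite mulr_ge0 ?subr_ge0.
apply/ereal_infP => _ [p cp <-].
move: st; rewrite le_eqVlt => /predU1P[->|st]; last exact: interpolation_cost_le.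
rewrite subrr expr0n mul0e transport_cost_sqdist.
by apply: integral_ge0 => z _; exact: sqdist_ge0.
Qed.

Lemma interpolation_geodesic : P2_geodesic (nu 0) (nu 1) nu.
Proof.
split=> //; first by move=> t _; exact: circle_finite_second_moment.
have W01 : W2 (nu 0) (nu 1) = sqrte C.
  by rewrite interpolation_W2// subr0 expr1n mul1e.
have Wst s t : 0 <= s -> s <= t -> t <= 1 ->
    W2 (nu s) (nu t) = (`|s - t|%:E * W2 (nu 0) (nu 1))%E.
  move=> s0 st t1; rewrite interpolation_W2// W01.
  rewrite -(fineK C_fin) -EFinM /= sqrtrM ?sqr_ge0// sqrtr_sqr.
  by rewrite distrC EFinM.
move=> s t /andP[s0 s1] /andP[t0 t1].
have [st|/ltW ts] := leP s t; first exact: Wst.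
by rewrite W2_sym distrC Wst.
Qed.

End interpolation.

(** * Distortion coefficients and entropy *)

Section comparison.
Context (R : realType).
Implicit Types (t x y z p q : R).

Lemma jensen_powR p t x y : 1 <= p -> 0 <= t <= 1 -> 0 <= x -> 0 <= y ->
  (t * x + (1 - t) * y) `^ p <= t * x `^ p + (1 - t) * y `^ p.
Proof.
move=> p1 /andP[t0 t1] x0 y0.
have := @convex_powR R p p1 (Itv01 t0 t1) x y.
rewrite !inE/= !in_itv/= !andbT => /(_ x0 y0).
by rewrite !convRE.
Qed.

(** The cosine [phi] centred at the midpoint is positive on the interval, whose length is below
    [pi / om]. Then [(w / phi)' = W / phi ^ 2] with [W' = phi * (w2 + om ^ 2 * w) <= 0]. A negative
    value of [w] between its two zeros would make [W] negative at some point and positive at a later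
    one. *)
Lemma sturm_ge0 (om x0 x1 : R) (w w1 w2 : R -> R) : 0 < om -> x0 < x1 ->
  om * (x1 - x0) < pi ->
  (forall x, is_derive x (1 : R) w (w1 x)) ->
  (forall x, is_derive x (1 : R) w1 (w2 x)) ->
  (forall x, w2 x + om ^+ 2 * w x <= 0) -> w x0 = 0 -> w x1 = 0 ->
  forall z, x0 < z < x1 -> 0 <= w z.
Proof.
move=> om0 x01 ompi dw dw1 w2le wx0 wx1 z /andP[x0z zx1].
pose mid := (x0 + x1) / 2.
pose phi s := cos (om * (s - mid)).
have phi_gt0 s : x0 <= s <= x1 -> 0 < phi s.
  by move=> /andP[h1 h2]; apply: cos_gt0_pihalf; rewrite /mid; nra.
have dphi s : is_derive s (1 : R) phi (- om * sin (om * (s - mid))).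
  rewrite /phi; apply: is_derive_eq; rewrite /GRing.scale/=; ring.
pose W s := phi s * w1 s + om * sin (om * (s - mid)) * w s.
have dW s : is_derive s (1 : R) W (phi s * (w2 s + om ^+ 2 * w s)).
  have dsin : is_derive s (1 : R) (fun s => sin (om * (s - mid))) (om * phi s).
    by rewrite /phi; apply: is_derive_eq; rewrite /GRing.scale/=; ring.
  rewrite /W; apply: is_derive_eq; rewrite /GRing.scale/=; ring.
have dq s : x0 <= s <= x1 -> is_derive s (1 : R) (fun s => w s / phi s) (W s / phi s ^+ 2).
  move=> /phi_gt0 phis; have phin0 : phi s != 0 by rewrite gt_eqF.
  by apply: is_derive_eq; rewrite /GRing.scale/= /W; field.
have is_der_cont (f f' : R -> R) (a b : R) :
    (forall s : R, a <= s <= b -> is_derive s (1 : R) f (f' s)) -> {within `[a, b], continuous f}.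
  move=> df; apply: continuous_in_subspaceT => s; rewrite inE/= in_itv/= => /df ds.
  by apply: differentiable_continuous; apply/derivable1_diffP; exact: ex_derive.
have mvt (f f' : R -> R) (a b : R) : a < b ->
    (forall s : R, a <= s <= b -> is_derive s (1 : R) f (f' s)) ->
    exists2 c, a < c < b & f b - f a = f' c * (b - a).
  move=> ab df; have [|c cab ->] := @MVT R f f' a b ab _ (is_der_cont _ _ _ _ df).
    by move=> x; rewrite in_itv/= => /andP[h1 h2]; apply: df; rewrite !ltW.
  by exists c => //; move: cab; rewrite in_itv.
rewrite leNgt; apply/negP => wz.
have qz : w z / phi z < 0.
  by rewrite pmulr_llt0// invr_gt0 phi_gt0// !ltW.
have [c1 /andP[c1l c1r]] := mvt (fun s => w s / phi s) (fun s => W s / phi s ^+ 2) _ _ x0z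
  (fun s => ltac:(move=> /andP[h1 h2]; apply: dq; lra)).
rewrite wx0 mul0r subr0 => E1.
have [c2 /andP[c2l c2r]] := mvt (fun s => w s / phi s) (fun s => W s / phi s ^+ 2) _ _ zx1
  (fun s => ltac:(move=> /andP[h1 h2]; apply: dq; lra)).
rewrite wx1 mul0r sub0r => E2.
have W1 : W c1 < 0.
  have : W c1 / phi c1 ^+ 2 * (z - x0) < 0 by rewrite -E1.
  rewrite pmulr_llt0 ?subr_gt0// pmulr_llt0// invr_gt0 exprn_gt0// phi_gt0//; lra.
have W2 : 0 < W c2.
  have : 0 < W c2 / phi c2 ^+ 2 * (x1 - z) by rewrite -E2 oppr_gt0.
  rewrite pmulr_lgt0 ?subr_gt0// pmulr_lgt0// invr_gt0 exprn_gt0// phi_gt0//; lra.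
have c12 : c1 < c2 by lra.
have [c3 /andP[c3l c3r] E3] := mvt W _ _ _ c12 (fun s _ => dW s).
have : W c2 - W c1 <= 0.
  rewrite E3 mulr_le0_ge0 ?subr_ge0 ?(ltW c12)// mulr_ge0_le0// ltW// phi_gt0//; lra.
lra.
Qed.

(** The right-hand side is the value of the solution of [y'' + om ^ 2 * y = 0] with the end values
    of [h]; [sturm_ge0] applies to its difference with [h]. *)
Lemma trig_convex (om x0 x1 t : R) (h h1 h2 : R -> R) : 0 < om -> x0 < x1 ->
  om * (x1 - x0) < pi -> 0 < t < 1 ->
  (forall x, is_derive x (1 : R) h (h1 x)) ->
  (forall x, is_derive x (1 : R) h1 (h2 x)) ->
  (forall x, 0 <= h2 x + om ^+ 2 * h x) ->
  h ((1 - t) * x0 + t * x1) <=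
    sin (om * ((1 - t) * (x1 - x0))) / sin (om * (x1 - x0)) * h x0 +
    sin (om * (t * (x1 - x0))) / sin (om * (x1 - x0)) * h x1.
Proof.
move=> om0 x01 ompi t01 dh dh1 hge.
set si := sin (om * (x1 - x0)).
have si0 : 0 < si by apply: sin_gt0_pi; rewrite ompi andbT mulr_gt0 ?subr_gt0.
have si_neq0 : si != 0 by rewrite gt_eqF.
pose w s := sin (om * (x1 - s)) / si * h x0 + sin (om * (s - x0)) / si * h x1 - h s.
pose w1 s := - om * cos (om * (x1 - s)) / si * h x0 + om * cos (om * (s - x0)) / si * h x1 - h1 s.
pose w2 s := - om ^+ 2 * sin (om * (x1 - s)) / si * h x0 - om ^+ 2 * sin (om * (s - x0)) / si * h x1 - h2 s.
have dw s : is_derive s (1 : R) w (w1 s).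
  by apply: is_derive_eq; rewrite /GRing.scale/= /w1; field.
have dw1 s : is_derive s (1 : R) w1 (w2 s).
  by apply: is_derive_eq; rewrite /GRing.scale/= /w2; field.
pose z := (1 - t) * x0 + t * x1.
have zI : x0 < z < x1 by rewrite /z; nra.
have : 0 <= w z.
  apply: (sturm_ge0 om0 x01 ompi dw dw1) zI.
  - by move=> s; have := hge s; rewrite /w2 /w; nra.
  - by rewrite /w -/si subrr mulr0 sin0; field.
  - by rewrite /w subrr mulr0 sin0 -/si; field.
rewrite /w /z.
have -> : x1 - ((1 - t) * x0 + t * x1) = (1 - t) * (x1 - x0) by ring.
have -> : (1 - t) * x0 + t * x1 - x0 = t * (x1 - x0) by ring.
by rewrite subr_ge0.
Qed.

End comparison.

Section distortion.
Context (R : realType).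
Variables (K N : R) (f f1 f2 : R -> R).
Hypotheses (K0 : K < 0) (N0 : N < 0).
Hypothesis df : forall x, is_derive x (1 : R) f (f1 x).
Hypothesis df1 : forall x, is_derive x (1 : R) f1 (f2 x).
Hypothesis ricci : forall x, K <= f2 x + f1 x ^+ 2 / (1 - N).

Lemma sfun_ratio (k t theta : R) : 0 < k -> 0 < t -> 0 < theta ->
  t * (Defs.sfun k (t * theta) / Defs.sfun k theta) =
  sin (Num.sqrt k * (t * theta)) / sin (Num.sqrt k * theta).
Proof.
move=> k0 t0 th0; rewrite /Defs.sfun !gt_eqF ?mulr_gt0// k0 !invfM invrK.
have sk : Num.sqrt k != 0 by rewrite gt_eqF// sqrtr_gt0.
set u := (sin _)^-1; move: (sin _) => v.
by field; rewrite sk !gt_eqF.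
Qed.

(* [h := exp (f / (1 - N'))] satisfies [h'' + K / (N' - 1) * h >= 0]. *)
Lemma density_root_convex (N' S Q t : R) : N <= N' -> N' < 0 -> 0 < t < 1 ->
  (`|S - Q|%:E < omega (K / (N' - 1)))%E ->
  expR (f ((1 - t) * S + t * Q) / (1 - N')) <=
    (1 - t) * (Defs.sfun (K / (N' - 1)) ((1 - t) * `|S - Q|) /
               Defs.sfun (K / (N' - 1)) `|S - Q|) * expR (f S / (1 - N')) +
    t * (Defs.sfun (K / (N' - 1)) (t * `|S - Q|) /
         Defs.sfun (K / (N' - 1)) `|S - Q|) * expR (f Q / (1 - N')).
Proof.
move=> NN' N'0 t01 small; pose h z := expR (f z / (1 - N')).
rewrite -/(h S) -/(h Q) -/(h ((1 - t) * S + t * Q)).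
set k := K / (N' - 1) in small *.
have k0 : 0 < k by rewrite /k -mulrNN -invrN; apply: mulr_gt0; rewrite ?invr_gt0; have := K0; lra.
pose om := Num.sqrt k.
have om0 : 0 < om by rewrite sqrtr_gt0.
have omk : om ^+ 2 = k by rewrite sqr_sqrtr// ltW.
have n0 : 0 < 1 - N' by lra.
pose h1 z := f1 z / (1 - N') * h z.
pose h2 z := (f2 z / (1 - N') + (f1 z / (1 - N')) ^+ 2) * h z.
have dh x : is_derive x (1 : R) h (h1 x).
  by apply: is_derive_eq; rewrite /GRing.scale/= /h1 /h; field; lra.
have dh1 x : is_derive x (1 : R) h1 (h2 x).
  by apply: is_derive_eq; rewrite /GRing.scale/= /h2 /h1; field; lra.
have hge x : 0 <= h2 x + om ^+ 2 * h x.
  have -> : h2 x + om ^+ 2 * h x =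
      (f2 x + f1 x ^+ 2 / (1 - N') - K) / (1 - N') * h x.
    by rewrite omk /k /h2; field; lra.
  apply: mulr_ge0; last exact: expR_ge0.
  apply: divr_ge0; last exact: ltW.
  rewrite subr_ge0.
  (* Since [N <= N'], the term [f1 ^ 2 / (1 - N')] is the larger one: the bound for [N] implies that
     for [N']. *)
  apply: le_trans (ricci x) _; rewrite lerD2l ler_wpM2l ?sqr_ge0//.
  by rewrite lef_pV2 ?posrE; have := N0; lra.
have main x0 x1 s : x0 < x1 -> 0 < s < 1 -> om * (x1 - x0) < pi ->
    h ((1 - s) * x0 + s * x1) <=
    (1 - s) * (Defs.sfun k ((1 - s) * (x1 - x0)) / Defs.sfun k (x1 - x0)) * h x0 +
    s * (Defs.sfun k (s * (x1 - x0)) / Defs.sfun k (x1 - x0)) * h x1.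
  move=> x01 s01 lt; rewrite !sfun_ratio ?subr_gt0//; try lra.
  exact: (trig_convex om0 x01 lt s01 dh dh1 hge).
have lt_pi th : (th%:E < omega k)%E -> om * th < pi.
  by rewrite /omega k0 lte_fin ltr_pdivlMr// mulrC.
have [SQ|QS|->] := ltgtP S Q.
- move: small; rewrite ltr0_norm ?subr_lt0// opprB => /lt_pi; exact: main.
- move: small; rewrite gtr0_norm ?subr_gt0// => /lt_pi small.
  have := main Q S (1 - t) QS; rewrite subKr => /(_ ltac:(lra) small).
  by rewrite addrC [leRHS]addrC.
- rewrite subrr normr0 !mulr0 /Defs.sfun eqxx divr1 !mulr1.
  by rewrite -!mulrDl subrK !mul1r.
Qed.

(* Jensen's inequality for the power [1 - 1 / N'], with weights proportional to
   [(1 - t) * s] and [t * r]. *)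
Lemma distortion_pointwise (N' S Q t g s r u0 u1 : R) : N <= N' -> N' < 0 ->
  0 < t < 1 -> 0 < g -> 0 < s -> 0 < r ->
  u0 * expR (- f S) * s = g -> u1 * expR (- f Q) * r = g ->
  (((g / (((1 - t) * s + t * r) * expR (- f ((1 - t) * S + t * Q)))) `^ (- N'^-1))%R%:E
   <= tau K N' (1 - t)%R `|S - Q|%R * (u0 `^ (- N'^-1))%R%:E +
      tau K N' t `|S - Q|%R * (u1 `^ (- N'^-1))%R%:E)%E.
Proof.
move=> NN' N'0 t01 g0 s0 r0 u0E u1E.
have [t0 t1] : 0 < t /\ 0 < 1 - t by lra.
have pos u v c : 0 < c -> u * expR v * c = g -> 0 < u.
  move=> c0 E; have := g0; rewrite -E pmulr_lgt0//.
  by rewrite pmulr_lgt0// expR_gt0.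
have u0_gt0 := pos _ _ _ s0 u0E; have u1_gt0 := pos _ _ _ r0 u1E.
rewrite /tau; case: ifPn => [small|_]; last first.
  by rewrite !gt0_mulye ?lte_fin ?powR_gt0// leey.
rewrite -!EFinM -EFinD lee_fin.
have := density_root_convex NN' N'0 t01 small.
set k := K / (N' - 1); set th := `|S - Q|.
set al := Defs.sfun k ((1 - t) * th) / _; set be := Defs.sfun k (t * th) / _.
set q := - N'^-1.
pose h z := expR (f z / (1 - N')).
rewrite -/(h S) -/(h Q) -/(h ((1 - t) * S + t * Q)).
set Z := (1 - t) * S + t * Q => hZ.
have q0 : 0 < q by rewrite oppr_gt0 invr_lt0.
(* Here [q = (1 + q) / (1 - N')], which is where the root of order [1 - N'] comes from. *)
have hq z : (expR (f z)) `^ q = h z `^ (1 + q).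
  by rewrite /h -!expRM; congr expR; rewrite /q; field; lra.
pose x := (1 - t) * s + t * r.
have x0 : 0 < x by rewrite /x addr_gt0// mulr_gt0.
have h0 z : 0 <= h z by exact: expR_ge0.
have k0 : 0 < k by rewrite /k -mulrNN -invrN; apply: mulr_gt0; rewrite ?invr_gt0; have := K0; lra.
have sfun_gt0 v : 0 <= v -> v <= th -> 0 < Defs.sfun k v.
  rewrite /Defs.sfun k0 le_eqVlt => /predU1P[<-|v0 vth]; first by rewrite eqxx.
  have sk : 0 < Num.sqrt k by rewrite sqrtr_gt0.
  rewrite gt_eqF// divr_gt0 ?mulr_gt0// sin_gt0_pi// mulr_gt0//=.
  move: small; rewrite /omega k0 lte_fin ltr_pdivlMr// mulrC.
  by apply: le_lt_trans; rewrite ler_pM2l.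
have th0 : 0 <= th by exact: normr_ge0.
have al0 : 0 <= al by rewrite divr_ge0// ltW// sfun_gt0//; nra.
have be0 : 0 <= be by rewrite divr_ge0// ltW// sfun_gt0//; nra.
(* Isolates the common factor [(g / x) ^ q]. The remaining coefficients [c * w / x] of the two terms
   add up to 1 and are the weights for Jensen. *)
have term c v u w z : 0 < c -> 0 < w -> 0 <= v -> u * expR (- f z) * w = g ->
    c * v `^ (1 + q) * u `^ q =
    (g / x) `^ q * (c * w / x * (x / w * (v * h z)) `^ (1 + q)).
  move=> c0 w0 v0 uE.
  have -> : u = g / x * (x / w * expR (f z)).
    rewrite -uE expRN; field; rewrite !gt_eqF//= expR_gt0//.
  have [gx xw] : 0 <= g / x /\ 0 <= x / w by split; rewrite divr_ge0// ltW.
  have cE : c * w / x * (x / w) = c by field; rewrite !gt_eqF.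
  have xw0 : 0 < x / w by rewrite divr_gt0.
  move: (g / x) (x / w) gx xw cE xw0 => G c1 G0 c10 cE c1_gt0.
  rewrite !powRM ?mulr_ge0 ?expR_ge0// hq.
  have -> : c1 `^ (1 + q) = c1 * c1 `^ q.
    by rewrite powRD ?powRr1//; apply/implyP => _; rewrite gt_eqF.
  by rewrite -[in LHS]cE; ring.
rewrite (term _ _ _ _ _ t1 s0 al0 u0E) (term _ _ _ _ _ t0 r0 be0 u1E) -mulrDr.
have -> : g / (((1 - t) * s + t * r) * expR (- f Z)) = g / x * expR (f Z).
  by rewrite expRN -/x; field; rewrite !gt_eqF// expR_gt0.
rewrite powRM ?expR_ge0// ?divr_ge0 ?(ltW g0) ?(ltW x0)// hq.
rewrite ler_wpM2l ?powR_ge0//.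
pose la := (1 - t) * s / x.
have la1 : t * r / x = 1 - la by rewrite /la /x; field; rewrite gt_eqF.
have la01 : 0 <= la <= 1.
  have : 0 <= t * r / x by rewrite divr_ge0 ?mulr_ge0// ltW.
  rewrite la1 subr_ge0 => ->; rewrite andbT /la divr_ge0 ?mulr_ge0// ltW//.
rewrite la1 -/la; apply: le_trans (jensen_powR _ la01 _ _); last 3 first.
- by rewrite lerDl ltW.
- by apply: mulr_ge0; [rewrite divr_ge0// ltW|exact: mulr_ge0].
- by apply: mulr_ge0; [rewrite divr_ge0// ltW|exact: mulr_ge0].
have -> : la * (x / s * (al * h S)) + (1 - la) * (x / r * (be * h Q)) =
    (1 - t) * al * h S + t * be * h Q.
  by rewrite -la1 /la; field; rewrite !gt_eqF.
apply: ge0_ler_powR => //; first by lra.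
  by rewrite nnegrE.
by rewrite nnegrE; apply: addr_ge0; apply: mulr_ge0 => //; apply: mulr_ge0 => //; exact: ltW.
Qed.

End distortion.

Section tau.
Context (R : realType).
Implicit Types (K N t : R).

Lemma measurable_fun_inv d (T : measurableType d) (f : T -> R) :
  measurable_fun setT f -> measurable_fun setT (fun x => (f x)^-1).
Proof.
(* Valid at zeros of [f] too, where both sides are 0; it reduces inversion to a real power. *)
move=> mf; rewrite (_ : (fun x => _) = (fun x => (f x ^+ 2) `^ (- 1) * f x)).
  apply: measurable_funM => //.
  exact: (measurableT_comp (measurable_powR (- 1)) (measurable_funX 2 mf)).
apply/funext => x; rewrite powR_inv1 ?sqr_ge0//.
by have [->|fx0] := eqVneq (f x) 0; [rewrite mulr0 invr0|field].
Qed.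

Lemma measurable_sfun (k : R) : measurable_fun setT (Defs.sfun k : R -> R).
Proof.
have lin (c : R) : measurable_fun setT (fun x => c * x).
  by apply: measurable_funM => //; exact: measurable_id.
have meq : measurable_fun setT (fun x : R => x == 0).
  exact: (measurable_fun_eqr (f := id) (g := cst 0)).
have [k0|k0] := boolP (0 < k).
  rewrite (_ : Defs.sfun k = fun theta => if theta == 0 then 1
      else sin (Num.sqrt k * theta) / (Num.sqrt k * theta)).
    apply: measurable_fun_ifT => //.
    apply: measurable_funM; last exact: measurable_fun_inv.
    by apply: measurableT_comp => //; exact: continuous_measurable_fun (@continuous_sin R).
  by apply/funext => x; rewrite /Defs.sfun k0.
have [k1|k1] := boolP (k < 0); last first.
  rewrite (_ : Defs.sfun k = cst 1)//; apply/funext => x.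
  by rewrite /Defs.sfun (negbTE k0) (negbTE k1); case: ifP.
rewrite (_ : Defs.sfun k = fun theta => if theta == 0 then 1
    else Defs.sinh (Num.sqrt (- k) * theta) / (Num.sqrt (- k) * theta)); last first.
  by apply/funext => x; rewrite /Defs.sfun (negbTE k0) k1.
apply: measurable_fun_ifT => //.
apply: measurable_funM; last exact: measurable_fun_inv.
have mexp : measurable_fun setT (@expR R).
  exact: continuous_measurable_fun (@continuous_expR R).
rewrite /Defs.sinh; apply: measurable_funM => //.
apply: measurable_funB; first exact: (measurableT_comp mexp (lin _)).
apply: (measurableT_comp mexp).
by apply: measurableT_comp => //; exact: lin.
Qed.

Lemma measurable_tau K N t : measurable_fun setT (tau K N t).
Proof.
rewrite /tau; apply: measurable_fun_ifT => //.
  apply: (measurable_fun_lte (f := EFin) (g := cst (omega (K / (N - 1))))) => //.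
apply/measurable_EFinP; apply: measurable_funM => //.
apply: (measurableT_comp (measurable_powR _)).
apply: measurable_funM; last exact: measurable_fun_inv (measurable_sfun _).
apply: (measurableT_comp (measurable_sfun _)).
by apply: measurable_funM => //; exact: measurable_id.
Qed.

Lemma tau_ge0 K N t theta : 0 <= t -> (0 <= tau K N t theta)%E.
Proof.
move=> t0; rewrite /tau; case: ifP => // _.
by rewrite lee_fin mulr_ge0// powR_ge0.
Qed.

(** Below [omega] the function [sfun] does not vanish and the quotient is 1. This settles the end
    times of the curvature-dimension inequality. *)
Lemma tau1_ge1 K N theta : K < 0 -> N < 0 -> 0 <= theta ->
  (1%:E <= tau K N 1 theta)%E.
Proof.
move=> K0 N0 th0; rewrite /tau; case: ifPn => [small|_]; last by rewrite leey.
have k0 : 0 < K / (N - 1).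
  by rewrite -mulrNN -invrN; apply: mulr_gt0; rewrite ?invr_gt0; lra.
have s0 : 0 < Defs.sfun (K / (N - 1)) theta.
  rewrite /Defs.sfun k0; move: th0; rewrite le_eqVlt => /predU1P[<-|th0].
    by rewrite eqxx.
  have sk : 0 < Num.sqrt (K / (N - 1)) by rewrite sqrtr_gt0.
  rewrite gt_eqF// divr_gt0 ?mulr_gt0// sin_gt0_pi// mulr_gt0//=.
  by move: small; rewrite /omega k0 lte_fin ltr_pdivlMr// mulrC.
by rewrite lee_fin !mul1r divff ?gt_eqF// powR1.
Qed.

End tau.

Section renyi.
Context (R : realType) (X : mmspace R).
Local Open Scope ereal_scope.
Local Open Scope charge_scope.

(** One factor [rho] is absorbed in [nu], so the entropy becomes an integral against the law and can
    be carried to the law of midpoints. Where [rho] is 0 both integrands vanish, the exponent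
    [1 - N^-1] being positive. *)
Lemma renyi_density (N : R) (nu : probability (borel X) R) (rho : X -> R) :
  (N < 0)%R -> has_density nu rho ->
  renyi N nu = \int[nu]_x (rho x `^ (- N^-1))%:E.
Proof.
move=> N0 [mrho rho0 nuE].
have mrhoE : measurable_fun [set: borel X] (EFin \o rho) by exact/measurable_EFinP.
have numu : nu `<< mm_measure X by exact: density_dominated mrhoE nuE.
have q0 : (0 < - N^-1)%R by rewrite oppr_gt0 invr_lt0.
rewrite /renyi ifT; last exact/asboolP.
have mpow : measurable_fun [set: borel X] (fun x => (rho x `^ (- N^-1))%:E).
  by apply/measurable_EFinP; exact: (measurableT_comp (measurable_powR _) mrho).
rewrite (density_integral (mu := mm_measure X) mrhoE _ nuE mpow)//; last first.
  by move=> x; rewrite /= lee_fin ?powR_ge0.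
apply: ae_eq_integral => //.
- apply: (measurableT_comp (measurable_poweR _)).
  by apply: measurable_int; exact: Radon_Nikodym_integrable.
- exact: emeasurable_funM.
have : ae_eq (mm_measure X) setT (EFin \o rho)
    ('d (charge_of_finite_measure nu) '/d (mm_measure X)).
  apply/ae_eq_sym/integral_ae_eq => //; first exact: Radon_Nikodym_integrable.
  by move=> E _ mE; rewrite -Radon_Nikodym_integral// -nuE.
apply: filterS => x /= + _ => /(_ I) <-.
rewrite poweR_EFin -EFinM; congr (_%:E).
have [->|rn0] := eqVneq (rho x) 0%R.
  by rewrite mulr0 powR0// gt_eqF//; lra.
rewrite powRD ?powRr1 1?mulrC//.
by apply/implyP => _.
Qed.

End renyi.

(** * The curvature-dimension condition on weighted circles *)

Section periodic_cdf.
Context (R : realType).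
Local Notation leb := (@lebesgue_measure R).

Lemma exists_periodic_cdf (L : R) (g : R -> R) : 0 < L ->
  measurable_fun setT g -> (forall x, 0 <= g x) -> (forall x, g (x + L) = g x) ->
  (\int[leb]_(x in `[0%R, L]) (g x)%:E = 1)%E ->
  exists F : R -> R, [/\ continuous F, {homo F : x y / x <= y},
    forall x, F (x + L) = F x + 1 & forall l u, primitive_on l u g F].
Proof.
move=> L0 mg g0 gL g1.
have mgE : measurable_fun setT (EFin \o g) by exact/measurable_EFinP.
have gE0 x : (0 <= (EFin \o g) x)%E by rewrite /= lee_fin.
have per a : (\int[leb]_(x in `[a, (a + L)%R]) (EFin \o g) x = 1)%E.
  by rewrite integral_periodic// => x; rewrite /= gL.
have pern a (n : nat) : (\int[leb]_(x in `[a, (a + n%:R * L)%R]) (EFin \o g) x = n%:R%:E)%E.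
  elim: n => [|n IH]; first by rewrite mul0r addr0 set_itv1 integral_set1.
  rewrite (@integral_itv_split _ _ a (a + n%:R * L))//.
  - rewrite IH -natr1 (_ : a + (n%:R + 1) * L = (a + n%:R * L) + L); last by ring.
    by rewrite per.
  - by rewrite lerDl mulr_ge0// ltW.
  - by rewrite -natr1; nra.
have gfin a b : (\int[leb]_(x in `[a, b]) (g x)%:E < +oo)%E.
  have [n hn] : exists n : nat, (b - a) / L < n%:R.
    by exists (Num.truncn ((b - a) / L)).+1; rewrite truncnS_gt.
  apply: (@le_lt_trans _ _ (\int[leb]_(x in `[a, (a + n%:R * L)%R]) (EFin \o g) x)%E).
    apply: ge0_subset_integral => //.
    - exact: measurable_funTS.
    - by move=> x _; exact: gE0.
    - apply: subset_itv; rewrite bnd_simp//.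
      by move: hn; rewrite ltr_pdivrMr//; lra.
  by rewrite pern ltry.
have [F [cF ndF Fg]] := exists_primitive mg g0 gfin.
exists F; split => // x.
have xL : x <= x + L by lra.
have := Fg x (x + L) x (x + L) (lexx _) xL (lexx _).
by rewrite [LHS]per => -[]; lra.
Qed.

End periodic_cdf.

Section circle_density.
Context (R : realType) (D : {posnum R}).
Local Notation S1 := (circle D).
Variables (w : borel S1 -> R) (mu : probability (borel S1) R).
Hypothesis mw : measurable_fun setT w.
Hypothesis w_gt0 : forall p, 0 < w p.
Hypothesis muE : forall A, measurable A ->
  mu A = (\int[circle_vol D]_(x in A) (w x)%:E)%E.
Local Open Scope ereal_scope.

Lemma integral_circle_density (h : borel S1 -> \bar R) :
  measurable_fun setT h -> (forall p, 0 <= h p) ->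
  \int[mu]_p h p = \int[circle_vol D]_p (h p * (w p)%:E).
Proof.
move=> mh h0.
have volT : circle_vol D setT < +oo by rewrite circle_volT ltry.
(* The total mass [2 D] equips the volume with the finiteness that [density_integral] asks for. *)
pose vol := mfrestr measurableT volT.
have volE A : vol A = circle_vol D A by rewrite /vol /mfrestr /mrestr setIT.
have volint A (k : borel S1 -> \bar R) : 
    \int[vol]_(x in A) k x = \int[circle_vol D]_(x in A) k x.
  by apply: eq_measure_integral => B mB _; exact: volE.
rewrite -volint; apply: density_integral => //.
- exact/measurable_EFinP.
- by move=> x; rewrite lee_fin ltW.
- by move=> A mA; rewrite volint; exact: muE.
Qed.

Lemma integral_circle_density_law (nu : probability (borel S1) R)
    (rho : S1 -> R) (h : borel S1 -> \bar R) :
  @has_density R (circle_mm mu) nu rho ->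
  measurable_fun setT h -> (forall p, 0 <= h p) ->
  \int[nu]_p h p = \int[circle_vol D]_p (h p * (rho p * w p)%:E).
Proof.
move=> [mrho rho0 nuE] mh h0.
have mrhoE : measurable_fun [set: borel S1] (EFin \o rho) by exact/measurable_EFinP.
have rhoE0 x : 0 <= (EFin \o rho) x by rewrite /= lee_fin.
rewrite (density_integral (mu := mu) mrhoE rhoE0 nuE)//.
rewrite integral_circle_density; last 2 first.
- exact: emeasurable_funM.
- by move=> p; rewrite mule_ge0.
by apply: eq_integral => p _; rewrite EFinM muleA.
Qed.

End circle_density.

Section transport_data.
Context (R : realType) (D : {posnum R}).
Local Notation leb := (@lebesgue_measure R).
Local Notation S1 := (circle D).
Local Notation L := (2 * D%:num).
Local Notation e := (circle_param D).
Variables (w : borel S1 -> R) (mu : probability (borel S1) R).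
Hypothesis mw : measurable_fun setT w.
Hypothesis w_gt0 : forall p, 0 < w p.
Hypothesis muE : forall A, measurable A ->
  mu A = (\int[circle_vol D]_(x in A) (w x)%:E)%E.

(* The midpoints are distributed according to [td_m]; [td_s] and [td_r] are the
   derivatives of the two ends [td_S] and [2 z - td_S z]. *)
Record transport_data (nu0 nu1 : probability (borel S1) R) (rho0 rho1 : S1 -> R) :=
  TransportData {
  td_S : R -> R;
  td_theta : R -> R;
  td_bound : R;
  td_s : R -> R;
  td_r : R -> R;
  td_m : probability (measurableTypeR R) R;
  td_cS : continuous td_S;
  td_ndS : {homo td_S : x y / x <= y};
  td_ndR : {homo (fun z => 2 * z - td_S z) : x y / x <= y};
  td_SL : forall z, td_S (z + L) = td_S z + L;
  td_thetaL : forall z, td_theta (z + L) = td_theta z;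
  td_thetaB : forall z, `|td_theta z| <= td_bound;
  td_subS : forall z z',
    2 * td_S z * (z' - z) <= (z' ^+ 2 - td_theta z') - (z ^+ 2 - td_theta z);
  td_subR : forall z z',
    2 * (2 * z - td_S z) * (z' - z) <= (z' ^+ 2 + td_theta z') - (z ^+ 2 + td_theta z);
  td_ms : measurable_fun setT td_s;
  td_s0 : forall x, 0 <= td_s x;
  td_primS : primitive_on 0 L td_s td_S;
  td_mr : measurable_fun setT td_r;
  td_r0 : forall x, 0 <= td_r x;
  td_primR : primitive_on 0 L td_r (fun z => 2 * z - td_S z);
  td_mE : forall h : R -> \bar R, measurable_fun setT h -> (forall x, 0 <= h x)%E ->
    (\int[td_m]_z h z = \int[leb]_(z in `[0%R, L])
      (h z * (rho0 (e (td_S z)) * w (e (td_S z)) * td_s z)%:E))%E;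
  td_ae : ae_eq leb `[0, L]%classic
    (fun z => (rho0 (e (td_S z)) * w (e (td_S z)) * td_s z)%:E)
    (fun z => (rho1 (e (2 * z - td_S z)) * w (e (2 * z - td_S z)) * td_r z)%:E);
  td_law0 : forall A, measurable A -> nu0 A = td_m ((fun z => e (td_S z)) @^-1` A);
  td_law1 : forall A, measurable A ->
    nu1 A = td_m ((fun z => e (2 * z - td_S z)) @^-1` A) }.

Lemma exists_transport_data (nu0 nu1 : probability (borel S1) R) (rho0 rho1 : S1 -> R) :
  @has_density R (circle_mm mu) nu0 rho0 -> @has_density R (circle_mm mu) nu1 rho1 ->
  inhabited (transport_data nu0 nu1 rho0 rho1).
Proof.
move=> dens0 dens1; have L0 := circle_period_gt0 D.
have me : measurable_fun [set: R] (e : R -> borel S1) := @measurable_circle_param R D.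
pose g0 z := rho0 (e z) * w (e z); pose g1 z := rho1 (e z) * w (e z).
have [mrho0 rho0_ge0 _] := dens0; have [mrho1 rho1_ge0 _] := dens1.
have mg0' : measurable_fun [set: borel S1] (fun p => rho0 p * w p) by exact: measurable_funM.
have mg1' : measurable_fun [set: borel S1] (fun p => rho1 p * w p) by exact: measurable_funM.
have mg0 : measurable_fun setT g0 := measurableT_comp mg0' me.
have mg1 : measurable_fun setT g1 := measurableT_comp mg1' me.
have g0_ge0 z : 0 <= g0 z by rewrite mulr_ge0// ltW.
have g1_ge0 z : 0 <= g1 z by rewrite mulr_ge0// ltW.
have g0L z : g0 (z + L) = g0 z by rewrite /g0 circle_paramD.
have g1L z : g1 (z + L) = g1 z by rewrite /g1 circle_paramD.
have total (nu : probability (borel S1) R) rho : @has_density R (circle_mm mu) nu rho ->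
    (\int[leb]_(z in `[0%R, L]) (rho (e z) * w (e z))%:E = 1)%E.
  move=> dens; have [mrho rho_ge0 _] := dens.
  have := integral_circle_density_law mw w_gt0 muE dens (h := cst 1%E) (measurable_cst _)
    (fun=> lee01).
  rewrite integral_cst//= probability_setT mule1 => ->.
  rewrite ge0_integral_circle.
  - by apply: eq_integral => z _; rewrite mul1e.
  - apply: emeasurable_funM => //; apply/measurable_EFinP; exact: measurable_funM.
  - by move=> p; rewrite mul1e lee_fin mulr_ge0// ltW.
have [F0 [cF0 ndF0 F0L F0g]] := exists_periodic_cdf L0 mg0 g0_ge0 g0L (total _ _ dens0).
have [F1 [cF1 ndF1 F1L F1g]] := exists_periodic_cdf L0 mg1 g1_ge0 g1L (total _ _ dens1).
have [al [S [mS MS]]] := exists_balanced_matching L0 cF0 cF1 ndF0 ndF1 F0L F1L.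
have cS : continuous S by exact: matching_continuous mS.
have [theta [thetaL subS subR [B thetaB]]] := exists_potential L0 mS MS.
have [ndS ndR SL F01] := mS.
have cR : continuous (fun z : R => 2 * z - S z).
  by move=> x; apply: cvgB; [apply: cvgMr; exact: cvg_id|exact: cS].
(* Each end is [2 z] minus the other one, so monotonicity of the other end is the Lipschitz bound
   with constant 2. *)
have [s [ms s0 pS]] := @exists_density R S 2 0 L (ler0n _ 2) cS ndS ndR.
have [r [mr r0 pR]] : exists r : R -> R, [/\ measurable_fun setT r, forall x, 0 <= r x &
    primitive_on 0 L r (fun z : R => 2 * z - S z)].
  apply: (@exists_density R _ 2) => // x y xy.
  by rewrite !opprB !addrA ![2 * _ + _]addrC !addrK ndS.
have meS : measurable_fun [set: R] (fun z : R => e (S z) : borel S1) :=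
  measurableT_comp me (continuous_measurable_fun cS).
have meR : measurable_fun [set: R] (fun z : R => e (2 * z - S z) : borel S1) :=
  measurableT_comp me (continuous_measurable_fun cR).
pose g z := g0 (S z) * s z; pose g' z := g1 (2 * z - S z) * r z.
have mg : measurable_fun setT g.
  by apply: measurable_funM => //; exact: (measurableT_comp mg0' meS).
have mg' : measurable_fun setT g'.
  by apply: measurable_funM => //; exact: (measurableT_comp mg1' meR).
have g_ge0 z : 0 <= g z by rewrite mulr_ge0.
have g'_ge0 z : 0 <= g' z by rewrite mulr_ge0.
have sub_prim u U (a b : R) : 0 <= a -> b <= L -> primitive_on 0 L u U -> primitive_on a b u U.
  move=> a0 bL H x y ax xy yb; apply: H => //; [exact: le_trans ax|exact: le_trans bL].
(* [F0 (S z)] acquires two densities, one through each end of the plan, because [F1 (2 * z - S z)]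
   differs from it by [al]. Their equality almost everywhere is the Monge-Ampere equation. *)
have prim_g : primitive_on 0 L g (fun z => F0 (S z)).
  move=> a b a0 ab bL; rewrite -(F0g _ _ (S a) (S b) (lexx _) (ndS _ _ ab) (lexx _)).
  rewrite -(primitive_change_of_variable (u := s) ab ms s0 cS ndS)//.
  - exact: sub_prim.
  - exact/measurable_EFinP.
have prim_g' : primitive_on 0 L g' (fun z => F0 (S z)).
  move=> a b a0 ab bL.
  have -> : F0 (S b) - F0 (S a) = F1 (2 * b - S b) - F1 (2 * a - S a).
    by rewrite !F01; ring.
  rewrite -(F1g _ _ _ _ (lexx _) (ndR _ _ ab) (lexx _)).
  rewrite -(primitive_change_of_variable (u := r) ab mr r0 cR ndR)//.
  - exact: sub_prim.
  - exact/measurable_EFinP.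
have gg' := primitive_unique (ltW L0) mg mg' g_ge0 g'_ge0 prim_g prim_g'.
have [m mE] : exists m : probability (measurableTypeR R) R,
    forall h : R -> \bar R, measurable_fun setT h -> (forall x, 0 <= h x)%E ->
    (\int[m]_z h z = \int[leb]_(z in `[0%R, L]) (h z * (g z)%:E))%E.
  pose k := (fun x => (g x)%:E) \_ `[0, L].
  have mk : measurable_fun [set: R] k.
    apply/(measurable_restrictT _ _).1; first exact: measurable_itv.
    by apply: measurable_funTS; exact/measurable_EFinP.
  have k0 x : (0 <= k x)%E by rewrite /k patchE; case: ifP => // _; rewrite lee_fin.
  have k1 : (\int[leb]_x k x = 1)%E.
    by rewrite -integral_mkcond prim_g// -[in S L](add0r L) SL F0L addrAC subrr add0r.
  have [m mE] := exists_weighted_probability (mu := leb) mk k0 k1.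
  exists m => h mh h0; rewrite (density_integral (mu := leb) mk k0 (fun A _ => mE A))//.
  rewrite [RHS]integral_mkcond; apply: eq_integral => x _.
  by rewrite /k !patchE; case: ifP => _; rewrite ?mule0.
have SL0 : S L = S 0 + L by rewrite -[in LHS](add0r L) SL.
have RL0 : 2 * L - S L = 2 * 0 - S 0 + L by rewrite SL0; ring.
have law (nu : probability (borel S1) R) rho (U u : R -> R) A :
    @has_density R (circle_mm mu) nu rho -> measurable_fun setT u -> (forall x, 0 <= u x) ->
    continuous U -> {homo U : x y / x <= y} -> U L = U 0 + L -> primitive_on 0 L u U ->
    measurable A ->
    nu A = (\int[leb]_(z in `[0%R, L])
      ((\1_A (e (U z)))%:E * (rho (e (U z)) * w (e (U z)) * u z)%:E))%E.
  move=> dens mu' u0 cU ndU UL pU mA; have [mrho rho_ge0 _] := dens.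
  have mind : measurable_fun [set: borel S1] (fun p => (\1_A p)%:E : \bar R).
    exact/measurable_EFinP.
  have ind0 (p : borel S1) : (0 <= (\1_A p)%:E :> \bar R)%E by rewrite lee_fin.
  have mh : measurable_fun [set: borel S1] (fun p => (\1_A p)%:E * (rho p * w p)%:E)%E.
    apply: emeasurable_funM => //; apply/measurable_EFinP; exact: measurable_funM.
  have h0 p : (0 <= (\1_A p)%:E * (rho p * w p)%:E)%E.
    by rewrite mule_ge0// lee_fin mulr_ge0// ltW.
  transitivity (\int[nu]_p (\1_A p)%:E)%E; first by rewrite integral_indic// setIT.
  rewrite (integral_circle_density_law mw w_gt0 muE dens mind ind0).
  rewrite -(circle_change_of_variable mu' u0 cU ndU UL pU mh h0).
  by apply: eq_integral => z _; rewrite -muleA -EFinM.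
have mind (A : set (borel S1)) (U : R -> borel S1) : measurable A -> measurable_fun setT U ->
    measurable_fun setT (fun z => (\1_A (U z))%:E : \bar R).
  by move=> mA mU; apply/measurable_EFinP; exact: measurableT_comp.
have indE (A : set (borel S1)) (U : R -> borel S1) : measurable A -> measurable_fun setT U ->
    m (U @^-1` A) = (\int[m]_z (\1_A (U z))%:E)%E.
  move=> mA mU.
  have mUA : measurable (U @^-1` A : set (measurableTypeR R)).
    by rewrite -[X in measurable X]setTI; exact: mU.
  apply/esym; etransitivity; first exact: (@integral_indic _ _ _ m setT measurableT _ mUA).
  by rewrite setIT.
have law0 A : measurable A -> nu0 A = m ((fun z => e (S z)) @^-1` A).
  move=> mA; rewrite indE// mE; [|exact: mind|by move=> x; rewrite lee_fin].
  exact: law dens0 ms s0 cS ndS SL0 pS mA.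
have law1 A : measurable A -> nu1 A = m ((fun z => e (2 * z - S z)) @^-1` A).
  move=> mA; rewrite indE// mE; [|exact: mind|by move=> x; rewrite lee_fin].
  rewrite [LHS](law _ _ _ _ _ dens1 mr r0 cR ndR RL0 pR mA).
  apply: ae_eq_integral => //.
  - apply: measurable_funTS; apply: emeasurable_funM; first exact: mind.
    exact/measurable_EFinP.
  - apply: measurable_funTS; apply: emeasurable_funM; first exact: mind.
    exact/measurable_EFinP.
  - exact/ae_eqe_mul2l/ae_eq_sym.
by constructor; exact: (@TransportData nu0 nu1 rho0 rho1 S theta B s r m cS ndS ndR SL thetaL thetaB
  subS subR ms s0 pS mr r0 pR mE gg' law0 law1).
Qed.

End transport_data.

Section displacement_interpolation.
Context (R : realType) (D : {posnum R}).
Local Notation S1 := (circle D).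
Local Notation L := (2 * D%:num).
Local Notation e := (circle_param D).
Variables (w : borel S1 -> R) (mu : probability (borel S1) R).
Variables (nu0 nu1 : probability (borel S1) R) (rho0 rho1 : S1 -> R).
Variable T : transport_data w nu0 nu1 rho0 rho1.
Local Notation S := (td_S T).
Local Notation m := (td_m T).

Definition interp (t z : R) : R := (1 - t) * S z + t * (2 * z - S z).

Lemma interp0 z : interp 0 z = S z.
Proof. by rewrite /interp; ring. Qed.

Lemma interp1 z : interp 1 z = 2 * z - S z.
Proof. by rewrite /interp; ring. Qed.

Lemma interpL t z : interp t (z + L) = interp t z + L.
Proof. by rewrite /interp td_SL; ring. Qed.

Lemma interp_sub s t z : `|interp s z - interp t z| = `|s - t| * `|2 * z - 2 * S z|.
Proof. by rewrite -normrM; congr `|_|; rewrite /interp; ring. Qed.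

Lemma interp_homo t : 0 <= t <= 1 -> {homo interp t : x y / x <= y}.
Proof.
move=> t01 x y xy; have := td_ndS T xy; have := td_ndR T xy; rewrite /interp.
by nra.
Qed.

(** The increments of the two ends are nonnegative with sum [2 * (y - x)], and both weights are
    positive. *)
Lemma interp_strict t : 0 < t < 1 -> {homo interp t : x y / x < y}.
Proof.
move=> /andP[t0 t1] x y xy; have hS := td_ndS T (ltW xy); have hR := td_ndR T (ltW xy).
have t'0 : 0 < 1 - t by lra.
rewrite -subr_gt0; set a := S y - S x; set b := (2 * y - S y) - (2 * x - S x).
have -> : interp t y - interp t x = (1 - t) * a + t * b by rewrite /interp /a /b; ring.
have a0 : 0 <= a by rewrite subr_ge0.
have b0 : 0 <= b by rewrite subr_ge0.
have [a00|an0] := eqVneq a 0.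
  by rewrite a00 mulr0 add0r mulr_gt0// lt_neqAle b0 andbT; apply/eqP => b00; move: a00 b00; rewrite /a /b; lra.
have a_gt0 : 0 < a by rewrite lt_neqAle eq_sym an0.
by apply: ltr_pwDl; [exact: mulr_gt0|rewrite mulr_ge0// ltW].
Qed.

Lemma interp_continuous t : continuous (interp t).
Proof.
move=> x; rewrite /interp; apply: cvgD; apply: cvgMr; first exact: td_cS.
by apply: cvgB; [apply: cvgMr; exact: cvg_id|exact: td_cS].
Qed.

Lemma measurable_interp t :
  measurable_fun setT (fun z : measurableTypeR R => e (interp t z) : borel S1).
Proof.
exact: (measurableT_comp (@measurable_circle_param R D)
  (continuous_measurable_fun (@interp_continuous t))).
Qed.

Definition interp_density (t z : R) : R := (1 - t) * td_s T z + t * td_r T z.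

Lemma measurable_interp_density t : measurable_fun setT (interp_density t).
Proof.
apply: measurable_funD; apply: measurable_funM => //.
  exact: td_ms.
exact: td_mr.
Qed.

Lemma interp_density_ge0 t z : 0 <= t <= 1 -> 0 <= interp_density t z.
Proof.
move=> t01; have := td_s0 T z; have := td_r0 T z.
by rewrite /interp_density; nra.
Qed.

Lemma interp_primitive t : 0 <= t <= 1 ->
  primitive_on 0 L (interp_density t) (interp t).
Proof.
move=> t01 a b a0 ab bL; have [t0 t1] : 0 <= t /\ 0 <= 1 - t by lra.
under eq_integral do rewrite /interp_density EFinD !EFinM.
have ms := td_ms T; have mr := td_mr T.
rewrite ge0_integralD//=; last 4 first.
- by move=> x _; rewrite -EFinM lee_fin mulr_ge0// td_s0.
- by apply: measurable_funTS; apply: emeasurable_funM => //; exact/measurable_EFinP.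
- by move=> x _; rewrite -EFinM lee_fin mulr_ge0// td_r0.
- by apply: measurable_funTS; apply: emeasurable_funM => //; exact/measurable_EFinP.
rewrite !ge0_integralZl//; try by [apply: measurable_funTS; exact/measurable_EFinP|
  move=> x _; rewrite lee_fin; exact: td_s0|move=> x _; rewrite lee_fin; exact: td_r0].
rewrite td_primS// td_primR// -!EFinM -EFinD; congr (_%:E).
by rewrite /interp; ring.
Qed.

(** Recover the midpoint from the position, then apply [f]; both maps commute with the period, so
    [z] may be reduced to [[0, L)]. *)
Lemma interp_inverse (f : R -> R) t : continuous f -> (forall z, f (z + L) = f z + L) ->
  0 < t < 1 -> exists2 a : borel S1 -> borel S1,
    measurable_fun setT a & forall z, a (e (interp t z)) = e (f z).
Proof.
move=> cf fL t01.
have [j [mj jE]] := exists_circle_inverse (@interp_continuous t) (interp_strict t01) (interpL t).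
have L0 := circle_period_gt0 D.
exists (fun p => e (f (j p))).
  apply: (measurableT_comp (@measurable_circle_param R D)).
  exact: (measurableT_comp (continuous_measurable_fun cf) mj).
move=> z; pose k := Num.floor (z / L); pose y := z - k%:~R * L.
have yI : 0 <= y < L.
  have /andP[] := floor_itv (z / L).
  by rewrite -/k intrD ler_pdivlMr// ltr_pdivrMr// /y; lra.
have -> : e (interp t z) = e (interp t y).
  rewrite -(subrK (k%:~R * L) z) -/y.
  exact: (periodic_int k y (f := fun z => e (interp t z))
    (fun z => etrans (congr1 e (interpL t z)) (circle_paramD _ _))).
rewrite jE// -[in RHS](subrK (k%:~R * L) z) -/y.
apply/esym/(periodic_int k y (f := fun z => e (f z))) => x.
by rewrite fL circle_paramD.
Qed.

Lemma exists_interpolation : exists (nu : R -> probability (borel S1) R)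
    (p : probability (borel S1 * borel S1)%type R),
  [/\ forall t A, measurable A -> nu t A = m ((fun z => e (interp t z)) @^-1` A),
      forall A, p A = m ((fun z => (e (S z), e (2 * z - S z))) @^-1` A),
      nu 0 = nu0 /\ nu 1 = nu1,
      @P2_geodesic R (circle_mm mu) nu0 nu1 nu &
      @optimal_coupling R (circle_mm mu) nu0 nu1 p].
Proof.
have [nu' nu'E] := choice (fun t => exists_pushforward_probability m (measurable_interp t)).
(* Taking the given laws at the end times makes [nu 0 = nu0] an equality of records, not only of
   values on measurable sets. *)
pose nu t := if t == 0 then nu0 else if t == 1 then nu1 else nu' t.
have nu_0 : nu 0 = nu0 by rewrite /nu eqxx.
have nu_1 : nu 1 = nu1 by rewrite /nu eqxx oner_eq0.
have nuE t A : measurable A -> nu t A = m ((fun z => e (interp t z)) @^-1` A).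
  move=> mA; rewrite /nu; case: eqP => [->|_].
    rewrite (td_law0 T mA); congr (m _).
    by apply/seteqP; split => z /=; rewrite interp0.
  case: eqP => [->|_]; last exact: nu'E.
  rewrite (td_law1 T mA); congr (m _).
  by apply/seteqP; split => z /=; rewrite interp1.
have [phi [psi [[mphi mpsi] [phiB psiB] phi_psi phi_psiE]]] :=
  exists_circle_potentials (td_thetaL T) (td_thetaB T) (td_subS T) (td_subR T).
have B0 : 0 <= td_bound T by apply: le_trans (td_thetaB T 0).
pose len (z : measurableTypeR R) := `|2 * z - 2 * S z|.
have mlen : measurable_fun setT len.
  apply: continuous_measurable_fun => x; apply: cvg_norm.
  by apply: cvgB; apply: cvgMr; [exact: cvg_id|exact: td_cS].
have len0 z : 0 <= len z by exact: normr_ge0.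
have lenE z : len z = mdist (e (interp 0 z) : S1) (e (interp 1 z) : S1).
  rewrite interp0 interp1.
  by rewrite (matching_dist (td_thetaL T) (td_thetaB T) (td_subS T) (td_subR T)).
have lip s t z : mdist (e (interp s z) : S1) (e (interp t z) : S1) <= `|s - t| * len z.
  by rewrite -interp_sub circle_param_lip.
have phi_psi_len z : phi (e (interp 0 z)) + psi (e (interp 1 z)) = len z ^+ 2 / 2.
  by rewrite interp0 interp1 phi_psiE /len real_normK ?num_real.
have cS : continuous S by move=> z; exact: td_cS.
have cR : continuous (fun z : R => 2 * z - S z).
  by move=> x; apply: cvgB; [apply: cvgMr; exact: cvg_id|exact: td_cS].
have RL z : 2 * (z + L) - S (z + L) = 2 * z - S z + L by rewrite td_SL; ring.
have back s : 0 <= s < 1 -> exists2 a : borel S1 -> borel S1,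
    measurable_fun setT a & forall z, a (e (interp s z)) = e (interp 0 z).
  move=> /andP[]; rewrite le_eqVlt => /predU1P[<- _|s0 s1]; first by exists id.
  have [|a ma aE] := @interp_inverse S s cS (td_SL T); first by rewrite s0.
  by exists a => // z; rewrite aE interp0.
have forth t : 0 < t <= 1 -> exists2 b : borel S1 -> borel S1,
    measurable_fun setT b & forall z, b (e (interp t z)) = e (interp 1 z).
  move=> /andP[t0]; rewrite le_eqVlt => /predU1P[->|t1]; first by exists id.
  have [|b mb bE] := @interp_inverse _ t cR RL; first by rewrite t0.
  by exists b => // z; rewrite bE interp1.
have E0 A : measurable A -> nu0 A = m ((fun z => e (interp 0 z)) @^-1` A).
  by move=> mA; have := nuE 0 A mA; rewrite nu_0.
have E1 A : measurable A -> nu1 A = m ((fun z => e (interp 1 z)) @^-1` A).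
  by move=> mA; have := nuE 1 A mA; rewrite nu_1.
have [p [cp pE]] : exists p : probability (borel S1 * borel S1)%type R,
    @coupling R (circle_mm mu) nu0 nu1 p /\
    forall A, p A = m ((fun z => (e (interp 0 z), e (interp 1 z))) @^-1` A).
  exact: (coupling_map (measurable_interp 0) (measurable_interp 1) E0 E1).
exists nu, p; split => //.
- move=> A; rewrite pE; congr (m _).
  by apply/seteqP; split => z /=; rewrite interp0 interp1.
- suff : @P2_geodesic R (circle_mm mu) (nu 0) (nu 1) nu by rewrite nu_0 nu_1.
  apply: (@interpolation_geodesic R D mu _ _ m (fun t z => e (interp t z)) len _ _ _ _
    _ nu nuE phi psi (td_bound T)) => //.
  exact: measurable_interp.
split => // p' cp'.
have mpair : measurable_fun setT
    (fun z : measurableTypeR R => (e (interp 0 z) : borel S1, e (interp 1 z) : borel S1)).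
  by apply: measurable_fun_pair; exact: measurable_interp.
have -> : @transport_cost R (circle_mm mu) p = (\int[m]_z (len z ^+ 2)%:E)%E.
  rewrite transport_cost_sqdist.
  etransitivity; first exact: (integral_law mpair (fun A _ => pE A)
    (@measurable_sqdist R D) (@sqdist_ge0 R D)).
  by apply: eq_integral => z _; rewrite /sqdist lenE.
apply: (@optimal_cost_le R D mu _ _ m (fun t z => e (interp t z)) len _ _ nu nuE
  phi psi (td_bound T)) => //.
- exact: measurable_interp.
- by rewrite nu_0 nu_1.
Qed.

End displacement_interpolation.

Section interpolation_density.
Context (R : realType) (D : {posnum R}).
Local Notation leb := (@lebesgue_measure R).
Local Notation S1 := (circle D).
Local Notation L := (2 * D%:num).
Local Notation e := (circle_param D).
Variables (w : borel S1 -> R) (mu : probability (borel S1) R).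
Hypothesis mw : measurable_fun setT w.
Hypothesis w_gt0 : forall p, 0 < w p.
Hypothesis muE : forall A, measurable A ->
  mu A = (\int[circle_vol D]_(x in A) (w x)%:E)%E.
Variables (nu0 nu1 : probability (borel S1) R) (rho0 rho1 : S1 -> R).
Hypothesis dens0 : @has_density R (circle_mm mu) nu0 rho0.
Variable T : transport_data w nu0 nu1 rho0 rho1.
Local Notation S := (td_S T).
Local Notation m := (td_m T).

(** The density of the law of midpoints on one period. *)
Definition midmass z := rho0 (e (S z)) * w (e (S z)) * td_s T z.

Lemma midmass_ge0 z : 0 <= midmass z.
Proof.
by have [_ rho0_ge0 _] := dens0; rewrite !mulr_ge0 ?td_s0// ltW.
Qed.

Lemma measurable_midmass : measurable_fun setT midmass.
Proof.
have [mrho0 _ _] := dens0.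
have meS : measurable_fun [set: R] (fun z : R => e (S z) : borel S1).
  apply: (measurableT_comp (@measurable_circle_param R D)).
  by apply: continuous_measurable_fun => z; exact: td_cS.
apply: measurable_funM; last exact: td_ms.
by apply: measurable_funM; [exact: (measurableT_comp mrho0 meS)|exact: (measurableT_comp mw meS)].
Qed.

(** On [[0, L)] the circle is covered once, and only there do the formulas for the inverse of
    [interp] hold. *)
Lemma integral_half_open (h : R -> \bar R) : measurable_fun setT h ->
  (\int[leb]_(z in `[0%R, L]) h z = \int[leb]_(z in `[0%R, L[) h z)%E.
Proof. by move=> mh; rewrite integral_itv_bndo_bndc//; exact: measurable_funTS. Qed.

(** The law at time [t] is the image of [midmass z dz] under [interp t], whose derivative is
    [interp_density]; its density is therefore a quotient, read at the midpoint that [j]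
    recovers. *)
Lemma interp_has_density t (nu : probability (borel S1) R) : 0 < t < 1 ->
  (forall A, measurable A -> nu A = m ((fun z => e (interp T t z)) @^-1` A)) ->
  exists rho : S1 -> R, @has_density R (circle_mm mu) nu rho /\
    forall z, 0 <= z < L -> rho (e (interp T t z)) =
      midmass z / (interp_density T t z * w (e (interp T t z))).
Proof.
move=> t01 nuE; have t01' : 0 <= t <= 1 by lra.
have [j [mj jE]] := exists_circle_inverse (@interp_continuous _ _ _ _ _ _ _ T t)
  (interp_strict T t01) (interpL T t).
pose c z := midmass z / interp_density T t z.
have mx := measurable_interp_density T t.
have mg := measurable_midmass.
have mc : measurable_fun setT c by apply: measurable_funM => //; exact: measurable_fun_inv.
have c0 z : 0 <= c z by rewrite divr_ge0 ?midmass_ge0 ?interp_density_ge0.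
(* As [t < 1], a zero of [interp_density] is a zero of [td_s], hence of [midmass], so the junk
   quotient is harmless. *)
have cx z : c z * interp_density T t z = midmass z.
  have [x0|xn0] := eqVneq (interp_density T t z) 0; last by rewrite /c divfK.
  rewrite x0 mulr0; have : td_s T z = 0.
    have := td_s0 T z; have := td_r0 T z; move: x0; rewrite /interp_density.
    by move=> x0 r0 s0; apply/eqP; rewrite eq_le s0 andbT; nra.
  by rewrite /midmass => ->; rewrite mulr0.
pose rho p := c (j p) / w p.
have mrho : measurable_fun [set: borel S1] (rho : borel S1 -> R).
  apply: measurable_funM; first exact: (measurableT_comp mc mj).
  exact: measurable_fun_inv.
have rho_ge0 p : 0 <= rho p by rewrite divr_ge0// ltW.
exists rho; split; last first.
  by move=> z zL; rewrite /rho jE// /c invfM mulrA.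
split => // A mA.
have mX : measurable_fun setT (fun z : measurableTypeR R => e (interp T t z) : borel S1).
  exact: measurable_interp.
have mind : measurable_fun setT (fun z : R => (\1_A (e (interp T t z)))%:E : \bar R).
  have mA1 : measurable_fun [set: borel S1] (\1_A : borel S1 -> R) by exact: measurable_indic.
  by apply/measurable_EFinP; exact: (measurableT_comp mA1 mX).
have mh : measurable_fun [set: borel S1] (fun p => (rho p * \1_A p)%:E).
  by apply/measurable_EFinP; apply: measurable_funM.
have h0 p : (0 <= (rho p * \1_A p)%:E)%E by rewrite lee_fin mulr_ge0.
transitivity (\int[leb]_(z in `[0%R, L[)
    ((\1_A (e (interp T t z)))%:E * (midmass z)%:E))%E.
  rewrite -integral_half_open; last first.
    by apply: emeasurable_funM => //; exact/measurable_EFinP.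
  rewrite -(td_mE T mind); last by move=> z; rewrite lee_fin.
  have mXA : measurable ((fun z => e (interp T t z)) @^-1` A : set (measurableTypeR R)).
    by rewrite -[X in measurable X]setTI; exact: mX.
  rewrite nuE//; apply/esym; etransitivity.
    exact: (@integral_indic _ _ _ m setT measurableT _ mXA).
  by rewrite setIT.
rewrite [RHS]integral_mkcond.
transitivity (\int[mu]_x (rho x * \1_A x)%:E)%E; last first.
  by apply: eq_integral => p _; rewrite epatch_indic/= EFinM.
etransitivity; last first.
  by apply/esym; exact: (integral_circle_density mw w_gt0 muE mh h0).
have mhw : measurable_fun [set: borel S1] (fun p => ((rho p * \1_A p)%:E * (w p)%:E)%E).
  by apply: emeasurable_funM => //; exact/measurable_EFinP.
have XL : interp T t L = interp T t 0 + L by rewrite -[in LHS](add0r L) interpL.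
rewrite -(circle_change_of_variable mx (fun z => interp_density_ge0 T z t01')
  (@interp_continuous _ _ _ _ _ _ _ T t) (interp_homo T t01') XL (interp_primitive T t01') mhw); last first.
  by move=> p; rewrite mule_ge0// lee_fin ltW.
rewrite integral_half_open; last first.
  apply: emeasurable_funM; last exact/measurable_EFinP.
  exact: (measurableT_comp mhw mX).
apply: eq_integral => z; rewrite inE/= in_itv/= => zL.
rewrite -!EFinM; congr (_%:E); rewrite /rho jE// -cx.
by field; rewrite gt_eqF.
Qed.

End interpolation_density.

Section circle_CD.
Context (R : realType) (D : {posnum R}).
Local Notation S1 := (circle D).
Local Notation L := (2 * D%:num).
Local Notation e := (circle_param D).

Lemma circle_CD (K N : R) (f : S1 -> R) (mu : probability (borel S1) R) (f1 f2 : R -> R) :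
  K < 0 -> N < 0 ->
  (forall x, is_derive x (1 : R) (fun s => f (e s)) (f1 x)) ->
  (forall x, is_derive x (1 : R) f1 (f2 x)) ->
  (forall x, K <= f2 x + f1 x ^+ 2 / (1 - N)) ->
  (forall A, measurable A -> mu A = (\int[circle_vol D]_(x in A) (expR (- f x))%:E)%E) ->
  CD (circle_mm mu) K N.
Proof.
move=> K0 N0 df df1 ricci muE nu0 nu1 rho0 rho1 dens0 dens1 _ _ _ _.
pose w (p : borel S1) := expR (- f p).
have w_gt0 p : 0 < w p by exact: expR_gt0.
have mw : measurable_fun setT w.
  apply: measurable_circle_fun; apply: continuous_measurable_fun => z.
  apply: differentiable_continuous; apply/derivable1_diffP.
  have dw : is_derive z (1 : R) (w \o e) (- f1 z * w (e z)).
    by rewrite /w /comp; apply: is_derive_eq; rewrite /GRing.scale/=; ring.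
  exact: ex_derive.
have [T] := exists_transport_data mw w_gt0 muE dens0 dens1.
have [nu [p [nuE pE [nu_0 nu_1] geo opt]]] := exists_interpolation mu T.
exists nu, p; split => // t N' t01 /andP[NN' N'0] _ _.
have q0 : 0 < - N'^-1 by rewrite oppr_gt0 invr_lt0.
have [mrho0 rho0_ge0 _] := dens0; have [mrho1 rho1_ge0 _] := dens1.
have meS : measurable_fun setT (fun z : measurableTypeR R => e (td_S T z) : borel S1).
  have := measurable_interp T 0; congr (measurable_fun _ _).
  by apply/funext => z; rewrite interp0.
have meR : measurable_fun setT (fun z : measurableTypeR R => e (2 * z - td_S T z) : borel S1).
  have := measurable_interp T 1; congr (measurable_fun _ _).
  by apply/funext => z; rewrite interp1.
have mpow rho : measurable_fun [set: borel S1] (rho : borel S1 -> R) ->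
    measurable_fun [set: borel S1] (fun x => (rho x `^ (- N'^-1))%:E : \bar R).
  by move=> mrho; apply/measurable_EFinP; exact: (measurableT_comp (measurable_powR _) mrho).
pose H (c : R) (rho : borel S1 -> R) (pr : borel S1 * borel S1 -> borel S1)
    (z : borel S1 * borel S1) : \bar R :=
  (tau K N' c (mdist (z.1 : S1) (z.2 : S1)) * (rho (pr z) `^ (- N'^-1))%:E)%E.
have H0 c rho pr z : 0 <= c -> (0 <= H c rho pr z)%E.
  by move=> c0; rewrite mule_ge0 ?tau_ge0// lee_fin powR_ge0.
have mH (c : R) (rho : borel S1 -> R) (pr : borel S1 * borel S1 -> borel S1) :
    measurable_fun [set: borel S1] rho ->
    measurable_fun [set: (borel S1 * borel S1)%type] pr ->
    measurable_fun [set: (borel S1 * borel S1)%type] (H c rho pr).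
  move=> mrho mpr; apply: emeasurable_funM.
    exact: (measurableT_comp (measurable_tau K N' c) (@measurable_circle_dist R D)).
  exact: (measurableT_comp (mpow _ mrho) mpr).
have mSR : measurable_fun setT
    (fun z : measurableTypeR R => (e (td_S T z) : borel S1, e (2 * z - td_S T z) : borel S1)).
  exact: measurable_fun_pair.
have t0 : 0 <= t by lra.
have t1 : 0 <= 1 - t by lra.
pose H1 z := H (1 - t) rho0 fst (e (td_S T z), e (2 * z - td_S T z)).
pose H2 z := H t rho1 snd (e (td_S T z), e (2 * z - td_S T z)).
have mH1 : measurable_fun setT (H1 : measurableTypeR R -> \bar R).
  by apply: (measurableT_comp _ mSR); apply: mH.
have mH2 : measurable_fun setT (H2 : measurableTypeR R -> \bar R).
  by apply: (measurableT_comp _ mSR); apply: mH.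
have H10 z : (0 <= H1 z)%E by exact: H0.
have H20 z : (0 <= H2 z)%E by exact: H0.
(* The plan [p] is the image of [td_m] under the two ends, so the whole inequality can be written
   against [td_m]. *)
suff main : (@renyi R (circle_mm mu) N' (nu t) <= \int[td_m T]_z (H1 z + H2 z))%E.
  apply: (le_trans main); rewrite ge0_integralD//.
  rewrite le_eqVlt; apply/orP; left; apply/eqP; congr (_ + _)%E; apply/esym.
  - apply: (integral_law mSR (fun A _ => pE A) (mH _ _ _ mrho0 measurable_fst)).
    by move=> z; exact: H0.
  - apply: (integral_law mSR (fun A _ => pE A) (mH _ _ _ mrho1 measurable_snd)).
    by move=> z; exact: H0.
have powE0 (rho : borel S1 -> R) x : (0 <= (rho x `^ (- N'^-1))%:E :> \bar R)%E by rewrite lee_fin powR_ge0.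
(* At the end times the interpolated map may be flat and has no inverse; there one of the two terms
   already suffices, by [tau1_ge1]. *)
have [t00|tn0] := eqVneq t 0.
  rewrite t00 nu_0 (renyi_density N'0 dens0).
  apply: (@le_trans _ _ (\int[td_m T]_z (rho0 (e (td_S T z)) `^ (- N'^-1))%:E)%E).
    rewrite le_eqVlt; apply/orP; left; apply/eqP.
    exact: (integral_law meS (td_law0 T) (mpow _ mrho0) (powE0 rho0)).
  apply: ge0_le_integral => //.
  - exact: (measurableT_comp (mpow _ mrho0) meS).
  - exact: emeasurable_funD.
  move=> z _; rewrite -[leLHS]adde0 leeD// -[leLHS]mul1e lee_wpmul2r//.
  by rewrite t00 subr0 tau1_ge1 ?mdist_ge0.
have [t11|tn1] := eqVneq t 1.
  rewrite t11 nu_1 (renyi_density N'0 dens1).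
  apply: (@le_trans _ _ (\int[td_m T]_z (rho1 (e (2 * z - td_S T z)) `^ (- N'^-1))%:E)%E).
    rewrite le_eqVlt; apply/orP; left; apply/eqP.
    exact: (integral_law meR (td_law1 T) (mpow _ mrho1) (powE0 rho1)).
  apply: ge0_le_integral => //.
  - exact: (measurableT_comp (mpow _ mrho1) meR).
  - exact: emeasurable_funD.
  move=> z _; rewrite -[leLHS]add0e leeD// -[leLHS]mul1e lee_wpmul2r//.
  by rewrite t11 tau1_ge1 ?mdist_ge0.
have t01' : 0 < t < 1.
  by move: t01 => /andP[? ?]; rewrite !lt_neqAle eq_sym tn0 tn1; apply/andP.
have [rho [dens rhoE]] := interp_has_density mw w_gt0 muE dens0 t01' (nuE t).
have [mrho rho_ge0 _] := dens.
rewrite (renyi_density N'0 dens).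
have mX := measurable_interp T t.
apply: (@le_trans _ _ (\int[td_m T]_z (rho (e (interp T t z)) `^ (- N'^-1))%:E)%E).
  rewrite le_eqVlt; apply/orP; left; apply/eqP.
  exact: (integral_law mX (nuE t) (mpow _ mrho) (powE0 rho)).
have mrX : measurable_fun setT
    (fun z : R => (rho (e (interp T t z)) `^ (- N'^-1))%:E : \bar R).
  exact: (measurableT_comp (mpow _ mrho) mX).
have mH12 : measurable_fun setT (fun z : R => (H1 z + H2 z)%E).
  exact: emeasurable_funD.
have mg := measurable_midmass mw dens0 T.
have mgE : measurable_fun setT (fun z => (midmass T z)%:E) by exact/measurable_EFinP.
have g0 := midmass_ge0 w_gt0 dens0 T.
rewrite !td_mE//; last by move=> z; rewrite adde_ge0.
rewrite [leLHS]integral_half_open; last exact: emeasurable_funM.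
rewrite [leRHS]integral_half_open; last exact: emeasurable_funM.
apply: ae_ge0_le_integral => //.
- by move=> z _; apply: mule_ge0; rewrite lee_fin ?powR_ge0//; exact: g0.
- by apply: measurable_funTS; exact: emeasurable_funM.
- by move=> z _; apply: mule_ge0; [exact: adde_ge0|rewrite lee_fin; exact: g0].
- by apply: measurable_funTS; exact: emeasurable_funM.
have := td_ae T; apply: filterS => z /= gg' zL.
have zL' : `[0, L]%classic z.
  by move: zL; rewrite /= !in_itv/= => /andP[-> /ltW].
have {}gg' : midmass T z =
    rho1 (e (2 * z - td_S T z)) * w (e (2 * z - td_S T z)) * td_r T z.
  by apply: EFin_inj; exact: (gg' zL').
move: zL; rewrite /= in_itv/= => zL.
rewrite -[_ * _ * td_s T z]/(midmass T z).
(* Where [midmass] vanishes both integrands do. Elsewhere [td_s] is positive, and so is [td_r] by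
   the Monge-Ampere equation. *)
have [gz0|gzn0] := eqVneq (midmass T z) 0; first by rewrite gz0 !mule0.
have gz_gt0 : 0 < midmass T z by rewrite lt_neqAle eq_sym gzn0 g0.
apply: lee_wpmul2r; first by rewrite lee_fin ltW.
have s_gt0 : 0 < td_s T z.
  by rewrite lt_neqAle td_s0 andbT eq_sym; apply: contraNneq gzn0; rewrite /midmass => ->; rewrite mulr0.
have r_gt0 : 0 < td_r T z.
  by rewrite lt_neqAle td_r0 andbT eq_sym; apply: contraNneq gzn0; rewrite gg' => ->; rewrite mulr0.
rewrite rhoE// /H1 /H2 /H /= (matching_dist (td_thetaL T) (td_thetaB T) (td_subS T) (td_subR T)).
have -> : `|2 * z - 2 * td_S T z| = `|td_S T z - (2 * z - td_S T z)|.
  by rewrite distrC; congr `|_|; ring.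
exact: (distortion_pointwise K0 N0 df df1 ricci NN' N'0 t01' gz_gt0 s_gt0 r_gt0 erefl (esym gg')).
Qed.

End circle_CD.

(** * Collapse to two points *)

Section trig_smooth.
Context (R : realType) (c : R).

(* The functions of this class are infinitely differentiable because the class
   is closed under derivation. *)
Inductive trig_rational : (R -> R) -> Prop :=
| TrigCst a : trig_rational (fun=> a)
| TrigCos : trig_rational (fun s => cos (c * s))
| TrigSin : trig_rational (fun s => sin (c * s))
| TrigAdd f g : trig_rational f -> trig_rational g ->
    trig_rational (fun s => f s + g s)
| TrigMul f g : trig_rational f -> trig_rational g ->
    trig_rational (fun s => f s * g s)
| TrigInv f : trig_rational f -> (forall s, f s != 0) ->
    trig_rational (fun s => (f s)^-1).

Lemma trig_rational_derive f : trig_rational f ->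
  exists2 g, trig_rational g & forall s, is_derive s (1 : R) f (g s).
Proof.
elim=> {f} [a|||f g _ [f' tf' df] _ [g' tg' dg]|f g tf [f' tf' df] tg [g' tg' dg]|
    f tf [f' tf' df] f0].
- by exists (fun=> 0) => [|s]; [exact: TrigCst|exact: is_derive_cst].
- exists (fun s => - c * sin (c * s)).
    exact: (TrigMul (TrigCst (- c)) TrigSin).
  by move=> s; apply: is_derive_eq; rewrite /GRing.scale/=; ring.
- exists (fun s => c * cos (c * s)).
    exact: (TrigMul (TrigCst c) TrigCos).
  by move=> s; apply: is_derive_eq; rewrite /GRing.scale/=; ring.
- exists (fun s => f' s + g' s); first exact: TrigAdd.
  by move=> s; exact: is_deriveD.
- exists (fun s => f' s * g s + f s * g' s).
    by apply: TrigAdd; exact: TrigMul.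
  by move=> s; apply: is_derive_eq; rewrite /GRing.scale/=; ring.
exists (fun s => -1 * ((f s)^-1 * (f s)^-1) * f' s).
  apply: TrigMul => //; apply: (TrigMul (TrigCst (-1))).
  by apply: TrigMul; exact: TrigInv.
by move=> s; have fs := f0 s; apply: is_derive_eq; rewrite /GRing.scale/= -exprVn; field.
Qed.

Lemma trig_rational_derivable f n s : trig_rational f ->
  derivable (derive1n n f) s 1.
Proof.
elim: n f => [|n IH] f tf; have [g tg df] := trig_rational_derive tf.
  exact: ex_derive.
rewrite derive1Sn (_ : f^`()%classic = g); first exact: IH.
by apply/funext => x; rewrite derive1E; exact: derive_val.
Qed.

End trig_smooth.

Section weight.
Context (R : realType) (D : {posnum R}).
Local Notation S1 := (circle D).
Local Notation e := (circle_param D).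
Variables (N b Z : R).
Hypotheses (N0 : N < 0) (b0 : 0 < b).
Let c := pi / D%:num.

(* [exp (potential / (1 - N))] is a multiple of [sqrt (cos (c s) ^ 2 + b ^ 2)],
   which satisfies [h'' + c ^ 2 h >= 0]. As [b] tends to 0 it degenerates to
   [|cos (c s)|], which vanishes at two antipodal points. *)
Definition potential (p : S1) : R :=
  Z + (1 - N) / 2 * ln (abscissa p ^+ 2 + b ^+ 2).

Let u (s : R) := cos (c * s) ^+ 2 + b ^+ 2.

Let u_gt0 s : 0 < u s.
Proof. by rewrite /u ltr_wpDl ?sqr_ge0// exprn_gt0. Qed.

Lemma potential_param s : potential (e s) = Z + (1 - N) / 2 * ln (u s).
Proof.
rewrite /potential /abscissa/= /u /c; do 5 congr (_ _).
by rewrite mulrAC.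
Qed.

Let u1 (s : R) := - (2 * c) * (cos (c * s) * sin (c * s)).
Let u2 (s : R) := - (2 * c ^+ 2) * (cos (c * s) ^+ 2 - sin (c * s) ^+ 2).

Let f1 (s : R) := (1 - N) / 2 * (u1 s / u s).
Let f2 (s : R) := (1 - N) / 2 * ((u2 s * u s - u1 s ^+ 2) / u s ^+ 2).

Lemma potential_derive (s : R) : is_derive s (1 : R) (fun s => potential (e s)) (f1 s).
Proof.
rewrite (_ : (fun s => _) = (fun s => Z + (1 - N) / 2 * ln (u s))).
  have dln := is_derive1_ln (u_gt0 s).
  apply: is_derive_eq; rewrite /GRing.scale/= /f1 /u1 add0r mul1r.
  by move: (u s)^-1 => v; ring.
by apply/funext => x; rewrite potential_param.
Qed.

Lemma potential_derive2 (s : R) : is_derive s (1 : R) f1 (f2 s).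
Proof.
have un0 : u s != 0 by rewrite gt_eqF.
rewrite /f1; apply: is_derive_eq; rewrite /GRing.scale/= /f2 /u1 /u2.
by move: (u s) un0 => v v0; field.
Qed.

Lemma potential_ricci (K : R) (s : R) : K < 0 -> pi * Num.sqrt ((N - 1) / K) <= D%:num ->
  K <= f2 s + f1 s ^+ 2 / (1 - N).
Proof.
move=> K0 KD; have D0 : 0 < D%:num by [].
have k0 : 0 < (N - 1) / K by rewrite -mulrNN -invrN mulr_gt0 ?invr_gt0 ?oppr_gt0//; have := N0; lra.
(* The lower bound on [D] enters here, squared. *)
have c2 : c ^+ 2 <= K / (N - 1).
  have : pi * Num.sqrt ((N - 1) / K) / D%:num <= 1 by rewrite ler_pdivrMr// mul1r.
  rewrite mulrAC -/c => h.
  have : (c * Num.sqrt ((N - 1) / K)) ^+ 2 <= 1 ^+ 2.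
    rewrite ler_sqr ?nnegrE// mulr_ge0 ?sqrtr_ge0// divr_ge0// ?pi_ge0// ltW//.
  rewrite exprMn sqr_sqrtr ?(ltW k0)// expr1n -ler_pdivlMr//.
  by rewrite mul1r invf_div.
have n0 : 0 < 1 - N by have := N0; lra.
have un0 : u s != 0 by rewrite gt_eqF.
have cs : sin (c * s) ^+ 2 = 1 - cos (c * s) ^+ 2 by rewrite -(cos2Dsin2 (c * s)); ring.
(* With [h = sqrt u] the left-hand side is [(1 - N) * (h'' / h + c ^ 2)]; the right-hand side is the
   positive excess produced by [b]. *)
have E : f2 s + f1 s ^+ 2 / (1 - N) + (1 - N) * c ^+ 2 =
    (1 - N) * c ^+ 2 * (b ^+ 2 + b ^+ 4) / u s ^+ 2.
  have -> : f2 s + f1 s ^+ 2 / (1 - N) + (1 - N) * c ^+ 2 = ((1 - N) / 2 *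
      (u2 s * u s - u1 s ^+ 2 / 2) + (1 - N) * c ^+ 2 * u s ^+ 2) / u s ^+ 2.
    rewrite /f2 /f1; move: (u s) (u1 s) (u2 s) un0 => v v1 v2 v0.
    by field; rewrite v0 gt_eqF.
  congr (_ / _); have -> : u1 s ^+ 2 = 4 * c ^+ 2 * cos (c * s) ^+ 2 * sin (c * s) ^+ 2.
    by rewrite /u1; ring.
  by rewrite /u2 /u cs; move: (cos (c * s)) => co; field.
have : 0 <= f2 s + f1 s ^+ 2 / (1 - N) + (1 - N) * c ^+ 2.
  rewrite E mulr_ge0 ?invr_ge0 ?sqr_ge0// mulr_ge0 ?addr_ge0 ?exprn_ge0 ?(ltW b0)//.
  by rewrite mulr_ge0 ?sqr_ge0// ltW.
have : (1 - N) * c ^+ 2 <= - K.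
  rewrite mulrC -ler_pdivlMr// (le_trans c2)// -[K / _]mulrNN -invrN opprB.
  exact: lexx.
lra.
Qed.

(** The logarithm is outside [trig_rational] while its first derivative is inside, hence the
    separate case of order 0. *)
Lemma potential_smooth : smooth potential.
Proof.
move=> n s; case: n => [|n].
  by case: (potential_derive s).
rewrite derive1Sn.
have -> : ((potential \o e)^`())%classic = f1.
  by apply/funext => x; rewrite derive1E; case: (potential_derive x).
apply: (trig_rational_derivable (c := c)).
apply: (TrigMul (TrigCst _ _)); apply: TrigMul; last first.
  apply: TrigInv; last by move=> x; rewrite gt_eqF.
  apply: TrigAdd; last exact: TrigCst.
  rewrite (_ : (fun x => _) = (fun x => cos (c * x) * cos (c * x))).
    by apply: TrigMul; exact: TrigCos.
  by apply/funext => x; rewrite expr2.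
apply: (TrigMul (TrigCst _ _)); apply: TrigMul; [exact: TrigCos|exact: TrigSin].
Qed.

End weight.

(** As for the circle, the index [D] selects the metric. *)
Definition two_points (R : realType) (D : {posnum R}) : Type := bool.

Section two_points.
Context (R : realType) (D : {posnum R}).
Local Notation leb := (@lebesgue_measure R).
Local Notation T2 := (two_points D).

HB.instance Definition _ := Choice.copy T2 bool.
HB.instance Definition _ := isPointed.Build T2 true.

Definition two_points_dist (p q : T2) : R := if p == q then 0 else D%:num.

Let two_points_dist_xx p : two_points_dist p p = 0.
Proof. by rewrite /two_points_dist eqxx. Qed.

Let two_points_dist_positivity p q : two_points_dist p q = 0 -> p = q.
Proof. by rewrite /two_points_dist; case: eqVneq => // _ /eqP; rewrite gt_eqF. Qed.

Let two_points_distC p q : two_points_dist p q = two_points_dist q p.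
Proof. by rewrite /two_points_dist eq_sym. Qed.

Let two_points_dist_triangle q p r :
  two_points_dist p r <= two_points_dist p q + two_points_dist q r.
Proof.
have D0 : 0 < D%:num by [].
by rewrite /two_points_dist; case: p; case: q; case: r => /=; lra.
Qed.

HB.instance Definition _ := @isMetric.Build R T2 two_points_dist
  two_points_dist_xx two_points_dist_positivity two_points_distC
  two_points_dist_triangle.

Let two_points_compact : compact [set: T2].
Proof. by apply: finite_compact; exact: (@finite_finset bool [set: bool]). Qed.

HB.instance Definition _ := Uniform_isComplete.Build T2
  (fun F FF cF => compact_cauchy_cvg FF cF filterT two_points_compact).

Lemma two_points_mdistE (p q : T2) :
  mdist p q = if p == q then 0 else D%:num.
Proof. by []. Qed.

Lemma two_points_separable : exists2 S : set T2, countable S & dense S.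
Proof.
exists setT; first exact: (@countableP bool).
by move=> U [x Ux] _; exists x.
Qed.

Definition two_points_mm (mu : probability (borel T2) R) : mmspace R :=
  MMSpace two_points_separable mu.

Lemma two_points_card : ([set: T2] #= `I_2)%card.
Proof.
apply/eq_cardSP; exists true => //.
rewrite (_ : _ `\` _ = [set false]); first exact: card_set1.
by apply/seteqP; split=> -[] /=; intuition.
Qed.

Lemma two_points_diam : diam T2 = D%:num%:E.
Proof.
apply/eqP; rewrite eq_le; apply/andP; split.
  apply: ge_ereal_sup => _ [[p q] _ <-]; rewrite lee_fin two_points_mdistE/=.
  by case: ifP.
by apply: ereal_sup_ubound; exists (true, false).
Qed.

(** A parameter of the two-point space: each half of [[0, 1)] goes to one point, which gives both
    the mass 1/2. *)
Definition side (v : R) : T2 := v < 2^-1.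

Lemma measurable_side :
  measurable_fun [set: R] (side : R -> borel T2).
Proof.
apply: (@measurability _ _ _ (borel T2) _ _ (@open T2)) => //.
move=> _ [U oU <-]; rewrite setTI.
rewrite (_ : _ @^-1` _ = (if true \in U then `]-oo, 2^-1[%classic else set0) `|`
   (if false \in U then `[2^-1, +oo[%classic else set0)).
  by apply: measurableU; case: ifP.
apply/seteqP; split=> v /=; rewrite /side.
  by have [v2|v2] := ltP v 2^-1 => Uv; [left|right];
    rewrite mem_set//= in_itv/= ?v2.
case; case: ifPn => [/set_mem Ux|//] /=; rewrite in_itv/= ?andbT.
  by move=> ->.
by rewrite leNgt => /negbTE ->.
Qed.

Lemma exists_two_points_law : exists mu : probability (borel T2) R,
  forall A : set (borel T2), measurable A ->
    mu A = leb (`[0, 1[ `&` side @^-1` A).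
Proof.
have m01 : measurable_fun [set: measurableTypeR R] (fun v => (\1_(`[0%R, 1%R[%classic) v : R)%:E).
  by apply/measurable_EFinP; exact: measurable_indic.
have [||] := @exists_weighted_probability _ _ R (lebesgue_measure : {measure set (measurableTypeR R) -> \bar R}) _ m01.
- by move=> x; rewrite lee_fin.
- rewrite integral_indic// setIT; etransitivity; first exact: lebesgue_measure_itv.
  by rewrite /= lte_fin ltr01 sube0.
move=> nu nuE.
have [mu muE] := exists_pushforward_probability nu measurable_side.
exists mu => A mA; rewrite muE nuE integral_indic//.
rewrite -[X in measurable X]setTI; exact: measurable_side.
Qed.

Lemma two_points_supp (mu : probability (borel T2) R) :
  (forall A : set (borel T2), measurable A ->
    mu A = leb (`[0, 1[ `&` side @^-1` A)) ->
  mm_supp (two_points_mm mu) = setT.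
Proof.
move=> muE; apply/seteqP; split=> // p _ U oU Up.
have mU : measurable (U : set (borel T2)) by exact: sub_sigma_algebra.
rewrite [X in (_ < X)%E]muE//.
have mside : measurable (side @^-1` U).
  by rewrite -[X in measurable X]setTI; exact: measurable_side.
have half (l r : R) : l < r -> `[l, r[ `<=` `[0, 1[ `&` side @^-1` U ->
    (0 < leb (`[0%R, 1%R[ `&` side @^-1` U)%classic)%E.
  move=> lr sub; apply: (@lt_le_trans _ _ (leb `[l, r[%classic)).
    by rewrite lebesgue_measure_itv/= lte_fin lr -EFinD lte_fin subr_gt0.
  by apply: le_measure; rewrite ?inE//; exact: measurableI.
case: p Up => Up.
  apply: (half 0 2^-1) => [|v /=]; first by lra.
  rewrite !in_itv/= /side => /andP[v0 v1]; rewrite v0 v1; split=> //; lra.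
apply: (half 2^-1 1) => [|v /=]; first by lra.
rewrite !in_itv/= /side => /andP[v0 v1]; split; first by rewrite v1 andbT; lra.
by rewrite (_ : (v < 2^-1) = false)//; apply/negbTE; rewrite -leNgt.
Qed.

End two_points.

Section quantile.
Context (R : realType) (L : R) (F : R -> R).
Hypothesis L0 : 0 < L.
Hypotheses (cF : continuous F) (ndF : {homo F : x y / x <= y}).
Hypothesis FD : forall x, F (x + L) = F x + 1.

(** The generalized inverse, characterized by a Galois connection. It is defined for every [v]
    because [F] gains 1 at each period and is thus unbounded on both sides. *)
Lemma exists_quantile : exists Q : R -> R,
  measurable_fun setT Q /\ forall v x, (Q v <= x) = (v <= F x).
Proof.
have FN (k : int) : F (k%:~R * L) = F 0 + k%:~R.
  have P x : F (x + L) - (x + L) / L = F x - x / L.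
    by rewrite FD mulrDl divff ?gt_eqF//; ring.
  have := periodic_int k 0 P; rewrite add0r mulfK ?gt_eqF//.
  by rewrite mul0r subr0 => <-; rewrite subrK.
have below v : exists x, F x < v.
  exists ((- (Num.floor (`|F 0 - v|) + 1))%:~R * L); rewrite FN.
  have := floor_itv `|F 0 - v|.
  rewrite rmorphN rmorphD/= => /andP[_]; have := ler_norm (F 0 - v); lra.
have above v : exists x, v < F x.
  exists ((Num.floor (`|v - F 0|) + 1)%:~R * L); rewrite FN.
  have := floor_itv `|v - F 0|.
  rewrite rmorphD/= => /andP[_]; have := ler_norm (v - F 0); lra.
have /choice[Q QE] v : exists q, forall x, (q <= x) = (v <= F x).
  by have [ab abE] := monotone_level cF ndF (below v) (above v);
    exists ab.1 => x; have [] := abE x.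
exists Q; split => // mT.
apply: (measurability _ (RGenOInfty.measurableE R)) => //.
move=> _ [_ [x ->] <-]; rewrite setTI (_ : _ @^-1` _ = `]F x, +oo[%classic)//.
by apply/seteqP; split=> v /=; rewrite !in_itv/= !andbT !ltNge QE.
Qed.

End quantile.

(** * The box distance through quantile functions *)

Section box.
Context (R : realType) (D : {posnum R}).
Local Notation leb := (@lebesgue_measure R).
Local Notation S1 := (circle D).
Local Notation L := (2 * D%:num).
Local Notation e := (circle_param D).
Variables (w F : R -> R) (mu : probability (borel S1) R)
  (nu : probability (borel (two_points D)) R).
Hypotheses (mw : measurable_fun setT w) (w0 : forall x, 0 <= w x).
Hypotheses (cF : continuous F) (smF : {homo F : x y / x < y}).
Hypothesis FL : forall x, F (x + L) = F x + 1.
Hypotheses (F0 : F 0 = 0) (FD : F D%:num = 2^-1) (pF : primitive_on 0 L w F).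
Hypothesis muE : forall A : set (borel S1), measurable A ->
  mu A = (\int[leb]_(x in `[0%R, L]) ((\1_A (e x))%:E * (w x)%:E))%E.
Hypothesis nuE : forall A : set (borel (two_points D)), measurable A ->
  nu A = leb (`[0, 1[ `&` @side R D @^-1` A).

Let ndF : {homo F : x y / x <= y}.
Proof. exact: ltW_homo. Qed.

(** [F] carries [w dx] on one period to Lebesgue measure on [[0, 1)], [w] being its density. *)
Lemma lebesgue_cdf (B : set R) : measurable B ->
  leb (`[0, 1[ `&` B) =
  (\int[leb]_(x in `[0%R, L]) ((\1_B (F x))%:E * (w x)%:E))%E.
Proof.
move=> mB; have L0 := circle_period_gt0 D.
transitivity (\int[leb]_(x in `[0%R, 1%R[) (\1_B x : R)%:E)%E.
  by rewrite integral_indic// setIC.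
have mB1 : measurable_fun setT (fun x : R => (\1_B x : R)%:E).
  by apply/measurable_EFinP; exact: measurable_indic.
rewrite integral_itv_bndo_bndc; last exact: measurable_funS mB1.
have FL1 : F L = 1 by rewrite -[L]add0r FL F0 add0r.
rewrite (primitive_change_of_variable (ltW L0) mw w0 cF ndF pF mB1) ?F0 ?FL1//.
Qed.

(** The parameters are [e] after the quantile function, and [side]. The set [J] keeps the [v] for
    which [Q v] is within [d] of the centre [D / 2] or [3 D / 2] of its half circle; these centres
    are antipodal, so distances are distorted by at most [2 * d]. Outside [J] the density is at most
    [M], hence the mass at most [L * M]. *)
Lemma circle_box_admissible (d M eps : R) : 0 < d -> 0 <= M ->
  (forall x, 0 <= x <= L ->
     d < `|x - (if x < D%:num then D%:num / 2 else 3 * D%:num / 2)| -> w x <= M) ->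
  2 * d <= eps -> L * M <= eps ->
  @box_admissible R (circle_mm mu) (two_points_mm nu) eps.
Proof.
move=> d0 M0 wM deps Meps; have L0 := circle_period_gt0 D; have D0 : 0 < D%:num by [].
have [Q [mQ QE]] := exists_quantile L0 cF ndF FL.
have QF x : Q (F x) = x.
  apply/eqP; rewrite eq_le QE lexx/= leNgt; apply/negP => Qx.
  by have := smF Qx; rewrite ltNge -QE lexx.
pose pt (p : two_points D) : R := if (p : bool) then D%:num / 2 else 3 * D%:num / 2.
pose J : set R := [set v | `|Q v - pt (side D v)| <= d].
have mpt : measurable_fun setT (fun v : R => pt (side D v)).
  rewrite /pt /side; apply: measurable_fun_ifT => //.
  exact: measurable_fun_ltr.
have mJ : measurable J.
  rewrite (_ : J = (fun v => `|Q v - pt (side D v)|) @^-1` `]-oo, d]%classic).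
    rewrite -[X in measurable X]setTI.
    have : measurable_fun setT (fun v => `|Q v - pt (side D v)|).
      apply: measurableT_comp => //; exact: measurable_funB.
    by apply.
  by apply/seteqP; split=> v /=; rewrite in_itv.
have phiE (A : set (borel S1)) : measurable A ->
    leb (`[0, 1[ `&` (e \o Q) @^-1` A) = mu A.
  move=> mA; rewrite muE// lebesgue_cdf; last first.
    rewrite -[X in measurable X]setTI.
    exact: (measurableT_comp (@measurable_circle_param R D) mQ).
  apply: eq_integral => x _; congr (_ * _)%E; rewrite !indicE; congr (_%:R%:E).
  by congr nat_of_bool; apply/idP/idP; rewrite !inE /= QF.
have mphi : measurable_fun setT (e \o Q : R -> borel S1).
  exact: (measurableT_comp (@measurable_circle_param R D) mQ).
have dist_pt p q : mdist (e (pt p)) (e (pt q)) = mdist (p : two_points D) q.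
  have dD : `|3 * D%:num / 2 - D%:num / 2| = D%:num :> R.
    by rewrite ger0_norm; lra.
  case: p; case: q; rewrite two_points_mdistE/= ?mdistxx//.
    by rewrite circle_param_isometry distrC dD.
  by rewrite circle_param_isometry dD.
have mI (B : set R) : measurable B -> measurable (`[0, 1[%classic `&` B).
  exact: measurableI.
exists (`[0, 1[%classic `&` J), (e \o Q), (@side R D); split.
- exact: measurableI.
- by move=> v [].
- by split; [exact: measurable_funS mphi|move=> A mA; exact: phiE].
- by split=> [|A mA]; [exact: measurable_funS (@measurable_side R D)|rewrite [RHS]nuE].
split.
  have : (leb (`[0%R, 1%R[ `&` ~` J)%classic <= eps%:E)%E.
    rewrite lebesgue_cdf; last exact: measurableC.
    apply: (@le_trans _ _ (\int[leb]_(x in `[0%R, L]) (cst M%:E x))%E); last first.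
      rewrite integral_cst// [X in (_ * X)%E](_ : _ = L%:E); last first.
        by etransitivity; [exact: lebesgue_measure_itv|rewrite /= lte_fin L0 sube0].
      by rewrite -EFinM lee_fin mulrC.
    apply: ge0_le_integral => //.
    - by move=> x _; rewrite -EFinM lee_fin mulr_ge0.
    - apply: (@measurable_funS _ _ _ _ setT) => //; apply: emeasurable_funM.
        apply/measurable_EFinP; apply: measurableT_comp.
          exact: measurable_indic (measurableC mJ).
        exact: continuous_measurable_fun.
      exact/measurable_EFinP.
    move=> x /=; rewrite in_itv/= => xL; rewrite -EFinM lee_fin indicE.
    case: (boolP (_ \in _)) => [|_]; last by rewrite mul0r.
    (* As [F] is strictly increasing with value 1/2 at [D], [side D (F x)] tests [x < D]. *)
    rewrite inE mul1r /= => /negP; rewrite -ltNge QF /side -FD (leW_mono (le_mono smF)) => h.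
    exact: wM.
  have : leb (`[0, 1[%classic : set R) = 1%E.
    by etransitivity; [exact: lebesgue_measure_itv|rewrite /= lte_fin ltr01 sube0].
  rewrite (@measureDI _ _ _ leb _ J)// setDE => E Jeps.
  by rewrite EFinB leeBlDr// -[1%:E]/1%E -E addeC leeD2l.
move=> s t [_ Js] [_ Jt]; rewrite -dist_pt.
change (`|mdist (e (Q s)) (e (Q t)) -
  mdist (e (pt (side D s))) (e (pt (side D t)))| <= eps).
have := circle_param_lip D (Q s) (pt (side D s)).
have := circle_param_lip D (Q t) (pt (side D t)).
have := metric_triangle (e (pt (side D s))) (e (Q s)) (e (pt (side D t))).
have := metric_triangle (e (Q s)) (e (pt (side D s))) (e (Q t)).
have := metric_triangle (e (Q s)) (e (Q t)) (e (pt (side D t))).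
have := metric_triangle (e (pt (side D s))) (e (pt (side D t))) (e (Q t)).
rewrite (metric_sym (e (pt (side D s))) (e (Q s))) (metric_sym (e (pt (side D t))) (e (Q t))).
move: Js Jt; rewrite /J/=; move: (`|Q s - _|) (`|Q t - _|) => ns nt.
by move=> Js Jt h1 h2 h3 h4 h5 h6; rewrite ler_norml; lra.
Qed.

End box.

Lemma sin_le_id (R : realType) (x : R) : 0 <= x -> sin x <= x.
Proof.
rewrite le_eqVlt => /predU1P[<-|x0]; first by rewrite sin0.
have [|c _] := @MVT R sin cos 0 x x0 (fun y _ => is_derive_sin y).
  by apply: continuous_subspaceT => y; exact: continuous_sin.
by rewrite sin0 !subr0 => ->; rewrite ler_piMl ?cos_le1// ltW.
Qed.

(** * Mass and concentration of the weight *)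

Section weight.
Context (R : realType) (D : {posnum R}) (N b : R).
Hypotheses (N0 : N < 0) (b0 : 0 < b).
Local Notation leb := (@lebesgue_measure R).
Local Notation L := (2 * D%:num).
Local Notation e := (circle_param D).
Let c := pi / D%:num.
Let D0 : 0 < D%:num. Proof. by []. Qed.
Let L0 : 0 < L := circle_period_gt0 D.

(** The density before normalization: the additive constant of the potential is 0. *)
Definition weight (s : R) : R := expR (- potential N b 0 (e s)).

Let weightE s : weight s = expR ((N - 1) / 2 * ln (cos (c * s) ^+ 2 + b ^+ 2)).
Proof. by rewrite /weight potential_param; congr expR; rewrite /c; ring. Qed.

Let u_gt0 s : 0 < cos (c * s) ^+ 2 + b ^+ 2.
Proof. by rewrite ltr_wpDl ?sqr_ge0// exprn_gt0. Qed.

Lemma weight_gt0 s : 0 < weight s. Proof. exact: expR_gt0. Qed.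

Lemma weight_le s a : 0 < a -> a <= cos (c * s) ^+ 2 + b ^+ 2 ->
  weight s <= expR ((N - 1) / 2 * ln a).
Proof.
move=> a0 au; have h : (N - 1) / 2 <= 0 by have := N0; lra.
by rewrite weightE ler_expR ler_wnM2l// ler_ln ?posrE.
Qed.

Lemma weight_ge s a : cos (c * s) ^+ 2 + b ^+ 2 <= a ->
  expR ((N - 1) / 2 * ln a) <= weight s.
Proof.
move=> ua; have h : (N - 1) / 2 <= 0 by have := N0; lra.
have a0 := lt_le_trans (u_gt0 s) ua.
by rewrite weightE ler_expR ler_wnM2l// ler_ln ?posrE.
Qed.

(** Invariance under the half turn is the reason why each limit point gets the mass 1/2. *)
Lemma weightD s : weight (s + D%:num) = weight s.
Proof.
rewrite !weightE mulrDr {2}/c divfK ?gt_eqF//.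
by rewrite cosDpi sqrrN.
Qed.

Lemma measurable_weight : measurable_fun [set: R] weight.
Proof.
apply: continuous_measurable_fun => s; apply: continuous_comp.
  apply: continuousN; apply: differentiable_continuous.
  by apply/derivable1_diffP; case: (@potential_derive _ D N b 0 b0 s).
exact: continuous_expR.
Qed.

(* As [N < 0], the lower bound diverges when [b] tends to 0. It is the mass of an
   arc of length [b / c] that ends at a minimum of the potential. *)
Lemma weight_mass : exists2 I : R,
  (\int[leb]_(x in `[0%R, L]) (weight x)%:E = I%:E)%E &
  0 < I /\ (b <= 1 ->
    D%:num / pi * expR ((N - 1) / 2 * ln 2) * expR (N * ln b) <= I).
Proof.
have mW : measurable_fun setT (fun x => (weight x)%:E).
  by apply/measurable_EFinP; exact: measurable_weight.
have W0 x : (0 <= (weight x)%:E)%E by rewrite lee_fin ltW// weight_gt0.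
have low (l r m : R) : 0 <= l -> l <= r -> r <= L -> 0 <= m ->
    (forall x, l <= x <= r -> m <= weight x) ->
    ((m * (r - l))%:E <= \int[leb]_(x in `[0%R, L]) (weight x)%:E)%E.
  move=> l0 lr rL m0 mx.
  apply: (@le_trans _ _ (\int[leb]_(x in `[l, r]) (weight x)%:E)%E); last first.
    apply: ge0_subset_integral => //; first exact: measurable_funS mW.
    by apply: subset_itv; rewrite bnd_simp.
  apply: (@le_trans _ _ (\int[leb]_(x in `[l, r]) (cst m%:E x))%E).
    rewrite integral_cst// [X in (_ * X)%E](_ : _ = (r - l)%:E) ?EFinM//.
    etransitivity; first exact: lebesgue_measure_itv.
    rewrite /= lte_fin; case: ltP => //= rl.
    by rewrite (_ : r = l) ?subrr//; apply/eqP; rewrite eq_le rl.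
  by apply: ge0_le_integral => //; exact: measurable_funS mW.
have fin : (\int[leb]_(x in `[0%R, L]) (weight x)%:E < +oo)%E.
  apply: (@le_lt_trans _ _ (\int[leb]_(x in `[0%R, L]) (cst (expR ((N - 1) / 2 * ln (b ^+ 2)))%:E x))%E).
    apply: ge0_le_integral => //; first exact: measurable_funS mW.
    move=> x _; rewrite lee_fin weight_le ?exprn_gt0//.
    by rewrite lerDr sqr_ge0.
  rewrite integral_cst// [X in (_ * X)%E](_ : _ = L%:E); last first.
    by etransitivity; [exact: lebesgue_measure_itv|rewrite /= lte_fin L0 sube0].
  by rewrite -EFinM ltry.
have fnum : (\int[leb]_(x in `[0%R, L]) (weight x)%:E)%E \is a fin_num.
  by rewrite ge0_fin_numE// integral_ge0.
exists (fine (\int[leb]_(x in `[0%R, L]) (weight x)%:E)%E); first by rewrite fineK.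
split=> [|b1].
  rewrite -lte_fin fineK//; apply: lt_le_trans (low 0 L _ _ _ _ (expR_ge0 ((N - 1) / 2 * ln (1 + b ^+ 2))) _) => //.
  - by rewrite subr0 lte_fin mulr_gt0 ?expR_gt0.
  - move=> x _; apply: weight_ge; rewrite lerD2r.
    by rewrite -(cos2Dsin2 (c * x)) lerDl sqr_ge0.
have pi0 := pi_gt0 R; have pi2 := pi_ge2 R.
rewrite -lee_fin fineK//.
have c0 : 0 < c by rewrite divr_gt0.
have bc : b / c <= D%:num / 2.
  rewrite ler_pdivrMr// /c (_ : D%:num / 2 * (pi / D%:num) = pi / 2); first lra.
  by move: pi => q; field; rewrite gt_eqF.
apply: le_trans (low (D%:num / 2 - b / c) (D%:num / 2) _ _ _ _ (expR_ge0 ((N - 1) / 2 * ln (2 * b ^+ 2))) _).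
- rewrite lee_fin opprB addrCA subrr addr0 lnM ?posrE ?exprn_gt0// lnXn//.
  (* On the arc [cos ^ 2 + b ^ 2] is at most [2 * b ^ 2]; the power [(N - 1) / 2] of this bound,
     times the length [b / c], is a constant times [b ^ N]. *)
  have -> : (N - 1) / 2 * (ln 2 + ln b *+ 2) = (N - 1) / 2 * ln 2 + (N * ln b - ln b).
    by rewrite mulr2n; field.
  rewrite expRD expRB lnK ?posrE//.
  rewrite le_eqVlt; apply/orP; left; apply/eqP; rewrite /c.
  move: (expR _) (expR _) pi0 => x1 x2; move: pi => q q0.
  by field; rewrite !gt_eqF.
- by rewrite subr_ge0.
- by rewrite gerBl divr_ge0 ?ltW.
- by have := D0; lra.
move=> x xI; apply: weight_ge.
rewrite [2 * _]mulrDl mul1r lerD2r.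
pose y := c * (D%:num / 2 - x).
have y0 : 0 <= y by rewrite mulr_ge0 ?(ltW c0)// subr_ge0; case/andP: xI.
have yb : y <= b by rewrite /y mulrC -ler_pdivlMr//; lra.
have -> : c * x = pi / 2 - y by rewrite /y /c; move: pi => q; field; rewrite gt_eqF.
rewrite cosB cos_pihalf sin_pihalf mul0r mul1r add0r ler_sqr ?nnegrE ?(ltW b0)//.
  by rewrite (le_trans (sin_le_id y0)).
by apply: sin_ge0_pi; rewrite y0 (le_trans yb)// (le_trans b1)//; lra.
Qed.

End weight.

Section concentration.
Context (R : realType) (D : {posnum R}) (N b : R).
Hypotheses (N0 : N < 0) (b0 : 0 < b).
Local Notation leb := (@lebesgue_measure R).
Local Notation S1 := (circle D).
Local Notation L := (2 * D%:num).
Local Notation e := (circle_param D).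
Let c := pi / D%:num.
Let D0 : 0 < D%:num. Proof. by []. Qed.
Let L0 : 0 < L := circle_period_gt0 D.
Local Notation W := (weight D N b).

(** Up to sign, the cosine at [x] is the sine of the angle from the centre of the half circle, and
    that angle is between [c * d] and [pi / 2]. The bound is independent of [b], so dividing by the
    diverging mass sends it to 0. *)
Lemma weight_tail (d x : R) : 0 < d -> d <= D%:num / 2 -> 0 <= x <= L ->
  d < `|x - (if x < D%:num then D%:num / 2 else 3 * D%:num / 2)| ->
  W x <= expR ((N - 1) / 2 * ln (sin (c * d) ^+ 2)).
Proof.
move=> d0 dD xL; have pi0 := pi_gt0 R; have c0 : 0 < c by rewrite divr_gt0.
have cD : c * (D%:num / 2) = pi / 2.
  by rewrite /c; move: pi => q; field; rewrite gt_eqF.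
have cd : 0 < c * d <= pi / 2 by rewrite mulr_gt0//= -cD ler_pM2l.
have sd : 0 < sin (c * d) by apply: sin_gt0_pi; lra.
set y := x - _ => dy.
have yD : `|y| <= D%:num / 2.
  by rewrite /y; case: ltP => h; rewrite ler_norml; lra.
have cosE : cos (c * x) ^+ 2 = sin (c * `|y|) ^+ 2.
  transitivity (sin (c * y) ^+ 2); last first.
    by case: (ger0P y) => // _; rewrite mulrN sinN sqrrN.
  rewrite /y; case: ltP => _.
    have -> : c * x = c * (x - D%:num / 2) + pi / 2 by rewrite -cD; ring.
    by rewrite cosDpihalf sqrrN.
  have -> : c * x = c * (x - 3 * D%:num / 2) + pi / 2 + pi.
    have -> : pi = c * D%:num by rewrite /c divfK// gt_eqF.
    by field.
  by rewrite cosDpi cosDpihalf !sqrrN.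
apply: weight_le => //; first by rewrite exprn_gt0.
rewrite cosE ler_wpDr ?sqr_ge0// ler_sqr ?nnegrE ?(ltW sd)//; last first.
  apply: sin_ge0_pi; rewrite mulr_ge0 ?(ltW c0)//=.
  have : c * `|y| <= pi / 2 by rewrite -cD ler_pM2l.
  by lra.
have cy : c * `|y| <= pi / 2 by rewrite -cD ler_pM2l.
have cdy : c * d < c * `|y| by rewrite ltr_pM2l.
by rewrite ltW// ltr_sin// in_itv/=; lra.
Qed.

Variables (I : R) (mu : probability (borel S1) R)
  (nu : probability (borel (two_points D)) R).
Hypothesis I0 : 0 < I.
Hypothesis WI : (\int[leb]_(x in `[0%R, L]) (W x)%:E = I%:E)%E.
Hypothesis muE : forall A : set (borel S1), measurable A ->
  mu A = (\int[circle_vol D]_(x in A) (expR (- potential N b (ln I) (x : S1)))%:E)%E.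
Hypothesis nuE : forall A : set (borel (two_points D)), measurable A ->
  nu A = leb (`[0, 1[ `&` @side R D @^-1` A).

Let w (x : R) := W x / I.

Lemma normalized_weightE x : expR (- potential N b (ln I) (e x)) = w x.
Proof.
rewrite /w /weight !potential_param add0r opprD expRD (expRN (ln I)) lnK ?posrE//.
exact: mulrC.
Qed.

Let w_gt0 x : 0 < w x. Proof. by rewrite divr_gt0 ?weight_gt0. Qed.

Let mw : measurable_fun [set: R] w.
Proof. by apply: measurable_funM => //; exact: measurable_weight. Qed.

Let intw (a r : R) : (\int[leb]_(x in `[a, r]) (w x)%:E =
  (I^-1)%:E * \int[leb]_(x in `[a, r]) (W x)%:E)%E.
Proof.
rewrite -ge0_integralZl//=; last by rewrite lee_fin invr_ge0 ltW.
- by apply: eq_integral => x _; rewrite -EFinM mulrC.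
- apply: (@measurable_funS _ _ _ _ setT) => //; apply/measurable_EFinP.
  exact: measurable_weight.
- by move=> x _; rewrite lee_fin ltW// weight_gt0.
Qed.

Let wD x : w (x + D%:num) = w x.
Proof. by rewrite /w weightD. Qed.

Let intw1 : (\int[leb]_(x in `[0%R, L]) (w x)%:E = 1)%E.
Proof. by rewrite intw WI -EFinM mulVf ?gt_eqF. Qed.

Lemma measurable_normalized_weight : measurable_fun [set: borel S1]
  (fun p : borel S1 => expR (- potential N b (ln I) (p : S1))).
Proof.
apply: measurable_circle_fun; rewrite (_ : _ \o _ = w)//.
by apply/funext => x; exact: normalized_weightE.
Qed.

Lemma normalized_weight_mass :
  (\int[circle_vol D]_p (expR (- potential N b (ln I) (p : S1)))%:E = 1)%E.
Proof.
rewrite ge0_integral_circle.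
- by rewrite -[RHS]intw1; apply: eq_integral => x _; rewrite normalized_weightE.
- apply/measurable_EFinP; exact: measurable_normalized_weight.
- by move=> p; rewrite lee_fin expR_ge0.
Qed.

Lemma potential_box_admissible (d eps : R) :
  0 < d -> d <= D%:num / 2 -> 2 * d <= eps ->
  L * (expR ((N - 1) / 2 * ln (sin (c * d) ^+ 2)) / I) <= eps ->
  @box_admissible R (circle_mm mu) (two_points_mm nu) eps.
Proof.
move=> d0 dD deps Meps.
have wL x : w (x + L) = w x by rewrite mulr2n mulrDl mul1r addrA !wD.
have w0 x := ltW (w_gt0 x).
have [F [cF ndF FL pF]] := exists_periodic_cdf L0 mw w0 wL intw1.
pose G x := F x - F 0.
have pG l u : primitive_on l u w G.
  by move=> x y lx xy yu; rewrite (pF l u)// /G; congr (_%:E); ring.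
apply: (@circle_box_admissible R D w G mu nu mw w0 _ _ _ _ _ _ _ nuE d
   (expR ((N - 1) / 2 * ln (sin (c * d) ^+ 2)) / I) eps) => //.
- by move=> x; apply: continuousB; [exact: cF|exact: cst_continuous].
- move=> x y xy; rewrite -subr_gt0 -lte_fin -(pG x y)//; last exact: ltW.
  (* [cos ^ 2 + b ^ 2 <= 1 + b ^ 2] bounds the density below by a positive constant, so its
     primitive is strictly increasing. *)
  pose m := expR ((N - 1) / 2 * ln (1 + b ^+ 2)) / I.
  have m0 : 0 < m by rewrite divr_gt0 ?expR_gt0.
  have mxw z : m <= w z.
    rewrite /m /w ler_pM2r ?invr_gt0// weight_ge// lerD2r.
    by rewrite -(cos2Dsin2 (pi / D%:num * z)) lerDl sqr_ge0.
  apply: (@lt_le_trans _ _ (\int[leb]_(z in `[x, y]) (cst m%:E z))%E).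
    rewrite integral_cst// [X in (_ * X)%E](_ : _ = (y - x)%:E).
      by rewrite -EFinM lte_fin mulr_gt0 ?subr_gt0.
    by etransitivity; [exact: lebesgue_measure_itv|rewrite /= lte_fin xy].
  apply: ge0_le_integral => //.
  - by move=> z _; rewrite lee_fin ltW.
  - apply: (@measurable_funS _ _ _ _ setT) => //; exact/measurable_EFinP.
  - by move=> z _; rewrite lee_fin.
- by move=> x; rewrite /G FL; ring.
- by rewrite /G subrr.
- have GL : G L = 1 by rewrite /G -[L]add0r FL; ring.
  (* The two half circles have equal mass, by invariance under the half turn. *)
  have : (\int[leb]_(x in `[0%R, D%:num]) (w x)%:E =
      \int[leb]_(x in `[D%:num, L]) (w x)%:E)%E.
    have mwE : measurable_fun setT (fun x => (w x)%:E) by apply/measurable_EFinP.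
    have wE0 x : (0 <= (w x)%:E)%E by rewrite lee_fin.
    have := integral_shift 0 D%:num D%:num mwE wE0.
    rewrite add0r (_ : D%:num + D%:num = L) => [->|]; last by ring.
    by apply: eq_integral => x _; rewrite wD.
  have DL : D%:num <= L by have := D0; lra.
  rewrite (pG 0 D%:num)// (pG D%:num L)// GL => -[].
  by rewrite (_ : G 0 = 0) /G ?subrr//; lra.
- move=> A mA.
  have mP := measurable_normalized_weight.
  have m1 : measurable_fun [set: borel S1] (fun p => (\1_A p : R)%:E).
    by apply/measurable_EFinP; exact: measurable_indic.
  have P0 (p : borel S1) : 0 < expR (- potential N b (ln I) (p : S1)) by exact: expR_gt0.
  have i0 (p : borel S1) : (0 <= (\1_A p : R)%:E)%E by rewrite lee_fin.
  transitivity (\int[mu]_p (\1_A p : R)%:E)%E; first by rewrite integral_indic// setIT.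
  rewrite (integral_circle_density mP P0 muE m1 i0) ge0_integral_circle.
  - by apply: eq_integral => x _; rewrite normalized_weightE.
  - by apply: emeasurable_funM => //; exact/measurable_EFinP.
  - by move=> p; rewrite mule_ge0// lee_fin ltW.
- by rewrite divr_ge0 ?expR_ge0 ?ltW.
- by move=> x xL dx; rewrite /w ler_pM2r ?invr_gt0// weight_tail.
Qed.

End concentration.

Lemma box_cvg_admissible (R : realType) (X_ : nat -> mmspace R) (Y : mmspace R) :
  (forall eps : R, 0 < eps ->
     \forall n \near \oo, box_admissible (X_ n) Y eps) ->
  box_cvg X_ Y.
Proof.
move=> adm.
have box0 n : (0 <= box (X_ n) Y)%E.
  by apply: le_ereal_inf_tmp => _ [eps [eps0 _] <-]; rewrite lee_fin ltW.
have boxle (eps : R) : 0 < eps -> \forall n \near \oo, (box (X_ n) Y <= eps%:E)%E.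
  move=> eps0; near=> n; apply: ereal_inf_lbound; exists eps => //; split => //.
  by near: n; exact: adm.
apply/fine_cvgP; split.
  near=> n; rewrite ge0_fin_numE//; apply: (@le_lt_trans _ _ 1%E); last exact: ltry.
  by near: n; exact: boxle.
apply/cvgrPdist_le => eps eps0; near=> n.
have := box0 n; have : (box (X_ n) Y <= eps%:E)%E by near: n; exact: boxle.
rewrite sub0r normrN /=; case: (box _ _) => //= r; rewrite !lee_fin => r1 r0.
by rewrite ger0_norm.
Unshelve. all: by end_near. Qed.

Theorem theorem1p5 (R : realType) (K N : R) (D : {posnum R}) :
  K < 0 -> N < 0 -> pi * Num.sqrt ((N - 1) / K) <= D%:num ->
  exists (f : nat -> circle D -> R)
         (mu : nat -> probability (borel (circle D)) R)
         (Y : mmspace R),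
    [/\ forall n, smooth (f n),
        forall n (A : set (borel (circle D))), measurable A ->
          mu n A = (\int[circle_vol D]_(x in A) (expR (- f n x))%:E)%E,
        [/\ ([set: Y] #= `I_2)%card, mm_supp Y = [set: Y] & diam Y = D%:num%:E],
        forall n, CD (circle_mm (mu n)) K N &
        box_cvg (fun n => circle_mm (mu n)) Y].
Proof.
move=> K0 N0 KD; have D0 : 0 < D%:num by [].
pose b (n : nat) : R := n.+1%:R^-1.
have b0 n : 0 < b n by rewrite invr_gt0.
have /choice[I I_] n : exists I : R,
    (\int[lebesgue_measure]_(x in `[0%R, (2 * D%:num)%R]) (weight D N (b n) x)%:E = I%:E)%E /\
    (0 < I /\ (b n <= 1 ->
      D%:num / pi * expR ((N - 1) / 2 * ln 2) * expR (N * ln (b n)) <= I)).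
  by have [I I1 I2] := weight_mass D N0 (b0 n); exists I.
pose f n (p : circle D) : R := potential N (b n) (ln (I n)) p.
have /choice[mu muE] n : exists mu : probability (borel (circle D)) R,
    forall A : set (borel (circle D)),
      mu A = (\int[circle_vol D]_(x in A) (expR (- f n (x : circle D)))%:E)%E.
  have [WI [I0 _]] := I_ n.
  apply: exists_weighted_probability.
  - apply/measurable_EFinP; exact: (@measurable_normalized_weight R D N (b n) (b0 n) (I n) I0).
  - by move=> p; rewrite lee_fin expR_ge0.
  - exact: (@normalized_weight_mass R D N (b n) (b0 n) (I n) I0 WI).
have [nu nuE] := exists_two_points_law D.
exists f, mu, (two_points_mm nu); split.
- by move=> n; exact: potential_smooth.
- by move=> n A _; exact: muE.
- by split; [exact: two_points_card|exact: two_points_supp|exact: two_points_diam].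
- move=> n; apply: (circle_CD K0 N0).
  + exact: (@potential_derive _ D N (b n) (ln (I n)) (b0 n)).
  + exact: (@potential_derive2 _ D N (b n) (b0 n)).
  + by move=> x; exact: potential_ricci.
  + by move=> A _; exact: muE.
apply: box_cvg_admissible => eps eps0.
(* [d] is fixed by [eps] alone, so the tail bound [M] is the same for all [n], and only the masses
   [I n] still have to be large. *)
pose d := Num.min (eps / 2) (D%:num / 2).
have d0 : 0 < d by rewrite lt_min !divr_gt0.
have de : d <= eps / 2 by rewrite ge_min lexx.
have dD : d <= D%:num / 2 by rewrite ge_min lexx orbT.
pose M := expR ((N - 1) / 2 * ln (sin (pi / D%:num * d) ^+ 2)).
pose C : R := D%:num / pi * expR ((N - 1) / 2 * ln 2).
have C0 : 0 < C by rewrite mulr_gt0 ?expR_gt0// divr_gt0// pi_gt0.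
near=> n.
have [WI [I0 lowI]] := I_ n.
have nN : 0 < - N by rewrite oppr_gt0.
(* The mass [I n] is at least [C * n.+1 ^ (- N)], written with [expR]. Bounding [expR y] below by
   [y] leaves the condition that [ln n.+1] exceed a fixed threshold. *)
have large : 2 * D%:num * M / eps / C / - N <= ln n.+1%:R.
  rewrite -ler_expR lnK ?posrE//; apply: (@le_trans _ _ n%:R); last by rewrite ler_nat.
  by near: n; exact: nbhs_infty_ger.
apply: (potential_box_admissible N0 (b0 n) I0 WI _ _ d0) => //.
- by rewrite mulrC -ler_pdivlMr.
rewrite -/M mulrA ler_pdivrMr// [eps * _]mulrC -ler_pdivrMr//.
have b1 : b n <= 1 by rewrite invf_le1// ler1n.
apply: le_trans (lowI b1); rewrite -/C [C * _]mulrC -ler_pdivrMr//.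
rewrite /b lnV ?posrE// mulrN -mulNr.
apply: (@le_trans _ _ (- N * ln n.+1%:R)); first by rewrite [- N * _]mulrC -ler_pdivrMr.
by apply: le_trans (expR_ge1Dx _); rewrite lerDr.
Unshelve. all: by end_near. Qed.
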